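(* For every integer $k\ge 2$ and every $\beta>0$ there is an $\varepsilon>0$ such that for every $p$ with $0<p<1$ the following holds. Let $G$ be a graph on $n\ge 3$ vertices with minimum degree $\delta(G)\ge \beta pn$. (a) If $G$ is $(\varepsilon,p,1,2)$-pseudorandom, then $G$ contains a square (second power) of a Hamilton cycle. (b) If $G$ is both $(\varepsilon,p,k-1,2k-1)$-pseudorandom and $(\varepsilon,p,k,k+1)$-pseudorandom, then $G$ contains a $k$th power of a Hamilton cycle.
   Context: Graphs are finite and simple. For $\varepsilon>0$, $0<p<1$ and positive integers $a\le b$, an $n$-vertex graph $G$ is $(\varepsilon,p,a,b)$-pseudorandom if $\big|e(X,Y)-p|X||Y|\big|<\varepsilon p|X||Y|$ for all disjoint $X,Y\subseteq V(G)$ with $|X|\ge\varepsilon p^{a}n$ and $|Y|\ge\varepsilon p^{b}n$, where $e(X,Y)$ is the number of edges with one endvertex in $X$ and the other in $Y$. The $k$th power of a graph $H$ is the graph on $V(H)$ in which two distinct vertices are adjacent if and only if their distance in $H$ is at most $k$. $G$ contains a $k$th power of a Hamilton cycle if it contains, as a (not necessarily induced) spanning subgraph, the $k$th power of a cycle through all vertices of $G$. *)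

(* Defs.v *)
From mathcomp Require Import all_boot all_order all_algebra reals.
Import Order.TTheory GRing.Theory Num.Theory.
Set Implicit Arguments.
Unset Strict Implicit.
Unset Printing Implicit Defensive.
Local Open Scope ring_scope.

(* A finite simple graph is a symmetric irreflexive relation e on a finType. *)

Definition deg (T : finType) (e : rel T) (x : T) : nat := #|[set y | e x y]|.

(* The default value #|T| is larger than every degree of a simple graph on a
   nonempty T, so it plays no role there. *)
Definition min_deg (T : finType) (e : rel T) : nat :=
  \big[minn/#|T|]_(x : T) deg e x.

(* Edges are unordered pairs, represented as two-element sets. *)
Definition edges_between (T : finType) (e : rel T) (X Y : {set T}) :
    {set {set T}} :=
  [set [set x; y] | x in X, y in Y & e x y].

Definition pseudorandom (R : realType) (eps p : R) (a b : nat)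
    (T : finType) (e : rel T) : Prop :=
  forall X Y : {set T}, [disjoint X & Y] ->
    eps * p ^+ a * #|T|%:R <= #|X|%:R ->
    eps * p ^+ b * #|T|%:R <= #|Y|%:R ->
    `|#|edges_between e X Y|%:R - p * #|X|%:R * #|Y|%:R|
      < eps * p * #|X|%:R * #|Y|%:R.

Definition walk (T : finType) (e : rel T) (m : nat) (x y : T) : bool :=
  [exists s : m.-tuple T, path e x s && (last x s == y)].

(* The length of a shortest walk from x to y; it is #|T| when x and y are not
   connected, which is why graph_power also tests connectedness. *)
Definition gdist (T : finType) (e : rel T) (x y : T) : nat :=
  find (fun m => walk e m x y) (iota 0 #|T|).

Lemma gdistP (T : finType) (e : rel T) (x y : T) : connect e x y ->
  walk e (gdist e x y) x y /\ (forall m, walk e m x y -> (gdist e x y <= m)%N).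
Proof.
move=> /connectP[s0 es0 ->]; case/shortenP: es0 => s es us _.
set z := last x s.
have ws : walk e (size s) x z.
  by apply/existsP; exists (in_tuple s); rewrite es eqxx.
have lts : (size s < #|T|)%N.
  by move/card_uniqP: us => /= <-; apply: max_card.
have hasw : has (fun m => walk e m x z) (iota 0 #|T|).
  by apply/hasP; exists (size s) => //; rewrite mem_iota.
have ltd : (gdist e x z < #|T|)%N by move: hasw; rewrite has_find size_iota.
split=> [|m wm]; first by have := nth_find 0%N hasw; rewrite nth_iota.
rewrite leqNgt; apply/negP => ltm.
have := before_find 0%N ltm; rewrite nth_iota ?add0n ?wm //.
exact: ltn_trans ltd.
Qed.

Definition graph_power (T : finType) (k : nat) (e : rel T) : rel T :=
  fun x y => [&& x != y, connect e x y & (gdist e x y <= k)%N].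

(* The graph of the cycle visiting the vertices in the cyclic order c. *)
Definition cycle_graph (T : finType) (c : seq T) : rel T :=
  fun x y => [&& x \in c, y \in c & (next c x == y) || (next c y == x)].

Definition has_power_Hamilton_cycle (T : finType) (k : nat) (e : rel T) : Prop :=
  exists c : seq T, [/\ (2 < size c)%N, uniq c, (forall x : T, x \in c)
    & subrel (graph_power k (cycle_graph c)) e].

(* Main.v *)
(* The proof is by absorption. The size of a common neighbourhood of [a]
   vertices is measured in units of [(p / 16) ^ a n]. Vertices of a
   configuration are chosen one after the other: for most candidates of the
   first one, for most candidates of the second one, and so on. Double counting
   allows two consecutive such choices to be exchanged whenever the two sets of
   candidates are large enough for pseudorandomness. Hence most [k]-cliques in
   prescribed sets can be reached by a short [k]-th power of a path from any
   [k]-tuple with large common neighbourhoods, and reaching the same clique from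
   two sides connects any two such [k]-tuples.

   A vertex [w] is absorbed by a short path that can be traversed, with the same
   ends, with or without [w]. In (b), [w] is inserted in the middle of the power
   of a path on [2 k] vertices in its neighbourhood; in (a), where such a path
   need not exist, the path without [w] runs backwards through two connecting
   pieces of the path with [w].

   Absorbing first the vertices with few neighbours in a reservoir [R2], and then
   most vertices of [R2] and of another reservoir [R1], gives a path in which any
   set of these vertices can be skipped. It is extended greedily until few
   vertices are left; these are absorbed by paths in [R1], the very few for which
   this fails by paths in [R2], and the cycle is closed within [R2]. The vertices
   of the reservoirs used in this way are skipped by the first part of the path.

   When the pseudorandomness condition applies to single vertices, every vertex
   is adjacent to almost all the others, and the argument is run with [p = 1]. *)
Require Import Defs.
From mathcomp Require Import all_boot all_order all_algebra reals boolp.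
From mathcomp Require Import ring lra zify.
Import Order.TTheory GRing.Theory Num.Theory.
Set Implicit Arguments.
Unset Strict Implicit.
Unset Printing Implicit Defensive.
Local Open Scope ring_scope.

(** The exponents in the hypotheses are those met by the exchanges. Moving the [k] vertices of a
    target clique ahead of the [k] vertices leading to it compares exponents below [k] with
    exponents below [2k]: this is the condition [(k-1, 2k-1)]. A path inside the neighbourhood of
    [w] starts one exponent higher and compares exponents up to [k] with exponents up to [k+1]. For
    squares the exchange of blocks would need 1 against 3, which [(1, 2)] does not give; two more
    vertices and a count of pairs replace it. One exchange turns a tolerance [d] into one of order
    [sqrt d]. Each argument makes a number of exchanges bounded in terms of [k], so its constants
    depend on neither the graph nor [p]. Sets of candidates are kept disjoint because regularity
    speaks of disjoint sets. *)

Section Cards.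
Variables (R : realType) (T : finType).
Implicit Types (P S : {set T}).

Lemma leq_card_setD P S : (#|P| <= #|P :\: S| + #|S|)%N.
Proof. by rewrite -(cardsID S P) addnC leq_add2l subset_leq_card // subsetIr. Qed.

Lemma card_setDr P S : #|P|%:R <= #|P :\: S|%:R + #|S|%:R :> R.
Proof. by rewrite -natrD ler_nat leq_card_setD. Qed.

Lemma card_setUr P S : #|P :|: S|%:R <= #|P|%:R + #|S|%:R :> R.
Proof. by rewrite -natrD ler_nat leq_card_setU. Qed.

Lemma card_subr P S : P \subset S -> #|P|%:R <= #|S|%:R :> R.
Proof. by move=> h; rewrite ler_nat subset_leq_card. Qed.

Lemma card_setCr S : #|S|%:R + #|~: S|%:R = #|T|%:R :> R.
Proof. by rewrite -natrD cardsC. Qed.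

Lemma card_set_seq (s : seq T) : (#|[set x in s]| <= size s)%N.
Proof. by rewrite cardsE card_size. Qed.

End Cards.

Lemma union_bound (R : numDomainType) (T : finType) (K : eqType) (s : seq K)
    (B : K -> {set T}) (r : R) :
  (forall k, k \in s -> #|B k|%:R <= r) ->
  exists2 W : {set T}, #|W|%:R <= (size s)%:R * r & forall k, k \in s -> B k \subset W.
Proof.
elim: s => [|k s IH] H; first by exists set0; rewrite // cards0 mul0r.
have [|W cW BW] := IH; first by move=> j js; apply: H; rewrite inE js orbT.
exists (B k :|: W) => [|j].
  rewrite /= -natr1 mulrDl mul1r addrC.
  apply: le_trans (lerD (H k _) cW); last by rewrite mem_head.
  by rewrite -natrD ler_nat leq_card_setU.
rewrite inE => /orP[/eqP->|/BW h]; first exact: subsetUl.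
exact: subset_trans h (subsetUr _ _).
Qed.

(** * Regular pairs, typical vertices and the exchange of two choices *)

Section Regular.
Variables (R : realType) (T : finType).
Implicit Types (X Y S B : {set T}) (x y : T).

Lemma card_superset_between B X m : B \subset X -> (#|B| <= m <= #|X|)%N ->
  exists B', [/\ B \subset B', B' \subset X & #|B'| = m].
Proof.
move=> BX; elim: m => [|m IH] /andP[Bm mX].
  by exists B; split=> //; apply/eqP; rewrite -leqn0.
case: (ltnP m #|B|) => [mB|Bm'].
  by exists B; split=> //; apply/eqP; rewrite eqn_leq Bm.
have [|B' [BB' B'X cB']] := IH; first by rewrite Bm' ltnW.
have: (0 < #|X :\: B'|)%N by rewrite cardsDS // cB' subn_gt0.
rewrite card_gt0 => /set0Pn[x]; rewrite inE => /andP[xB' xX].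
exists (x |: B'); split.
- exact: subset_trans BB' (subsetUr _ _).
- by rewrite subUset sub1set xX.
- by rewrite cardsU1 xB' cB'.
Qed.

(** The exceptional set is quantified, so that [P] may be any proposition, in particular another
    [most] statement. *)
Definition most (d : R) (X : {set T}) (P : T -> Prop) : Prop :=
  exists2 B : {set T}, #|B|%:R <= d * #|X|%:R &
    forall x, x \in X -> x \notin B -> P x.

Lemma most_impl d d' X (P Q : T -> Prop) : d <= d' ->
  (forall x, x \in X -> P x -> Q x) -> most d X P -> most d' X Q.
Proof.
move=> dd' PQ [B cB BP]; exists B => [|x xX xB]; last by apply: PQ => //; apply: BP.
by apply: le_trans cB _; rewrite ler_wpM2r.
Qed.

Lemma most_and d d' X (P Q : T -> Prop) :
  most d X P -> most d' X Q -> most (d + d') X (fun x => P x /\ Q x).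
Proof.
move=> [B cB BP] [B' cB' BQ]; exists (B :|: B').
  rewrite mulrDl; apply: le_trans (lerD cB cB').
  by rewrite -natrD ler_nat cardsU leq_subr.
by move=> x xX; rewrite inE negb_or => /andP[xB xB']; split; [apply: BP|apply: BQ].
Qed.

Lemma most_ex d X (P : T -> Prop) : d < 1 -> (0 < #|X|)%N -> most d X P ->
  exists2 x, x \in X & P x.
Proof.
move=> d1 X0 [B cB BP].
have [/exists_inP[x xX xB]|] := boolP [exists x in X, x \notin B].
  by exists x => //; apply: BP.
rewrite negb_exists_in => /forall_inP XB.
have XsB : X \subset B by apply/subsetP => x /XB; rewrite negbK.
have: #|X|%:R <= #|B|%:R :> R by rewrite ler_nat subset_leq_card.
have: 0 < #|X|%:R :> R by rewrite ltr0n.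
move=> h1 h2; suff: d * #|X|%:R < #|X|%:R by lra.
by rewrite gtr_pMl.
Qed.

Lemma most_exceptional d X (P : T -> Prop) (B : {set T}) :
  #|B|%:R <= d * #|X|%:R -> (forall x, x \in X -> ~ P x -> x \in B) -> most d X P.
Proof.
move=> cB H; exists B => // x xX xB; apply: contrapT => nP.
by rewrite (H _ xX nP) in xB.
Qed.

Variable e : rel T.
Definition nb x : {set T} := [set y | e x y].
Definition ecount X Y : nat := \sum_(x in X) #|Y :&: nb x|.

Hypothesis e_sym : symmetric e.

Lemma card_pairsC X Y (r : T -> T -> bool) :
  (\sum_(x in X) #|[set y in Y | r x y]| = \sum_(y in Y) #|[set x in X | r x y]|)%N.
Proof.
have E (A : {set T}) (s : pred T) : #|[set y in A | s y]| = (\sum_(y in A) s y)%N.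
  by rewrite -sum1_card -big_mkcondr; apply: eq_bigl => y; rewrite inE.
rewrite (eq_bigr _ (fun x _ => E Y (r x))) exchange_big /=.
by apply: eq_bigr => y _; rewrite E.
Qed.

Lemma ecountC X Y : ecount X Y = ecount Y X.
Proof.
rewrite /ecount.
have E (Z : {set T}) x : Z :&: nb x = [set y in Z | e x y] by apply/setP=> y; rewrite !inE.
under eq_bigr do rewrite E.
under [in RHS]eq_bigr do rewrite E.
rewrite card_pairsC; apply: eq_bigr => y _; congr #|pred_of_set _|.
by apply/setP=> x; rewrite !inE e_sym.
Qed.

Variable p : R.
(* A typical vertex is adjacent to a fraction at least [p / 8] of a given set: the
   base [p / 16] leaves a factor 2 to spare at each step. *)
Fact lev_key : unit. Proof. by []. Qed.
Definition lev (a : nat) : R :=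
  locked_with lev_key ((p / 16%:R) ^+ a * #|T|%:R).

Lemma levE a : lev a = (p / 16%:R) ^+ a * #|T|%:R.
Proof. by rewrite /lev unlock. Qed.

(** Crude two-sided bounds: the lower one provides typical vertices, the upper one serves double
    counting. With [p = 1] they also hold in a graph where every vertex is adjacent to almost all
    others. *)
Definition reg (eta : R) (a b : nat) : Prop := forall X Y, [disjoint X & Y] ->
  eta * lev a <= #|X|%:R -> eta * lev b <= #|Y|%:R ->
  p / 2%:R * #|X|%:R * #|Y|%:R <= (ecount X Y)%:R <= 2%:R * p * #|X|%:R * #|Y|%:R.

Lemma reg_sym eta a b : reg eta a b -> reg eta b a.
Proof.
move=> H X Y dXY hX hY; rewrite ecountC -!mulrA (mulrC #|X|%:R) !mulrA.
by apply: H => //; rewrite disjoint_sym.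
Qed.

Lemma split_half S : exists S1 S2, [/\ S1 :|: S2 = S, [disjoint S1 & S2],
  (#|S| <= 2 * #|S1| + 1)%N & (#|S| <= 2 * #|S2| + 1)%N].
Proof.
have [||S1 [_ S1S cS1]] := @card_superset_between set0 S #|S|./2.
- exact: sub0set.
- by rewrite cards0 /=; lia.
have h := odd_double_half #|S|.
exists S1, (S :\: S1); split.
- apply/setP=> x; rewrite !inE.
  by case: (boolP (x \in S1)) => //= /(subsetP S1S) ->.
- by rewrite -setI_eq0; apply/eqP/setP=> x; rewrite !inE; case: (x \in S1).
- by rewrite cS1; lia.
- by rewrite cardsDS // cS1; lia.
Qed.

(* Splitting [S] in two halves removes the need for [S] to be disjoint from the
   set of atypical vertices. *)
Lemma typical eta a b S : 0 < p -> reg eta a b -> 1 <= eta * lev a ->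
  0 < eta * lev b -> 3%:R * (eta * lev a) <= #|S|%:R ->
  #|[set y | #|S :&: nb y|%:R < p / 8%:R * #|S|%:R]|%:R
    <= 3%:R * (eta * lev b).
Proof.
move=> p0 Hreg ea1 eb0 hS; set Z := [set y | _].
rewrite leNgt; apply/negP => hZ.
have [S1 [S2 [S12 dS c1 c2]]] := split_half S.
have c1' : #|S|%:R <= 2%:R * #|S1|%:R + 1 :> R by rewrite -natrM -(natrD _ _ 1) ler_nat.
have c2' : #|S|%:R <= 2%:R * #|S2|%:R + 1 :> R by rewrite -natrM -(natrD _ _ 1) ler_nat.
have key S' : S' \subset S -> #|S|%:R <= 2%:R * #|S'|%:R + 1 :> R ->
    #|Z|%:R <= 2%:R * #|Z :\: S'|%:R :> R -> False.
  move=> sS' cS' cZ.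
  have h1 : eta * lev a <= #|S'|%:R by lra.
  have h2 : eta * lev b <= #|Z :\: S'|%:R by lra.
  have dd : [disjoint S' & Z :\: S'].
    by rewrite -setI_eq0; apply/eqP/setP=> x; rewrite !inE; case: (x \in S').
  have /andP[lo _] := Hreg _ _ dd h1 h2; rewrite ecountC in lo.
  have up : (ecount (Z :\: S') S')%:R <= #|Z :\: S'|%:R * (p / 8%:R * #|S|%:R).
    rewrite /ecount natr_sum mulr_natl -sumr_const.
    apply: ler_sum => x; rewrite inE => /andP[_]; rewrite inE => /ltW xZ.
    apply: le_trans xZ; rewrite ler_nat subset_leq_card //.
    exact: setSI.
  have z0 : 0 < #|Z :\: S'|%:R :> R by lra.
  have s0 : 1 <= #|S'|%:R :> R by lra.
  (* As [S'] is nonempty, the rounding gives [|S| <= 3 |S'|], and 3/8 is less than 1/2. *)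
  have : #|Z :\: S'|%:R * (p / 8%:R * #|S|%:R) < p / 2%:R * #|S'|%:R * #|Z :\: S'|%:R.
    rewrite [ltRHS]mulrC ltr_pM2l //.
    suff: p * #|S|%:R <= p * (3%:R * #|S'|%:R).
      move=> hp; have : 0 < p * #|S'|%:R by apply: mulr_gt0 => //; lra.
      by move=> hp'; lra.
    by rewrite ler_pM2l //; lra.
  lra.
(* Every vertex of [Z] lies outside one of the disjoint halves, so one of them leaves at least half
   of [Z] outside it. *)
have [h|h] := leP (#|Z|%:R : R) (2%:R * #|Z :\: S1|%:R).
  by apply: key h => //; rewrite -S12 subsetUl.
apply: (key S2) => //; first by rewrite -S12 subsetUr.
have : (#|Z| <= #|Z :\: S1| + #|Z :\: S2|)%N.
  apply: leq_trans (leq_card_setU _ _); apply: subset_leq_card.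
  apply/subsetP=> x xZ; rewrite in_setU !in_setD xZ !andbT -negb_and.
  apply/negP=> /andP[x1 x2]; move/pred0P: dS => /(_ x); rewrite /= x1 x2 //.
by rewrite -(ler_nat R) natrD; lra.
Qed.

End Regular.

Section Swap.
Variables (R : realType) (T : finType) (e : rel T) (p : R).
Hypotheses (e_sym : symmetric e) (p_gt0 : 0 < p).
Implicit Types (X Y S B : {set T}) (x y : T).
Local Notation nb := (nb e).
Local Notation lev := (lev T p).

Lemma nat_between (X : {set T}) (r : R) : 1 <= r -> r <= #|X|%:R ->
  exists m, [/\ (m <= #|X|)%N, r <= m%:R & m%:R <= 2%:R * r].
Proof.
move=> r1 rX; have ex : exists m, r <= m%:R by exists #|X|.
case: (ex_minnP ex) => m rm mmin; exists m; split=> //; first exact: mmin.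
case: m rm mmin => [|m] rm mmin; first by move: rm => /=; lra.
have [h|h] := leP r m%:R; first by have := mmin _ h; rewrite ltnn.
by rewrite -natr1; lra.
Qed.

Lemma most_bad d X P :
  most d X P -> #|[set x in X | `[< ~ P x >]]|%:R <= d * #|X|%:R :> R.
Proof.
case=> B cB BP; apply: le_trans cB; rewrite ler_nat subset_leq_card //.
apply/subsetP=> x; rewrite inE => /andP[xX /asboolP nP].
by apply/negPn/negP => xB; apply: nP; apply: BP.
Qed.

Definition pairs (r : rel T) X Y : nat := \sum_(x in X) #|[set y in Y | r x y]|.

Lemma pairs_ecount X Y : pairs e X Y = ecount e X Y.
Proof. by apply: eq_bigr => x _; congr #|pred_of_set _|; apply/setP => y; rewrite !inE. Qed.

Lemma pairs_true X Y : pairs (fun _ _ => true) X Y = (#|X| * #|Y|)%N.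
Proof.
rewrite /pairs (eq_bigr (fun=> #|Y|)) ?sum_nat_const // => x _.
by congr #|pred_of_set _|; apply/setP => y; rewrite inE andbT.
Qed.

(* Double counting of the pairs violating [Q] gives the exchange of the two
   quantifiers, provided that [r] is nearly regular between [X] and [Y]. *)
Lemma swap_most (r : rel T) (lo d d' : R) X Y (Q : T -> T -> Prop) :
  0 < lo -> 0 < d -> 0 < d' -> 32%:R * d <= d' ^+ 2 -> (0 < #|X|)%N ->
  (forall Z : {set T}, Z \subset Y -> d' / 2%:R * #|Y|%:R < #|Z|%:R ->
    lo * (#|X|%:R * #|Z|%:R) <= (pairs r X Z)%:R) ->
  (pairs r X Y)%:R <= 4%:R * lo * (#|X|%:R * #|Y|%:R) ->
  (forall B : {set T}, B \subset X -> #|B|%:R <= d * #|X|%:R ->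
    (pairs r B Y)%:R <= 8%:R * lo * (d * (#|X|%:R * #|Y|%:R))) ->
  most d X (fun x => most d [set y in Y | r x y] (Q x)) ->
  most (d' / 2%:R) Y (fun y => most d' [set x in X | r x y] (Q^~ y)).
Proof.
move=> lo0 d0 d'0 dd' X0 low upX upB /[dup] HM /most_bad.
set B := [set x in X | _] => cB.
have BX : B \subset X by apply/subsetP => x; rewrite inE => /andP[].
have Bgood x : x \in X -> x \notin B -> most d [set y in Y | r x y] (Q x).
  by move=> xX; rewrite inE xX => /asboolPn/contrapT.
pose bad x y := r x y && `[< ~ Q x y >].
(* [Z] is the set of failing [y]; the bad pairs in [X] times [Z] are counted from both sides. *)
pose Z := [set y in Y | d' * #|[set x in X | r x y]|%:R < #|[set x in X | bad x y]|%:R].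
have cZ : #|Z|%:R <= d' / 2%:R * #|Y|%:R.
  rewrite leNgt; apply/negP => hZ.
  have ZY : Z \subset Y by apply/subsetP=> y; rewrite inE => /andP[].
  have {}low := low Z ZY hZ.
  have lo' : d' * (pairs r X Z)%:R <= (\sum_(x in X) #|[set y in Z | bad x y]|)%:R.
    rewrite [pairs _ _ _]card_pairsC (card_pairsC X Z bad) !natr_sum mulr_sumr; apply: ler_sum => y.
    by rewrite inE => /andP[_ /ltW].
  have up : (\sum_(x in X) #|[set y in Z | bad x y]|)%:R
      <= d * (pairs r X Y)%:R + (pairs r B Y)%:R.
    have -> : (pairs r B Y)%:R = \sum_(x in X) (if x \in B then #|[set y in Y | r x y]|%:R else 0) :> R.
      rewrite /pairs natr_sum -big_mkcondr /=; apply: eq_bigl => x.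
      by case: (boolP (x \in B)) => [/(subsetP BX) ->|]; rewrite ?andbF.
    rewrite [pairs r X Y]/pairs !natr_sum mulr_sumr -big_split /=; apply: ler_sum => x xX.
    have sub : (#|[set y in Z | bad x y]| <= #|[set y in [set y in Y | r x y] | `[< ~ Q x y >]]|)%N.
      apply/subset_leq_card/subsetP=> y; rewrite inE => /andP[/(subsetP ZY) yY /andP[rxy nQ]].
      by rewrite inE nQ inE yY rxy.
    case: (boolP (x \in B)) => xB.
      rewrite addrC; apply: ler_wpDr; first by rewrite mulr_ge0 // ltW.
      rewrite ler_nat; apply: leq_trans sub _; apply: subset_leq_card.
      by apply/subsetP=> y; rewrite inE => /andP[].
    by rewrite addr0; apply: le_trans (most_bad (Bgood _ xX xB)); rewrite ler_nat.
  (* In units of [lo |X| |Y|], the count is more than [d'^2 / 2], hence more than [16 d], but at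
     most [4 d + 8 d]. *)
  have X1 : 0 < #|X|%:R :> R by rewrite ltr0n.
  have h1 := upB B BX cB.
  have h2 : (d' * lo * #|X|%:R) * (d' / 2%:R * #|Y|%:R) < (d' * lo * #|X|%:R) * #|Z|%:R.
    by rewrite ltr_pM2l // !mulr_gt0.
  have h3 : d' * (lo * (#|X|%:R * #|Z|%:R)) <= d' * (pairs r X Z)%:R by rewrite ler_pM2l.
  have h4 : d * (pairs r X Y)%:R <= d * (4%:R * lo * (#|X|%:R * #|Y|%:R)) by rewrite ler_pM2l.
  have W0 : 0 <= lo * (#|X|%:R * #|Y|%:R) by rewrite !mulr_ge0 // ltW.
  have h5 : 32%:R * d * (lo * (#|X|%:R * #|Y|%:R)) <= d' ^+ 2 * (lo * (#|X|%:R * #|Y|%:R)).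
    by rewrite ler_wpM2r.
  have h6 : 0 <= d * (lo * (#|X|%:R * #|Y|%:R)) by rewrite mulr_ge0 // ltW.
  by move: h1 h2 h3 h4 h5 h6 lo' up; clear; move=> *; lra.
apply: (most_exceptional cZ) => y yY nM; rewrite inE yY ltNge; apply/negP => h; apply: nM.
exists [set x in X | bad x y] => // x; rewrite inE => /andP[xX rxy].
by rewrite inE xX /bad rxy /= => /asboolPn/contrapT.
Qed.

Lemma swap_reg eta a b d d' X Y (Q : T -> T -> Prop) :
  reg e p eta a b -> [disjoint X & Y] ->
  0 < d -> d <= 2%:R^-1 -> 0 < d' -> d' <= 1 -> 32%:R * d <= d' ^+ 2 ->
  1 <= eta * lev a -> eta * lev a <= d * #|X|%:R ->
  0 < eta * lev b -> eta * lev b <= d' / 2%:R * #|Y|%:R ->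
  most d X (fun x => most d [set y in Y | e x y] (Q x)) ->
  most (d' / 2%:R) Y (fun y => most d' [set x in X | e x y] (Q^~ y)).
Proof.
move=> Hreg dXY d0 d2 d'0 d'1 dd' ea1 eaX eb0 ebY.
have Y0 : 0 <= #|Y|%:R :> R by [].
have dX : d * #|X|%:R <= #|X|%:R by apply: ler_piMl => //; lra.
have aX : eta * lev a <= #|X|%:R by lra.
have bY : eta * lev b <= #|Y|%:R.
  by apply: le_trans ebY _; apply: ler_piMl => //; lra.
apply: (swap_most (lo := p / 2%:R)) => //; first by rewrite divr_gt0.
- by rewrite -(ltr0n R); lra.
- move=> Z ZY hZ; rewrite pairs_ecount.
  have dXZ : [disjoint X & Z] by apply: disjointWr ZY dXY.
  have bZ : eta * lev b <= #|Z|%:R by lra.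
  by have /andP[+ _] := Hreg _ _ dXZ aX bZ; rewrite !mulrA.
- rewrite pairs_ecount; have /andP[_] := Hreg _ _ dXY aX bY.
  have -> : 2%:R * p * #|X|%:R * #|Y|%:R = 4%:R * (p / 2%:R) * (#|X|%:R * #|Y|%:R) by field.
  by [].
move=> B0 B0X cB0.
(* [B0] may be too small for regularity. It is enlarged to a subset of [X] of size between [d |X|]
   and [2 d |X|], which doubles the bound on the pairs. *)
have [m [mX dm md]] := nat_between (le_trans ea1 eaX) dX.
have [|B [B0B BX cB]] := @card_superset_between T B0 X m B0X.
  by rewrite mX andbT -(ler_nat R); apply: le_trans cB0 dm.
have dBY : [disjoint B & Y] by apply: disjointWl BX dXY.
have aB : eta * lev a <= #|B|%:R by rewrite cB; lra.
have /andP[_ up] := Hreg _ _ dBY aB bY.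
apply: (@le_trans _ _ (ecount e B Y)%:R).
  by rewrite pairs_ecount ler_nat /ecount [leqRHS](big_setID B0) /= (setIidPr B0B) leq_addr.
apply: le_trans up _.
have h : (2%:R * p * #|Y|%:R) * #|B|%:R <= (2%:R * p * #|Y|%:R) * (2%:R * (d * #|X|%:R)).
  by apply: ler_wpM2l; [rewrite !mulr_ge0 // ltW | rewrite cB].
by move: h; clear => h; lra.
Qed.

(** Exchange of two choices between which no adjacency is required: all pairs count, and [lo = 1/4]
    turns the upper bound [4 lo] into 1. *)
Lemma swap_all (d d' : R) X Y (Q : T -> T -> Prop) :
  0 < d -> 0 < d' -> 32%:R * d <= d' ^+ 2 -> (0 < #|X|)%N ->
  most d X (fun x => most d [set y in Y | true] (Q x)) ->
  most (d' / 2%:R) Y (fun y => most d' [set x in X | true] (Q^~ y)).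
Proof.
move=> d0 d'0 dd' X0.
apply: (@swap_most (fun _ _ => true) 4%:R^-1) => //; rewrite ?invr_gt0 //.
- move=> Z _ _; rewrite pairs_true natrM; apply: ler_piMl; last by lra.
  by rewrite mulr_ge0.
- by rewrite pairs_true natrM mulfV ?mul1r // pnatr_eq0.
move=> B _ cB; rewrite pairs_true natrM.
have := ler_wpM2r (ler0n R #|Y|) cB; have : 0 <= #|B|%:R * #|Y|%:R :> R by rewrite mulr_ge0.
by clear => h1 h2; lra.
Qed.

End Swap.

(** * Iterated choices of typical vertices *)

Section GoodGraph.
Variables (R : realType) (T : finType) (e : rel T) (p : R) (rg : rel nat).

(* [rg a b]: regularity is available between sets of sizes of order [p ^ a n] and
   [p ^ b n]. *)
Record good_graph (eta : R) : Prop := GoodGraph {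
  gg_p0 : 0 < p;
  gg_p1 : p <= 1;
  gg_sym : symmetric e;
  gg_irr : irreflexive e;
  gg_rg : symmetric rg;
  gg_n : (0 < #|T|)%N;
  gg_eta : 0 < eta;
  gg_reg : forall a b, rg a b -> reg e p eta a b;
  gg_big : forall a b, rg a b -> 1 <= eta * lev T p a }.

Lemma lev_gt0 eta a : good_graph eta -> 0 < lev T p a.
Proof.
by case=> p0 *; rewrite levE mulr_gt0 ?exprn_gt0 ?divr_gt0 // ltr0n.
Qed.

Lemma levS a : lev T p a.+1 = p / 16%:R * lev T p a.
Proof. by rewrite !levE exprS mulrA. Qed.

Lemma le_lev eta a b : good_graph eta -> (a <= b)%N -> lev T p b <= lev T p a.
Proof.
move=> gg; have p0 := gg_p0 gg; have p1 := gg_p1 gg.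
move=> ab; rewrite !levE ler_wpM2r //; apply: ler_wiXn2l => //; lra.
Qed.

Lemma good_graph_le eta eta' : eta <= eta' -> good_graph eta -> good_graph eta'.
Proof.
move=> le gg; have lv a := lev_gt0 a gg; case: gg => p0 p1 es ei rs n0 e0 Hr Hb.
have le' a : eta * lev T p a <= eta' * lev T p a by rewrite ler_wpM2r // ltW.
split=> // [|a b rab X Y dXY hX hY|a b rab].
- exact: lt_le_trans e0 le.
- by apply: Hr rab _ _ dXY _ _; apply: le_trans (le' _) _.
- exact: le_trans (Hb _ _ rab) (le' _).
Qed.

End GoodGraph.

Section Nested.
Variables (R : realType) (T : finType) (e : rel T) (p : R) (rg : rel nat).
Variables (eta rho : R) (adj : rel nat).
Hypothesis gg : good_graph e p rg eta.
Hypothesis adj_sym : symmetric adj.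
Hypothesis adj_irr : irreflexive adj.
Hypothesis rho_gt0 : 0 < rho.
Local Notation nb := (nb e).
Local Notation lev := (lev T p).

(* [((j, b), Y)]: the vertex labelled [j] is to be chosen in [Y], a set whose
   size is of order at least [p ^ b n]. *)
Definition item := ((nat * nat) * {set T})%type.
Implicit Types (I J K : item) (l ps : seq item) (c : seq (nat * T)) (d : R).

Definition cand I c : {set T} :=
  [set y in I.2 | all (fun u => adj u.1 I.1.1 ==> e u.2 y) c].
(** The power of [p] to be expected in the size of the candidate set: that of the pool, plus one for
    each neighbouring label already chosen. *)
Definition expo (k : nat * nat) (s : seq nat) : nat := (k.2 + count (adj^~ k.1) s)%N.
Definition sized I c : Prop :=
  rho * lev (expo I.1 (unzip1 c)) <= #|cand I c|%:R.
Definition all_sized l c : Prop := forall I, I \in l -> sized I c.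

(* For most choices of the first vertex among its candidates, for most choices
   of the second one among its candidates, etc., the property [L] holds. *)
Fixpoint nested d l c (L : seq (nat * T) -> Prop) : Prop :=
  if l is J :: l' then
    all_sized l c /\ most d (cand J c) (fun y => nested d l' ((J.1.1, y) :: c) L)
  else L c.

(** Exchanges permute the list of choices, so the final property must not depend on its order. *)
Definition perm_inv (L : seq (nat * T) -> Prop) : Prop :=
  forall c c', perm_eq c c' -> L c -> L c'.

Lemma cand_perm I c c' : perm_eq c c' -> cand I c = cand I c'.
Proof. by move=> cc; apply/setP=> y; rewrite !inE (perm_all _ cc). Qed.

Lemma expo_perm k s s' : perm_eq s s' -> expo k s = expo k s'.
Proof. by move=> /permP ss; rewrite /expo ss. Qed.

Lemma all_sized_perm l : perm_inv (all_sized l).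
Proof.
move=> c c' cc H I Il; rewrite /sized -(cand_perm _ cc).
by rewrite -(expo_perm _ (perm_map _ cc)); apply: H.
Qed.

Lemma all_sized_sub l l' c : {subset l' <= l} -> all_sized l c -> all_sized l' c.
Proof. by move=> ll' H I /ll'; apply: H. Qed.

Lemma nested_perm d l c c' L : perm_inv L -> perm_eq c c' ->
  nested d l c L -> nested d l c' L.
Proof.
move=> HL; elim: l c c' => [|I l IH] c c' cc /=; first exact: HL.
case=> sz M; split; first exact: all_sized_perm cc sz.
rewrite -(cand_perm _ cc); apply: most_impl M => // y _; apply: IH.
by rewrite perm_cons.
Qed.

Lemma nested_impl d d' l c (L L' : seq (nat * T) -> Prop) : d <= d' ->
  (forall c', L c' -> L' c') -> nested d l c L -> nested d' l c L'.
Proof.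
move=> dd' LL'; elim: l c => [|I l IH] c /=; first exact: LL'.
by case=> sz M; split=> //; apply: most_impl M => // y _; apply: IH.
Qed.

Lemma nested_split d l1 l2 c L :
  nested d (l1 ++ l2) c L -> nested d l1 c (fun c' => nested d l2 c' L).
Proof.
elim: l1 c => [|I l1 IH] c //= [sz M]; split.
  by apply: all_sized_sub sz => J; rewrite -cat_cons mem_cat => ->.
by apply: most_impl M => // y _; apply: IH.
Qed.

(** What is known after the choices in [l1] survives those in [l2] by monotonicity; the exceptional
    sets add up only along [l1]. *)
Lemma nested_and d d' l1 l2 c (L L' : seq (nat * T) -> Prop) :
  (forall u c, L' c -> L' (u :: c)) ->
  nested d (l1 ++ l2) c L -> nested d' l1 c L' ->
  0 <= d' -> nested (d + d') (l1 ++ l2) c (fun c => L c /\ L' c).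
Proof.
move=> mono H1 H2 d'0; elim: l1 c H1 H2 => [|I l1 IH] c /=.
  elim: l2 c => [|J l2 IH] c //= [sz M] L'c; split=> //.
  apply: most_impl M => [|y _ H]; first by rewrite lerDl.
  by apply: IH => //; apply: mono.
move=> [sz M] [_ M']; split=> //.
apply: most_impl (most_and M M') => // y _ [].
exact: IH.
Qed.

Definition wf c : Prop :=
  forall u v, u \in c -> v \in c -> adj u.1 v.1 -> e u.2 v.2.

Lemma wf_cons I c y : wf c -> y \in cand I c -> wf ((I.1.1, y) :: c).
Proof.
move=> wc; rewrite inE => /andP[_ /allP H] u v.
rewrite !inE => /orP[/eqP->|uc] /orP[/eqP->|vc] /=.
- by rewrite adj_irr.
- by move=> a; have := H _ vc; rewrite adj_sym a /= (gg_sym gg).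
- by move=> a; have := H _ uc; rewrite a.
- exact: wc.
Qed.

Lemma sized_gt0 I c : sized I c -> (0 < #|cand I c|)%N.
Proof.
move=> H; rewrite -(ltr0n R); apply: lt_le_trans H.
by rewrite mulr_gt0 // (lev_gt0 _ gg).
Qed.

(** A tolerance below 1 and a nonempty candidate set leave an admissible choice at each step. *)
Lemma nested_ex d l c L : d < 1 -> uniq [seq J.1.1 | J <- l] -> wf c ->
  nested d l c L ->
  exists c', [/\ wf (c' ++ c), L (c' ++ c),
    unzip1 c' = rev [seq J.1.1 | J <- l] &
    forall I u, I \in l -> u \in c' -> u.1 = I.1.1 -> u.2 \in I.2].
Proof.
move=> d1; elim: l c => [|I l IH] c /=.
  by move=> _ wc Lc; exists [::].
case/andP=> Il ul wc [sz M].
have I0 : (0 < #|cand I c|)%N by apply: sized_gt0; apply: sz; rewrite mem_head.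
have [y yI] := most_ex d1 I0 M.
case/(IH _ ul (wf_cons wc yI)) => c' [wc' Lc' c'l c'in].
exists (rcons c' (I.1.1, y)); rewrite cat_rcons; split=> //.
  by rewrite /unzip1 map_rcons -/(unzip1 _) c'l rev_cons.
move=> J u; rewrite inE mem_rcons inE => /orP[/eqP->|Jl] /orP[/eqP->|uc] //=.
- by move: yI; rewrite inE => /andP[].
- move=> uI; case/negP: Il; rewrite -uI -mem_rev -c'l; exact: map_f.
- by move=> IJ; case/negP: Il; rewrite IJ; apply/mapP; exists J.
- exact: c'in.
Qed.

Lemma cand_cons I c i y : cand I ((i, y) :: c) =
  if adj i I.1.1 then cand I c :&: nb y else cand I c.
Proof.
apply/setP=> x; case: ifP => a; rewrite !inE /= a //=.
by rewrite andbA andbAC.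
Qed.

Lemma expo_cons k i s : expo k (i :: s) = (expo k s + adj i k.1)%N.
Proof. by rewrite /expo /= addnCA addnC. Qed.

(** A vertex typical for a candidate set keeps a fraction [p / 8] of it, twice what the increased
    exponent charges. Each neighbouring label excludes at most [3 eta lev] vertices, by
    [typical]. *)
Lemma typical_step I c l : 3%:R * eta <= rho ->
  (forall K, K \in l -> adj I.1.1 K.1.1 ->
     rg (expo I.1 (unzip1 c)) (expo K.1 (unzip1 c))) ->
  all_sized l c ->
  exists2 W : {set T}, #|W|%:R <= (size l)%:R * (3%:R * (eta * lev (expo I.1 (unzip1 c)))) &
    forall y, y \notin W -> all_sized l ((I.1.1, y) :: c).
Proof.
move=> eta_rho Hrg sz.
have lv a := lev_gt0 a gg; have e0 := gg_eta gg; have p0 := gg_p0 gg.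
pose B K := if adj I.1.1 K.1.1 then
  [set y | #|cand K c :&: nb y|%:R < p / 8%:R * #|cand K c|%:R] else set0.
have [|W cW BW] := @union_bound R T _ l B (3%:R * (eta * lev (expo I.1 (unzip1 c)))).
  move=> K Kl; rewrite /B; case: ifP => a; last first.
    by rewrite cards0; apply: mulr_ge0 => //; apply: mulr_ge0; apply: ltW => //; apply: lv.
  have rIK := Hrg _ Kl a; have rKI := rIK; rewrite (gg_rg gg) in rKI.
  apply: (typical (gg_sym gg) p0 (gg_reg gg rKI)).
  - exact: (gg_big gg rKI).
  - by rewrite mulr_gt0.
  - by apply: le_trans (sz _ Kl); rewrite mulrA ler_wpM2r // ltW.
exists W => // y yW K Kl; rewrite /sized cand_cons /= expo_cons.
have yB : y \notin B K by apply: contraNN yW; apply: (subsetP (BW _ Kl)).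
move: yB; rewrite /B; case: (adj _ _); last by rewrite addn0 => _; apply: sz.
rewrite addn1 levS inE -leNgt; apply: le_trans.
have h := sz _ Kl; rewrite /sized in h; have lv' := lv (expo K.1 (unzip1 c)).
apply: (@le_trans _ _ (p / 8%:R * (rho * lev (expo K.1 (unzip1 c))))).
  have : 0 < rho * p * lev (expo K.1 (unzip1 c)) by rewrite !mulr_gt0.
  by move=> h'; lra.
by rewrite ler_wpM2l // divr_ge0 // ltW.
Qed.

(** The regularity used by successive choices depends on exponents only, so it can be checked by
    computation for explicit lists and by arithmetic for paths. The labels in [ps] are never chosen;
    their candidate sets are only watched. *)
Fixpoint init_ok (s : seq nat) (l ps : seq (nat * nat)) : bool :=
  if l is i :: l' then
    all (fun k => adj i.1 k.1 ==> rg (expo i s) (expo k s)) (l' ++ ps)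
    && init_ok (i.1 :: s) l' ps
  else true.

(** The atypical vertices and the candidates are both measured by [lev] of the same exponent, so
    their ratio does not involve [p]. *)
Lemma nested_init d l ps c :
  init_ok (unzip1 c) (unzip1 l) (unzip1 ps) -> all_sized (l ++ ps) c ->
  3%:R * eta <= rho -> 3%:R * (size (l ++ ps))%:R * eta <= d * rho ->
  nested d l c (all_sized ps).
Proof.
move=> + + eta_rho; elim: l c => [|I l IH] c //= /andP[ok1 ok2] sz small.
split; first by apply: all_sized_sub sz => J; rewrite -cat_cons mem_cat => ->.
have lv a := lev_gt0 a gg; have e0 := gg_eta gg.
have [||W cW HW] := @typical_step I c (l ++ ps) eta_rho.
- move=> K Kl; apply/implyP; apply: (allP ok1).
  by rewrite /unzip1 -map_cat; apply: (map_f fst).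
- by apply: all_sized_sub sz => J; rewrite inE orbC => ->.
exists W.
  apply: le_trans cW _.
  apply: (@le_trans _ _ (d * (rho * lev (expo I.1 (unzip1 c))))).
    rewrite !mulrA; apply: ler_wpM2r; first exact: ltW.
    apply: le_trans small; apply: ler_wpM2r; first exact: ltW.
    by rewrite mulrC ler_wpM2l // ler_nat.
  apply: ler_wpM2l; last by apply: sz; rewrite mem_head.
  rewrite -(pmulr_lge0 _ rho_gt0); apply: le_trans small.
  by rewrite !mulr_ge0 // ltW.
move=> y yI yW; apply: IH => //; first exact: HW.
apply: le_trans small; apply: ler_wpM2r; first exact: ltW.
by rewrite ler_wpM2l // ler_nat.
Qed.

End Nested.

Section DSeq.
Variable R : realType.
(** The recursion is the case of equality in [32 d <= d'^2]: a statement with tolerance [tol m] can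
    undergo [m] exchanges and end at [tol 0 = 1/4], small enough for two such statements to hold
    together. It is locked so that arithmetic treats it as an atom. *)
Definition tol (m : nat) : R :=
  locked_with lev_key (iter m (fun d => d ^+ 2 / 32%:R) 4%:R^-1).

Lemma tolS m : 32%:R * tol m.+1 = tol m ^+ 2.
Proof. by rewrite /tol !unlock iterS; field. Qed.

Lemma tol_gt0 m : 0 < tol m.
Proof.
rewrite /tol unlock; elim: m => [|m IH]; first by rewrite invr_gt0.
by rewrite iterS divr_gt0 // exprn_gt0.
Qed.

Lemma tol_le4 m : tol m <= 4%:R^-1.
Proof.
elim: m => [|m IH]; first by rewrite /tol unlock.
have := tolS m; have := tol_gt0 m; rewrite expr2.
by move: IH; nra.
Qed.

Lemma tol_le a b : (a <= b)%N -> tol b <= tol a.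
Proof.
move/subnK <-; elim: (b - a)%N => // m IH; rewrite addSn; apply: le_trans IH.
have := tolS (m + a); have := tol_gt0 (m + a); have := tol_le4 (m + a).
by rewrite expr2; nra.
Qed.

End DSeq.

Section Swapping.
Variables (R : realType) (T : finType) (e : rel T) (p : R) (rg : rel nat).
Variables (eta rho : R) (adj : rel nat).
Hypothesis gg : good_graph e p rg eta.
Hypothesis adj_sym : symmetric adj.
Hypothesis adj_irr : irreflexive adj.
Hypothesis rho_gt0 : 0 < rho.
Local Notation nb := (nb e).
Local Notation lev := (lev T p).
Local Notation item := (item T).
Local Notation nested := (nested e p rho adj).
Local Notation cand := (cand e adj).
Local Notation expo := (expo adj).
Local Notation all_sized := (all_sized e p rho adj).
Local Notation tol := (tol R).
Implicit Types (I J K : item) (l ps : seq item) (c : seq (nat * T)) (d : R).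

Lemma nested_swap d d' I J l c L : perm_inv L ->
  0 < d -> d <= d' -> d' <= 4%:R^-1 -> 32%:R * d <= d' ^+ 2 ->
  [disjoint I.2 & J.2] ->
  (adj I.1.1 J.1.1 -> rg (expo I.1 (unzip1 c)) (expo J.1 (unzip1 c))) ->
  (forall K, K \in l -> adj J.1.1 K.1.1 ->
    rg (expo J.1 (unzip1 c)) (expo K.1 (unzip1 c))) ->
  6%:R * (size l).+2%:R * eta <= d * rho ->
  nested d (I :: J :: l) c L -> nested d' (J :: I :: l) c L.
Proof.
move=> HL d0 dd' d'4 d32 dIJ rIJ rJK small [sz M].
have lv a := lev_gt0 a gg; have e0 := gg_eta gg; have p0 := gg_p0 gg.
have d'0 : 0 < d' by exact: lt_le_trans dd'.
have l1 : 1 <= (size l).+1%:R :> R by rewrite ler1n.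
have l2 : (size l).+2%:R = (size l).+1%:R + 1 :> R by rewrite -[in LHS]natr1.
have el : eta <= (size l).+1%:R * eta by rewrite ler_peMl // ltW.
have drho : d * rho <= d' * rho by rewrite ler_wpM2r // ltW.
have drho1 : d * rho <= rho by apply: ler_piMl; [exact: ltW|lra].
rewrite l2 in small.
have [|||W cW HW] := typical_step (adj := adj) (I := J) (c := c) (l := I :: l) gg rho_gt0.
- by nra.
- move=> K; rewrite inE => /orP[/eqP-> a|Kl]; last exact: rJK.
  by rewrite (gg_rg gg); apply: rIJ; rewrite adj_sym.
- by apply: all_sized_sub sz => K; rewrite !inE => /orP[->|->]; rewrite ?orbT.
have szJ : rho * lev (expo J.1 (unzip1 c)) <= #|cand J c|%:R.
  by apply: sz; rewrite !inE eqxx orbT.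
have szI : rho * lev (expo I.1 (unzip1 c)) <= #|cand I c|%:R.
  by apply: sz; rewrite mem_head.
(* Half of [d'] pays for keeping the other candidate sets large after the choice for [J], the other
   half for the exchange itself. *)
have mW : most (d' / 2%:R) (cand J c) (fun y => all_sized (I :: l) ((J.1.1, y) :: c)).
  exists W => [|y _]; last exact: HW.
  apply: le_trans cW _; rewrite /=.
  apply: (@le_trans _ _ (d' / 2%:R * (rho * lev (expo J.1 (unzip1 c))))); last first.
    by apply: ler_wpM2l szJ; rewrite divr_ge0 // ltW.
  have : (size l).+1%:R * 3%:R * eta <= d' / 2%:R * rho by lra.
  by move=> /(ler_wpM2r (ltW (lv (expo J.1 (unzip1 c))))); rewrite -!mulrA.
suff mQ : most (d' / 2%:R) (cand J c) (fun y => most d' (cand I ((J.1.1, y) :: c))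
    (fun x => nested d l ((J.1.1, y) :: (I.1.1, x) :: c) L)).
  split; first by apply: all_sized_sub sz => K; rewrite !inE orbCA.
  apply: most_impl (most_and mW mQ) => [|y _ [sy my]]; first by lra.
  split=> //; apply: most_impl my => // x _.
  move/(nested_impl dd' (fun c h => h)); apply: nested_perm => //.
  by apply/permP=> a /=; rewrite addnCA.
have disj : [disjoint cand I c & cand J c].
  apply: disjointWl (disjointWr _ dIJ); first by apply/subsetP=> x; rewrite inE => /andP[].
  by apply/subsetP=> x; rewrite inE => /andP[].
have E x : cand J ((I.1.1, x) :: c) = [set y in cand J c | adj I.1.1 J.1.1 ==> e x y].
  by apply/setP => y; rewrite !inE /= andbCA andbC.
have E' y : cand I ((J.1.1, y) :: c) = [set x in cand I c | adj I.1.1 J.1.1 ==> e x y].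
  by apply/setP => x; rewrite !inE /= andbCA andbC adj_sym (gg_sym gg).
have {}M : most d (cand I c) (fun x => most d [set y in cand J c | adj I.1.1 J.1.1 ==> e x y]
    (fun y => nested d l ((J.1.1, y) :: (I.1.1, x) :: c) L)).
  by apply: most_impl M => // x _ []; rewrite E.
suff : most (d' / 2%:R) (cand J c) (fun y => most d' [set x in cand I c | adj I.1.1 J.1.1 ==> e x y]
    (fun x => nested d l ((J.1.1, y) :: (I.1.1, x) :: c) L)).
  by apply: most_impl => // y _; rewrite E'.
move: M; case: (boolP (adj I.1.1 J.1.1)) => [a|_] /= M; last first.
  by apply: swap_all d0 d'0 d32 _ M; exact: (sized_gt0 gg rho_gt0 szI).
have r := rIJ a; have r' := r; rewrite (gg_rg gg) in r'.
apply: (swap_reg p0 (gg_reg gg r) disj d0 _ d'0 _ d32 (gg_big gg r) _ _ _ M).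
- lra.
- lra.
- apply: le_trans (ler_wpM2l (ltW d0) szI); rewrite mulrA.
  by apply: ler_wpM2r; [exact: ltW|nra].
- by rewrite mulr_gt0.
- have d2 : 0 <= d' / 2%:R by rewrite divr_ge0 // ltW.
  apply: le_trans (ler_wpM2l d2 szJ); rewrite mulrA.
  by apply: ler_wpM2r; [exact: ltW|lra].
Qed.

(** The conditions of the successive exchanges that carry [j] to the front of [l1]: [j] is exchanged
    with each entry [i], and must be typical for all that follows. *)
Fixpoint move_ok (s : seq nat) (l1 : seq (nat * nat)) (j : nat * nat)
    (l2 : seq (nat * nat)) : bool :=
  if l1 is i :: l1' then
    [&& adj i.1 j.1 ==> rg (expo i s) (expo j s),
      all (fun k => adj j.1 k.1 ==> rg (expo j s) (expo k s)) (l1' ++ l2)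
      & move_ok (i.1 :: s) l1' j l2]
  else true.

Lemma nested_move m M N l1 J l2 c L : perm_inv L ->
  (forall I, I \in l1 -> [disjoint I.2 & J.2]) ->
  move_ok (unzip1 c) (unzip1 l1) J.1 (unzip1 l2) ->
  (size (l1 ++ l2) < N)%N -> (m + size l1 <= M)%N ->
  6%:R * N%:R * eta <= tol M * rho ->
  nested (tol (m + size l1)) (l1 ++ J :: l2) c L ->
  nested (tol m) (J :: l1 ++ l2) c L.
Proof.
move=> HL; elim: l1 m c => [|I l1 IH] m c dis; first by rewrite addn0.
rewrite /= -/(unzip1 l1) -/(unzip1 l2) => /and3P[ok1 ok2 ok3] sN mM small [sz M'].
have e0 := gg_eta gg.
have tm : tol m.+1 <= tol m by apply: tol_le.
apply: (@nested_swap (tol m.+1)) => //.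
- exact: tol_gt0.
- exact: tol_le4.
- by rewrite tolS.
- by apply: dis; rewrite mem_head.
- by move=> a; move: ok1; rewrite a.
- move=> K Kl; apply/implyP; apply: (allP ok2).
  by rewrite -map_cat; apply: map_f.
- apply: (@le_trans _ _ (6%:R * N%:R * eta)).
    by rewrite ler_pM2r // ler_pM2l // ler_nat.
  apply: le_trans small _; rewrite ler_pM2r //; apply: tol_le.
  by apply: leq_trans mM; rewrite addnS ltnS leq_addr.
split.
  apply: all_sized_sub sz => K; rewrite !(inE, mem_cat).
  by case: (K == I); case: (K == J); case: (K \in l1); case: (K \in l2).
move: M'; apply: most_impl => [|x _]; first by apply: tol_le; rewrite addnS ltnS leq_addr.
rewrite -addSnnS; apply: IH => //.
- by move=> K Kl; apply: dis; rewrite inE Kl orbT.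
- exact: ltnW.
- by rewrite addSnnS.
Qed.

Fixpoint block_ok (s : seq nat) (l1 l2 : seq (nat * nat)) : bool :=
  if l2 is j :: l2' then move_ok s l1 j l2' && block_ok (j.1 :: s) l1 l2'
  else true.

Lemma nested_block m M N l1 l2 c L : perm_inv L ->
  (forall I J, I \in l1 -> J \in l2 -> [disjoint I.2 & J.2]) ->
  block_ok (unzip1 c) (unzip1 l1) (unzip1 l2) ->
  (size (l1 ++ l2) <= N)%N -> (m + size l1 * size l2 <= M)%N ->
  6%:R * N%:R * eta <= tol M * rho ->
  nested (tol (m + size l1 * size l2)) (l1 ++ l2) c L ->
  nested (tol m) (l2 ++ l1) c L.
Proof.
move=> HL; elim: l2 c => [|J l2 IH] c dis.
  by rewrite cats0 muln0 addn0.
rewrite [unzip1 (J :: l2)]/= => /andP[ok1 ok2] sN mM small.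
rewrite /= mulnS addnCA addnC => H.
have : nested (tol (m + size l1 * size l2)) (J :: l1 ++ l2) c L.
  apply: (@nested_move _ M N) => //.
  - by move=> I Il; apply: dis => //; rewrite mem_head.
  - by move: sN; rewrite !size_cat /= addnS.
  - by move: mM; rewrite /= mulnS; lia.
case=> sz M'; split.
  apply: all_sized_sub sz => K; rewrite !(inE, mem_cat).
  by case: (K == J); case: (K \in l1); case: (K \in l2).
apply: most_impl M' => [|x _]; first by apply: tol_le; rewrite leq_addr.
apply: IH => //.
- by move=> I K Il Kl; apply: dis => //; rewrite inE Kl orbT.
- by move: sN; rewrite !size_cat /= addnS => /ltnW.
- by move: mM; rewrite /= mulnS; lia.
Qed.

Fixpoint rev_ok (s : seq nat) (l : seq (nat * nat)) : bool :=
  if l is j :: l' then move_ok s (rev l') j [::] && rev_ok (j.1 :: s) l'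
  else true.

(** The head of [l], which is last in [rev l], is moved to the front and the rest is treated
    recursively; the square of the length bounds the number of exchanges. *)
Lemma nested_rev m M N l c L : perm_inv L ->
  {in l &, forall I J, I != J -> [disjoint I.2 & J.2]} -> uniq l ->
  rev_ok (unzip1 c) (unzip1 l) ->
  (size l <= N)%N -> (m + size l * size l <= M)%N ->
  6%:R * N%:R * eta <= tol M * rho ->
  nested (tol (m + size l * size l)) (rev l) c L -> nested (tol m) l c L.
Proof.
move=> HL; elim: l c => [|J l IH] c dis; first by rewrite addn0.
rewrite [unzip1 (J :: l)]/= => /andP[Jl ul] /andP[ok1 ok2] sN mM small.
rewrite rev_cons -cats1 => H.
have le1 : (m + size l * size l + size l <= m + (size l).+1 * (size l).+1)%N by lia.
have : nested (tol (m + size l * size l)) (J :: rev l ++ [::]) c L.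
  apply: (@nested_move _ M N) => //.
  - move=> I Il; rewrite mem_rev in Il; apply: dis; rewrite ?inE ?Il ?eqxx ?orbT //.
    by apply: contraNneq Jl => <-.
  - by rewrite /unzip1 map_rev.
  - by rewrite cats0 size_rev.
  - by rewrite size_rev; apply: leq_trans le1 mM.
  - apply: nested_impl H => //; apply: tol_le; rewrite size_rev.
    exact: le1.
rewrite cats0; case=> sz M'; split.
  by apply: all_sized_sub sz => K; rewrite !inE mem_rev.
apply: most_impl M' => [|x _]; first by apply: tol_le; rewrite leq_addr.
apply: IH => //.
- by move=> I K Il Kl; apply: dis; rewrite inE ?Il ?Kl orbT.
- exact: ltnW.
- by apply: leq_trans mM; rewrite /=; lia.
Qed.

End Swapping.

Section Relabel.
Variables (R : realType) (T : finType) (e : rel T) (p rho : R).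
Variables (adj adj' : rel nat) (g : nat -> nat).

Definition relabel (I : item T) : item T := ((g I.1.1, I.1.2), I.2).

(** Candidate sets and exponents see labels only through adjacency, and only those in use, which [S]
    contains. So [g] may be a truncated subtraction. *)
Lemma nested_relabel d l c (L L' : seq (nat * T) -> Prop) (S : {pred nat}) :
  {in S &, forall i j, adj i j = adj' (g i) (g j)} ->
  {subset unzip1 c <= S} -> {subset [seq J.1.1 | J <- l] <= S} ->
  (forall c, L c -> L' [seq (g u.1, u.2) | u <- c]) ->
  nested e p rho adj d l c L ->
  nested e p rho adj' d (map relabel l) [seq (g u.1, u.2) | u <- c] L'.
Proof.
move=> ag + + LL'.
have step c0 J : {subset unzip1 c0 <= S} -> J.1.1 \in S ->
    cand e adj' (relabel J) [seq (g u.1, u.2) | u <- c0] = cand e adj J c0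
    /\ expo adj' (relabel J).1 (unzip1 [seq (g u.1, u.2) | u <- c0]) =
       expo adj J.1 (unzip1 c0).
  move=> cS JS; split.
    apply/setP=> y; rewrite !inE all_map /=; congr (_ && _).
    by apply: eq_in_all => u uc /=; rewrite ag //; apply: cS; apply: map_f.
  rewrite /expo /unzip1 -map_comp !count_map /=; congr (_ + _)%N.
  by apply: eq_in_count => u uc /=; rewrite ag //; apply: cS; apply: map_f.
elim: l c => [|J l IH] c cS lS /=; first exact: LL'.
case=> sz M; split.
  move=> K; rewrite -map_cons => /mapP[I Il ->]; rewrite /sized.
  have IS : I.1.1 \in S by apply: lS; apply: (map_f (fun J : item T => J.1.1) Il).
  by have [-> ->] := step c I cS IS; apply: sz.
have JS : J.1.1 \in S by apply: lS; rewrite mem_head.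
have [-> _] := step c J cS JS.
apply: most_impl M => // x _.
move/IH; rewrite /=; apply.
- by move=> i; rewrite inE => /orP[/eqP->//|]; apply: cS.
- by move=> i il; apply: lS; rewrite inE il orbT.
Qed.

End Relabel.

Ltac nlia :=
  repeat match goal with H : ?P |- _ =>
    lazymatch P with
    | nat => fail
    | is_true (leq _ _) => fail
    | is_true (andb _ _) => fail
    | is_true (orb _ _) => fail
    | is_true (negb (@eq_op _ _ _)) => fail
    | @eq _ _ _ => fail
    | _ => clear H
    end end; lia.

Ltac rlra := intros;
  repeat match goal with H : ?P |- _ =>
    lazymatch P with
    | is_true (@Order.le _ _ _ _) => fail
    | is_true (@Order.lt _ _ _ _) => fail
    | @eq _ _ _ => fail
    | _ => clear H
    end end; lra.

(** * Connecting *)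

Section KPath.
Variables (T : eqType) (e : rel T) (k : nat).
Implicit Types (s z : seq T).

Fixpoint kpath s : bool :=
  if s is x :: s' then all (e x) (take k s') && kpath s' else true.

Lemma kpathP x0 s :
  reflect (forall i j, (i < j < size s)%N -> (j <= i + k)%N -> e (nth x0 s i) (nth x0 s j))
    (kpath s).
Proof.
elim: s => [|x s IH] /=; first by apply: ReflectT => i j; rewrite ltn0 andbF.
apply: (iffP andP) => [[/allP xs /IH es] [|i] [|j]//= ij jk|H].
- apply: xs; rewrite -(@nth_take k) //; first by apply: mem_nth; rewrite size_take; case: ifP; lia.
- exact: es.
split; last by apply/IH => i j ij jk; apply: (H i.+1 j.+1).
apply/(all_nthP x0) => i; rewrite size_take => ik.
have [i1 i2] : (i < k)%N /\ (i < size s)%N by move: ik; case: ifP; lia.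
by rewrite nth_take //; apply: (H 0%N i.+1).
Qed.

Lemma kpath_catr s1 s2 : kpath (s1 ++ s2) -> kpath s2.
Proof. by elim: s1 => //= x s1 IH /andP[_]. Qed.

Lemma kpath_catl s1 s2 : kpath (s1 ++ s2) -> kpath s1.
Proof.
elim: s1 => //= x s1 IH /andP[/allP xs /IH ->]; rewrite andbT.
apply/allP=> y ys; apply: xs; move: ys; rewrite take_cat.
case: ltnP => // h; rewrite (take_oversize h) mem_cat => ->; by [].
Qed.

(** An edge of the power spans at most [k] steps and cannot jump over [m]. *)
Lemma kpath_glue s1 m s2 : (k <= size m)%N ->
  kpath (s1 ++ m) -> kpath (m ++ s2) -> kpath (s1 ++ m ++ s2).
Proof.
move=> km; elim: s1 => //= x s1 IH /andP[xs ps1] pm; rewrite IH // andbT.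
move: xs; rewrite catA [in X in _ -> X]takel_cat // size_cat.
exact: leq_trans km (leq_addl _ _).
Qed.

Lemma kpath_rev s : symmetric e -> kpath (rev s) = kpath s.
Proof.
move=> es; suff h s' : kpath s' -> kpath (rev s').
  by apply/idP/idP => [/h|/h //]; rewrite revK.
case: s' => [|x0 s'] //; move: (x0 :: s') => {}s' /(kpathP x0) H.
apply/(kpathP x0) => i j /andP[ij]; rewrite size_rev => js jk.
rewrite !nth_rev //; last by lia.
by rewrite es; apply: H; lia.
Qed.

(** An insertion brings no two old vertices closer to each other. *)
Lemma kpath_insert w s1 s2 : symmetric e -> kpath (s1 ++ s2) ->
  all (e w) (s1 ++ s2) -> kpath (s1 ++ w :: s2).
Proof.
move=> es; elim: s1 => [|x s1 IH] /=.
  by move=> ->; rewrite andbT => /allP ws; apply/allP => y /mem_take; apply: ws.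
move=> /andP[/allP xs p12] /andP[wx w12]; rewrite IH // andbT.
apply/allP => y ys.
have : y \in take k (s1 ++ s2) \/ y = w.
  move: ys; rewrite !take_cat; case: ifP => _; first by left.
  case: (k - _)%N => [|d] /=; first by rewrite take0; left.
  rewrite mem_cat inE => /or3P[ys|/eqP->|ys]; [left|by right|left].
    by rewrite mem_cat ys.
  rewrite mem_cat; apply/orP; right.
  by rewrite -(cat_take_drop d (take d.+1 s2)) mem_cat take_takel ?ys.
by case=> [/xs//|->]; rewrite es.
Qed.

Lemma kpath_iota (f : nat -> T) m n :
  (forall i j, (m <= i)%N -> (j < m + n)%N -> (i < j <= i + k)%N -> e (f i) (f j)) ->
  kpath [seq f i | i <- iota m n].
Proof.
elim: n m => //= n IH m H; rewrite IH ?andbT; last first.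
  by move=> i j mi jn; apply: H; lia.
apply/allP=> y /(nthP (f m))[i]; rewrite size_take size_map size_iota => ik <-.
have [i1 i2] : (i < k)%N /\ (i < n)%N by move: ik; case: ifP; lia.
rewrite nth_take // (nth_map 0%N) ?size_iota // nth_iota //.
by apply: H; lia.
Qed.

Lemma kpath_cat x0 z s : size z = k -> kpath z -> kpath s ->
  (forall i j, (i < size s)%N -> (i <= j < k)%N -> e (nth x0 z j) (nth x0 s i)) ->
  kpath (z ++ s).
Proof.
move=> zk /(kpathP x0) pz /(kpathP x0) ps cross.
apply/(kpathP x0) => i j; rewrite size_cat => /andP[ij js] jk.
rewrite !nth_cat; case: ltnP => iz; case: ltnP => jz.
- by apply: pz; lia.
- by apply: cross; lia.
- by lia.
- by apply: ps; lia.
Qed.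

End KPath.

Definition near (k : nat) : rel nat :=
  fun i j => [&& i != j, (i <= j + k)%N & (j <= i + k)%N].

Lemma near_sym k : symmetric (near k).
Proof. by move=> i j; rewrite /near eq_sym [X in _ && X]andbC. Qed.

Lemma near_irr k : irreflexive (near k).
Proof. by move=> i; rewrite /near eqxx. Qed.

Lemma count_near k i m n : (i < m)%N || (m + n <= i)%N ->
  count (near k ^~ i) (iota m n) = (minn (i + k).+1 (m + n) - maxn (i - k) m)%N.
Proof.
elim: n m => [|n IH] m h /=; first by lia.
rewrite IH; last by lia.
by rewrite /near (_ : m != i) /=; lia.
Qed.

(** The exponent [k - i] accounts for the vertices of a preceding [k]-tuple that label [i] must see.
    Thus each label has exponent exactly [k] when its turn comes, and its later neighbours have
    less. *)
Lemma init_ok_path (rg : rel nat) k (n m : nat) :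
  (forall a, (a < k)%N -> rg k a) ->
  init_ok rg (near k) (rev (iota 0 n)) [seq (i, k - i)%N | i <- iota n m] [::].
Proof.
move=> H; elim: m n => //= m IH n; apply/andP; split; last first.
  by have := IH n.+1; rewrite -[n.+1]addn1 iotaD rev_cat.
rewrite cats0; apply/allP => _ /mapP[i + ->]; rewrite mem_iota => /andP[ni _].
apply/implyP; rewrite /near /= => /and3P[_ h1 h2].
have -> : expo (near k) (n, k - n)%N (rev (iota 0 n)) = k.
  by rewrite /expo count_rev /= count_near; lia.
by apply: H; rewrite /expo count_rev /= count_near; lia.
Qed.

(** When the labels below [n] and [k, ..., k + j - 1] are chosen, label [k + j] has exponent
    [max n j], which is below [k] whenever it is exchanged; the other labels reach at most
    [2k - 1]. *)
Lemma block_ok_path (rg : rel nat) k : symmetric rg ->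
  (forall a b, (a < k)%N -> (b < 2 * k)%N -> rg a b) ->
  block_ok rg (near k) [::] [seq (i, k - i)%N | i <- iota 0 k]
    [seq (i, k - i)%N | i <- iota k k].
Proof.
move=> rs H.
suff h m j : (j + m = k)%N -> block_ok rg (near k) (rev (iota k j))
    [seq (i, k - i)%N | i <- iota 0 k] [seq (i, k - i)%N | i <- iota (k + j) m].
  by have := h k 0%N (add0n _); rewrite addn0.
elim: m j => //= m IH j jm; apply/andP; split; last first.
  have := IH j.+1; rewrite addSnnS => /(_ jm).
  by rewrite -[j.+1]addn1 iotaD rev_cat /= addnA addn1.
suff h n d : (n + d = k)%N -> move_ok rg (near k) (rev (iota 0 n) ++ rev (iota k j))
    [seq (i, k - i)%N | i <- iota n d] (k + j, k - (k + j))%N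
    [seq (i, k - i)%N | i <- iota (k + j).+1 m].
  exact: (h 0%N k).
have exr n' : (n' <= k)%N -> (expo (near k) (k + j, k - (k + j))%N
    (rev (iota 0 n') ++ rev (iota k j)) = j + (n' - j))%N.
  by move=> ?; rewrite /expo count_cat !count_rev /= !count_near; lia.
elim: d n => //= d IH' n nd; apply/and3P; split.
- apply/implyP; rewrite {1}/near /= => /and3P[_ h1 h2].
  rewrite rs; apply: H; first by rewrite exr; lia.
  by rewrite /expo count_cat !count_rev /= !count_near; lia.
- apply/allP => K; rewrite mem_cat => KK; apply/implyP => _.
  apply: H; first by rewrite exr; lia.
  case/orP: KK => /mapP[i]; rewrite mem_iota => ii -> /=;
  by rewrite /expo count_cat !count_rev /= !count_near; lia.
have := IH' n.+1; rewrite addSnnS => /(_ nd).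
by rewrite -[n.+1]addn1 iotaD rev_cat.
Qed.

Section Lookup.
Variables (T : finType) (x0 : T).
Implicit Types (c : seq (nat * T)).

Definition look c i : T := (nth (0%N, x0) c (index i (unzip1 c))).2.

Lemma look_in c i : i \in unzip1 c -> (i, look c i) \in c.
Proof.
move=> ic; have lt : (index i (unzip1 c) < size c)%N by rewrite -(size_map fst) index_mem.
have E : (nth (0%N, x0) c (index i (unzip1 c))).1 = i.
  by rewrite -(nth_map _ 0%N fst) // nth_index.
by rewrite -[X in (X, _)]E -surjective_pairing mem_nth.
Qed.

(** Reading the choices as a function of the label makes the property stable under permutation and
    under further choices. *)
Definition assigned (Phi : (nat -> T) -> Prop) c : Prop :=
  forall f : nat -> T, (forall u, u \in c -> f u.1 = u.2) -> Phi f.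

Lemma assigned_perm Phi : perm_inv (assigned Phi).
Proof. by move=> c c' cc H f fc; apply: H => u uc; apply: fc; rewrite -(perm_mem cc). Qed.

Lemma assigned_cons Phi u c : assigned Phi c -> assigned Phi (u :: c).
Proof. by move=> H f fc; apply: H => v vc; apply: fc; rewrite inE vc orbT. Qed.

Lemma look_assigned c : uniq (unzip1 c) -> forall u, u \in c -> look c u.1 = u.2.
Proof.
move=> uc u /(nthP (0%N, x0))[i ic <-].
rewrite /look -(nth_map _ 0%N fst) // index_uniq // size_map //.
Qed.

Lemma assigned_mono (Phi Psi : (nat -> T) -> Prop) c :
  (forall f, Phi f -> Psi f) -> assigned Phi c -> assigned Psi c.
Proof. by move=> H P f fc; apply/H/P. Qed.
End Lookup.

Section Track.
Variables (R : realType) (T : finType) (e : rel T) (p : R) (rg : rel nat).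
Variables (eta : R) (adj : rel nat).
Hypothesis gg : good_graph e p rg eta.
Hypothesis adj_sym : symmetric adj.
Hypothesis adj_irr : irreflexive adj.

(** Records that the choices come from candidate sets, so that the final property may rely on their
    adjacencies and labels. *)
Lemma nested_track rho d l c L : wf e adj c -> nested e p rho adj d l c L ->
  nested e p rho adj d l c (fun c' => [/\ L c', wf e adj c' &
    unzip1 c' = rev [seq J.1.1 | J <- l] ++ unzip1 c]).
Proof.
elim: l c => [|J l IH] c wc /=; first by move=> Lc; split.
case=> sz M; split=> //; apply: most_impl M => // y yJ H.
have := IH _ (wf_cons gg adj_sym adj_irr wc yJ) H.
apply: nested_impl => // c' [? ? E]; split=> //.
by rewrite E rev_cons cat_rcons.
Qed.
End Track.

Lemma wf_edge (T : finType) (e : rel T) (adj : rel nat) c i j x y :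
  wf e adj c -> (i, x) \in c -> (j, y) \in c -> adj i j -> e x y.
Proof. by move=> wc ic jc; apply: (wc _ _ ic jc). Qed.

Definition commons (T : finType) (e : rel T) (s : seq T) : {set T} :=
  [set y | all (fun x => e x y) s].

Definition reach (T : finType) (e : rel T) (k : nat) (z : seq T) (V : {set T})
    (f : nat -> T) : Prop :=
  exists cs, [/\ uniq cs, {subset cs <= V}, (size cs <= 2 * k)%N &
    kpath e k (z ++ cs ++ [seq f j | j <- iota 0 k])].

Definition distinct : rel nat := fun i j => i != j.

(** The first [k] pools continue [z], the next [k] receive the target, the last [k] leave room for a
    detour, which [left_two] takes. With [distinct] as adjacency the target is a clique, so it can
    be met in the opposite order from another side. *)
Definition left_spec (R : realType) (k : nat) (rg : rel nat) : Prop :=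
  forall rho : R, 0 < rho -> exists rho' eta : R, [/\ 0 < rho', 0 < eta &
  forall (T : finType) (e : rel T) (p : R), good_graph e p rg eta ->
  forall (z : seq T) (P : nat -> {set T}) (V : {set T}),
  size z = k -> kpath e k z ->
  (forall i, (i < 3 * k)%N -> rho * lev T p (k - i) <= #|P i|%:R) ->
  (forall i, (i < k)%N -> P i \subset commons e (drop i z)) ->
  (forall i j, (i < 3 * k)%N -> (j < 3 * k)%N -> i != j -> [disjoint P i & P j]) ->
  (forall i, (i < k)%N || (2 * k <= i < 3 * k)%N -> P i \subset V) ->
  nested e p rho' distinct (tol R (k * k)) [seq ((j, 0%N), P (k + j)%N) | j <- iota 0 k]
    [::] (assigned (reach e k z V))].

Lemma left_general (R : realType) (k : nat) (rg : rel nat) :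
  (0 < k)%N -> symmetric rg ->
  (forall a b, (a < k)%N -> (b < 2 * k)%N -> rg a b) -> left_spec R k rg.
Proof.
move=> k0 rs H rho rho0; pose M := (k * k + k * k)%N.
have t0 := tol_gt0 R M; have t4 := tol_le4 R M.
exists rho, (tol R M * rho / (6%:R * (2 * k)%:R)); split=> //.
  by rewrite divr_gt0 ?mulr_gt0 // ltr0n; nlia.
set eta := _ / _ => T e p gg z P V zk pz Psz PN Pd PV.
have e0 := gg_eta gg.
have k1 : 1 <= (2 * k)%:R :> R by rewrite ler1n; nlia.
have etaE : 6%:R * (2 * k)%:R * eta = tol R M * rho.
  by rewrite /eta mulrC divfK // mulf_neq0 // pnatr_eq0; nlia.
have eta1 : eta <= (2 * k)%:R * eta by rewrite ler_peMl // ltW.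
have tr : tol R M * rho <= rho by rewrite ler_piMl ?ltW //; lra.
pose it i : item T := ((i, (k - i)%N), P i).
pose lc := [seq it i | i <- iota 0 k]; pose lr := [seq it i | i <- iota k k].
have key m n : unzip1 [seq it i | i <- iota m n] = [seq (i, k - i)%N | i <- iota m n].
  by rewrite /unzip1 -map_comp; apply: eq_map.
have lab m n : [seq J.1.1 | J <- [seq it i | i <- iota m n]] = iota m n.
  by rewrite -map_comp map_id.
have lcr : lc ++ lr = [seq it i | i <- iota 0 (2 * k)].
  by rewrite -map_cat -iotaD addnn mul2n.
have ns := near_sym k; have ni := near_irr k.
have cand0 (I : item T) : cand e (near k) I [::] = I.2.
  by apply/setP=> x; rewrite inE andbT.
have N1 : nested e p rho (near k) (tol R M) (lc ++ lr) [::]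
    (all_sized e p rho (near k) [::]).
  apply: (nested_init gg rho0).
  - rewrite lcr key; apply: (@init_ok_path rg k 0 (2 * k)) => a ak.
    by rewrite rs; apply: H => //; nlia.
  - rewrite cats0 lcr => _ /mapP[i + ->]; rewrite mem_iota => /andP[_ ik].
    rewrite /sized cand0 /expo /= addn0; apply: Psz; nlia.
  - lra.
  - rewrite cats0 lcr size_map size_iota; nra.
(* With the targets in front, the statement says that most targets admit connecting vertices. *)
have N2 : nested e p rho (near k) (tol R (k * k)) (lr ++ lc) [::]
    (all_sized e p rho (near k) [::]).
  apply: (nested_block gg ns rho0 (M := M) (N := (2 * k)%N)) => //.
  - move=> _ _ /mapP[i + ->] /mapP[j + ->]; rewrite !mem_iota => ik jk.
    by apply: Pd; nlia.
  - by rewrite !key; apply: block_ok_path.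
  - by rewrite lcr size_map size_iota.
  - by rewrite !size_map !size_iota.
  - by rewrite etaE.
  - by rewrite !size_map !size_iota; exact: N1.
have w0 : wf e (near k) [::] by [].
have N3 := nested_track gg ns ni w0 (nested_split N2).
have -> : [seq ((j, 0%N), P (k + j)%N) | j <- iota 0 k] =
    map (relabel (subn^~ k)) lr.
  rewrite /lr -[X in map _ (map _ (iota X k))]addn0 iotaDl -!map_comp.
  by apply: eq_map => j; rewrite /relabel /= addKn subnDA subnn.
apply: (@nested_relabel _ _ _ _ _ (near k) _ (subn^~ k) _ _ [::] _ _
  [pred i | k <= i < 2 * k]%N _ _ _ _ N3) => //.
- move=> i j; rewrite !inE /near /distinct => ik jk.
  by apply/and3P/idP => [[]|h]; [nlia|split; nlia].
- by move=> i; rewrite lab mem_iota inE; nlia.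
move=> c [Nc wc lc_]; rewrite lab cats0 in lc_.
move=> f fc.
have fc' i : (k <= i < 2 * k)%N -> (i, f (i - k)%N) \in c.
  move=> ik; have : i \in unzip1 c by rewrite lc_ mem_rev mem_iota; nlia.
  case/mapP => u uc iu.
  have /fc /= : (u.1 - k, u.2)%N \in [seq (v.1 - k, v.2)%N | v <- c] by apply/mapP; exists u.
  by rewrite iu => ->; rewrite -surjective_pairing.
pose x0 : T := f 0%N.
have [||c' [wc' _ lc' inc']] := nested_ex gg ns ni rho0 _ _ wc Nc.
- by apply: le_lt_trans (tol_le4 _ _) _; lra.
- by rewrite lab iota_uniq.
rewrite lab in lc'.
pose h i := if (i < k)%N then look x0 c' i else f (i - k)%N.
have hin i : (i < 2 * k)%N -> (i, h i) \in c' ++ c.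
  move=> ik; rewrite mem_cat /h; case: ltnP => i_k.
    by rewrite look_in // lc' mem_rev mem_iota.
  by rewrite fc' ?orbT // i_k.
have hP i : (i < k)%N -> h i \in P i.
  move=> ik; rewrite /h ik; apply: (inc' (it i) (i, look x0 c' i)) => //.
    by apply: map_f; rewrite mem_iota.
  by rewrite look_in // lc' mem_rev mem_iota.
have hadj i j : (i < 2 * k)%N -> (j < 2 * k)%N -> near k i j -> e (h i) (h j).
  by move=> /hin ii /hin jj; apply: (wc' _ _ ii jj).
exists [seq h i | i <- iota 0 k]; split.
- rewrite map_inj_in_uniq ?iota_uniq // => i j; rewrite !mem_iota => /andP[_ ik] /andP[_ jk] hij.
  apply/eqP/negPn/negP => ij.
  have : [disjoint P i & P j] by apply: Pd; rewrite ?ij //; nlia.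
  by move/pred0P/(_ (h i)) => /=; rewrite hP //= hij hP.
- move=> _ /mapP[i + ->]; rewrite mem_iota => /andP[_ ik].
  by apply: (subsetP (PV i _)); rewrite ?ik //; apply: hP.
- by rewrite size_map size_iota; nlia.
have -> : [seq f j | j <- iota 0 k] = [seq h i | i <- iota k k].
  rewrite -[X in _ = map _ (iota X k)]addn0 iotaDl -!map_comp; apply: eq_map => j /=.
  by rewrite /h ltnNge leq_addr /= addKn.
rewrite -map_cat -iotaD addnn -mul2n.
have ph : kpath e k [seq h i | i <- iota 0 (2 * k)].
  apply: kpath_iota => i j _ jk ij; apply: hadj; rewrite /near; nlia.
apply: (@kpath_cat _ _ _ (h 0%N)) => // i j; rewrite size_map size_iota => i2 ijk.
rewrite (nth_map 0%N) ?size_iota // nth_iota //= add0n.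
have ik : (i < k)%N by nlia.
have : h i \in commons e (drop i z) by apply: (subsetP (PN i ik)); exact: hP.
rewrite inE => /allP; apply.
rewrite -[j](@subnKC i) ?nth_drop; last by nlia.
by rewrite -nth_drop mem_nth // size_drop zk; nlia.
Qed.

(* Choosing greedily, the smallest sets first. *)
Lemma disjoint_pools (T : finType) (S : nat -> {set T}) (m : nat) :
  exists X : nat -> {set T},
    (forall i, (i < m)%N -> X i \subset S i /\ (#|S i| < m * #|X i|.+1)%N) /\
    (forall i j, (i < m)%N -> (j < m)%N -> i != j -> [disjoint X i & X j]).
Proof.
pose geS i j := (#|S j| <= #|S i|)%N.
suff: forall o, (size o <= m)%N -> uniq o -> sorted geS o ->
  exists X : nat -> {set T},
    (forall i, i \in o -> X i \subset S i /\ #|X i| = (#|S i| %/ m)%N) /\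
    (forall i j, i \in o -> j \in o -> i != j -> [disjoint X i & X j]).
  move/(_ (sort geS (iota 0 m))); case.
  - by rewrite size_sort size_iota.
  - by rewrite sort_uniq iota_uniq.
  - by apply: sort_sorted => i j; apply: leq_total.
  move=> X [XS Xd]; have mo i : (i < m)%N -> i \in sort geS (iota 0 m).
    by rewrite mem_sort mem_iota.
  exists X; split=> [i im|i j /mo im /mo jm]; last exact: Xd.
  have [? ->] := XS _ (mo _ im); split=> //.
  by rewrite mulnC; apply: ltn_ceil; lia.
have trS : transitive geS by move=> j i k ji ik; apply: leq_trans ik ji.
elim=> [|i o IH] om uo so; first by exists (fun=> set0); split.
have /andP[io uo'] := uo.
have [X [XS Xd]] := IH (ltnW om) uo' (path_sorted so).
have oi := order_path_min trS so.
have [|W cW XW] := @union_bound int T _ o X (#|S i| %/ m)%:R.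
  by move=> j jo; have [_ ->] := XS _ jo; rewrite ler_nat; apply/leq_div2r/(allP oi).
rewrite -natrM ler_nat in cW.
have [||B [_ BS cB]] := @card_superset_between T set0 (S i :\: W) (#|S i| %/ m).
- exact: sub0set.
- rewrite cards0 /=.
  have h1 := leq_card_setD (S i) W.
  have h2 : (m * (#|S i| %/ m) <= #|S i|)%N by rewrite mulnC leq_trunc_div.
  have h3 : ((size o).+1 * (#|S i| %/ m) <= m * (#|S i| %/ m))%N by rewrite leq_mul2r om orbT.
  have := leq_trans (leq_trans h3 h2) h1; rewrite mulSn => h4.
  by rewrite -(leq_add2r (size o * (#|S i| %/ m))); apply: leq_trans h4 _; rewrite leq_add2l.
have Bd j : j \in o -> [disjoint B & X j].
  move=> jo; rewrite -setI_eq0; apply/eqP/setP=> x; rewrite !inE.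
  apply/andP=> -[/(subsetP BS)]; rewrite inE => /andP[/negP xW _] xX.
  by apply: xW; apply: (subsetP (XW _ jo)).
exists (fun j => if j == i then B else X j); split=> [j|j1 j2]; rewrite !inE.
  case: eqP => [->|_ /= /XS //] _; split=> //.
  exact: subset_trans BS (subsetDl _ _).
case: eqP => [->|_] /=; case: eqP => [->|_] //=.
- by rewrite eqxx.
- by move=> _ jo _; apply: Bd.
- by move=> jo _ _; rewrite disjoint_sym; apply: Bd.
- exact: Xd.
Qed.

Lemma rev_ok_clique (rg : rel nat) k (adj : rel nat) (s : seq nat) (l : seq (nat * nat)) :
  (forall a b, (a < k)%N -> (b < k)%N -> rg a b) ->
  all (fun i => i.2 == 0%N) l -> (size s + size l <= k)%N -> rev_ok rg adj s l.
Proof.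
move=> H; have ex (i : nat * nat) s' : i.2 == 0%N -> (size s' < k)%N -> (expo adj i s' < k)%N.
  move=> /eqP i0; rewrite /expo i0 add0n; apply: leq_ltn_trans; exact: count_size.
elim: l s => //= j l IH s /andP[j0 l0] sk; apply/andP; split; last first.
  by apply: IH => //=; lia.
have l0' : all (fun i : nat * nat => i.2 == 0%N) (rev l) by rewrite all_rev.
have sk' : (size s + size (rev l) < k)%N by rewrite size_rev; lia.
elim: (rev l) s l0' sk' {IH sk l0} => //= i l' IH s /andP[i0 l0] sk.
apply/and3P; split.
- by apply/implyP => _; apply: H; apply: ex => //; lia.
- rewrite cats0; apply/allP => u ul; apply/implyP => _; apply: H; apply: ex => //; try lia.
  exact: (allP l0).
- by apply: IH => //=; lia.
Qed.

Section Connect.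
Variables (R : realType) (k : nat) (rg : rel nat).
Hypothesis k_gt0 : (0 < k)%N.
Hypothesis rg_small : forall a b, (a < k)%N -> (b < k)%N -> rg a b.
Hypothesis rg_k : rg k 0.

Definition good (T : finType) (e : rel T) (p rho : R) (z : seq T) (U : {set T}) : Prop :=
  forall i, (i <= size z)%N ->
    rho * lev T p (size z - i) <= #|U :&: commons e (drop i z)|%:R.

Definition connect_spec : Prop :=
  forall rho : R, 0 < rho -> exists2 eta : R, 0 < eta &
  forall (T : finType) (e : rel T) (p : R), good_graph e p rg eta ->
  forall (z y : seq T) (U : {set T}), size z = k -> size y = k ->
  kpath e k z -> kpath e k y -> good e p rho z U -> good e p rho (rev y) U ->
  exists cs, [/\ uniq cs, {subset cs <= U}, (size cs <= 5 * k)%N &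
    kpath e k (z ++ cs ++ y)].

(** The specification is applied to [z] and to [rev y] with the same target pools. Each side reaches
    all but a quarter of the candidates at every choice, so both reach a common clique. *)
Lemma connect_of_left : left_spec R k rg -> connect_spec.
Proof.
move=> left rho rho0; pose m := (5 * k)%N; have mE : m = (5 * k)%N by [].
have m0 : 0 < m%:R :> R by rewrite ltr0n; nlia.
have k0 : 0 < k%:R :> R by rewrite ltr0n.
have rho1_0 : 0 < rho / (2%:R * m%:R) by rewrite divr_gt0 // mulr_gt0.
have [rho' [eta1 [rho'0 eta10 L]]] := left _ rho1_0.
have t0 := tol_gt0 R (k * k).
pose eta2 := tol R (k * k) * rho' / (6%:R * k%:R).
have eta20 : 0 < eta2 by rewrite divr_gt0 // mulr_gt0.
exists (Num.min eta1 (Num.min eta2 (rho / (2%:R * m%:R)))).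
  by rewrite !lt_min eta10 eta20 rho1_0.
move=> T e p; set eta := Num.min _ _ => gg z y U zk yk pz py gz gy.
have e1 : eta <= eta1 by rewrite ge_min lexx.
have e2 : eta <= eta2 by rewrite !ge_min lexx orbT.
have e3 : eta <= rho / (2%:R * m%:R) by rewrite !ge_min lexx !orbT.
have gg1 := good_graph_le e1 gg.
have big : 1 <= eta * lev T p k by exact: (gg_big gg rg_k).
have lv a := lev_gt0 a gg; have es := gg_sym gg.
have ryk : size (rev y) = k by rewrite size_rev.
pose S i := if (i < k)%N then U :&: commons e (drop i z)
  else if (3 * k <= i < 4 * k)%N then U :&: commons e (drop (i - 3 * k) (rev y)) else U.
have SU i : S i \subset U.
  by rewrite /S; case: ifP => _; [|case: ifP => _]; rewrite ?subsetIl.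
pose ex i := if (i < k)%N then (k - i)%N else if (3 * k <= i < 4 * k)%N then (k - (i - 3 * k))%N else 0%N.
have cS i : rho * lev T p (ex i) <= #|S i|%:R.
  rewrite /ex /S; case: ifP => ik; first by have := gz i; rewrite zk; apply; exact: ltnW.
  case: ifP => ik'; first by have := gy (i - 3 * k)%N; rewrite ryk; apply; nlia.
  have := gz k; rewrite zk subnn drop_oversize ?zk // => /(_ (leqnn _)).
  by congr (_ <= #|pred_of_set _|%:R); apply/setP => x; rewrite !inE andbT.
have [X [XS Xd]] := disjoint_pools S m.
have cX i : (i < m)%N -> rho / (2%:R * m%:R) * lev T p (ex i) <= #|X i|%:R.
  move=> im; have [_ ] := XS i im; rewrite -(ltr_nat R) natrM -natr1 => lt.
  have h1 : lev T p k <= lev T p (ex i).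
    apply: (le_lev gg); rewrite /ex; case: ifP => _; first exact: leq_subr.
    by case: ifP => _; rewrite ?leq_subr.
  (* Every pool is to have at least one vertex, so the factor 2 in the denominator absorbs the
     rounding. *)
  have h2 : 1 <= rho / (2%:R * m%:R) * lev T p (ex i).
    apply: le_trans big _; apply: ler_pM => //; apply: ltW => //.
    exact: (gg_eta gg).
  have h3 : m%:R * (rho / (2%:R * m%:R) * lev T p (ex i)) * 2%:R = rho * lev T p (ex i).
    by field; rewrite gt_eqF.
  set r := rho / _ * _ in h2 h3 *; have := cS i; rewrite -h3 => h4.
  have : m%:R * (r * 2%:R) < m%:R * (#|X i|%:R + 1) by rewrite mulrA; apply: le_lt_trans lt.
  by rewrite ltr_pM2l //; lra.
pose V1 : {set T} := \bigcup_(i < m | ((i < k) || (2 * k <= i < 3 * k))%N) X i.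
pose V2 : {set T} := \bigcup_(i < m | (3 * k <= i)%N) X i.
have XV1 i : (i < k)%N || (2 * k <= i < 3 * k)%N -> X i \subset V1.
  move=> ik; have im : (i < m)%N by rewrite /m; nlia.
  exact: (bigcup_sup (Ordinal im)).
have XV2 i : (3 * k <= i < m)%N -> X i \subset V2.
  by move=> /andP[ik im]; apply: (bigcup_sup (Ordinal im)).
have V1U : V1 \subset U.
  by apply/bigcupsP => i _; apply: subset_trans (SU i); have [] := XS i (ltn_ord i).
have V2U : V2 \subset U.
  by apply/bigcupsP => i _; apply: subset_trans (SU i); have [] := XS i (ltn_ord i).
have Xi x i j : (i < m)%N -> (j < m)%N -> x \in X i -> x \in X j -> i = j.
  move=> im jm xi xj; apply/eqP; apply: contraT => /(Xd i j im jm)/pred0P/(_ x).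
  by rewrite /= xi xj.
have V12 x : x \in V1 -> x \in V2 -> False.
  case/bigcupP => i ik xi /bigcupP[j jk xj].
  by have := Xi x i j (ltn_ord i) (ltn_ord j) xi xj; nlia.
have V1r x j : (j < k)%N -> x \in X (k + j)%N -> (x \in V1 -> False) /\ (x \in V2 -> False).
  move=> jk xj; have jm : (k + j < m)%N by nlia.
  by split; case/bigcupP => i ik xi; have := Xi x i _ (ltn_ord i) jm xi xj; nlia.
have N1 := L T e p gg1 z X V1 zk pz _ _ _ _.
have {N1} N1 : nested e p rho' distinct (tol R (k * k)) [seq ((j, 0%N), X (k + j)%N) | j <- iota 0 k]
    [::] (assigned (reach e k z V1)).
  apply: N1 => // [i ik|i ik|i j ik jk].
  - have im : (i < m)%N by rewrite /m; nlia.
    by have := cX i im; congr (_ * lev T p _ <= _); rewrite /ex; repeat (case: ifP => ?); nlia.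
  - have im : (i < m)%N by rewrite /m; nlia.
    have [h _] := XS i im; apply: subset_trans h _.
    by rewrite /S ik subsetIr.
  - by apply: Xd; rewrite /m; nlia.
(* The pools as seen from [rev y], which meets the target pools in reverse order. *)
pose sg i := (if i < k then 3 * k + i else if i < 2 * k then k + (2 * k - 1 - i) else 2 * k + i)%N.
have sgm i : (i < 3 * k)%N -> (sg i < m)%N.
  by rewrite /sg /m; case: ifP => ?; [|case: ifP => ?]; nlia.
have N2 := L T e p gg1 (rev y) (X \o sg) V2 ryk _ _ _ _ _.
have {N2} N2 : nested e p rho' distinct (tol R (k * k))
    [seq ((j, 0%N), X (sg (k + j)%N)) | j <- iota 0 k] [::] (assigned (reach e k (rev y) V2)).
  apply: N2 => [|i ik|i ik|i j ik jk|i ik] /=.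
  - by rewrite kpath_rev.
  - by have := cX _ (sgm i ik); congr (_ * lev T p _ <= _); rewrite /sg /=;
      (case: ifP => ?; [|case: ifP => ?]); rewrite /ex; repeat (case: ifP => ?); nlia.
  - have i3 : (i < 3 * k)%N by nlia.
    have [h _] := XS _ (sgm i i3); apply: subset_trans h _.
    rewrite /S /sg ik ifF; last by nlia.
    by rewrite ifT ?addKn ?subsetIr //; nlia.
  - move=> ij; apply: Xd; [exact: sgm|exact: sgm|].
    apply: contraNneq ij; rewrite /sg.
    by repeat (case: ifP => ?); nlia.
  - apply: XV2; rewrite /sg /m; case: ifP => ?; first by nlia.
    by case: ifP => ?; nlia.
pose l := [seq ((j, 0%N), X (k + j)%N) | j <- iota 0 k].
have ds : symmetric distinct by move=> i j; rewrite /distinct eq_sym.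
have di : irreflexive distinct by move=> i; rewrite /distinct eqxx.
pose g j := (k.-1 - j)%N.
have El : map (relabel g) [seq ((j, 0%N), X (sg (k + j)%N)) | j <- iota 0 k] = rev l.
  apply: (@eq_from_nth _ ((0%N, 0%N), set0)).
    by rewrite size_rev !size_map.
  move=> i; rewrite !size_map size_iota => ik.
  rewrite nth_rev ?size_map ?size_iota // /l -map_comp.
  rewrite !(nth_map 0%N) ?size_iota; try nlia.
  rewrite !nth_iota /=; try nlia.
  rewrite /relabel /= /g /sg ifF; last by nlia.
  by rewrite ifT; last (by nlia); congr ((_, _), X _); nlia.
pose L2 := assigned (fun f => reach e k (rev y) V2 (f \o g)).
have N3 : nested e p rho' distinct (tol R (k * k)) (rev l) [::] L2.
  rewrite -El; apply: (@nested_relabel _ _ _ _ _ distinct _ g _ _ [::] _ _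
    [pred i | i < k]%N _ _ _ _ N2) => //.
  - move=> i j; rewrite !inE /distinct /g => ik jk.
    by apply/idP/idP; nlia.
  - by move=> i; rewrite -map_comp map_id mem_iota.
  - move=> c Lc f fc; apply: Lc => u uc /=.
    apply: (fc (g u.1, u.2)); exact: (map_f (fun u => (g u.1, u.2))).
have ul : uniq [seq J.1.1 | J <- l] by rewrite -map_comp map_id iota_uniq.
have sl : size l = k by rewrite size_map size_iota.
(* The statement from the side of [y] makes its choices in reverse order; exchanging them back
   spends the [k * k] steps of tolerance kept in reserve. *)
have N4 : nested e p rho' distinct (tol R 0) l [::] L2.
  apply: (nested_rev gg ds rho'0 (M := (k * k)%N) (N := k)) => //.
  - exact: assigned_perm.
  - move=> _ _ /mapP[i + ->] /mapP[j + ->]; rewrite !mem_iota /= => ik jk.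
    move=> ij; apply: Xd; rewrite /m; try nlia.
    by apply: contraNneq ij => /addnI ->.
  - by apply: (@map_uniq _ _ (fun J => J.1.1)); exact: ul.
  - apply: (@rev_ok_clique _ k) => //; last by rewrite !size_map size_iota.
    by apply/allP => u; rewrite /l /unzip1 -map_comp => /mapP[i _ ->].
  - by rewrite sl.
  - by rewrite sl.
  - have h : 6%:R * k%:R * eta2 = tol R (k * k) * rho'.
      by rewrite /eta2 mulrC divfK // mulf_neq0 // gt_eqF.
    by rewrite -h ler_wpM2l // mulr_ge0.
  - by rewrite sl.
have t4 := tol_le4 R 0.
have t00 : 0 <= tol R 0 by apply: ltW; exact: tol_gt0.
have N5 : nested e p rho' distinct (tol R 0 + tol R 0) (l ++ [::]) [::]
    (fun c => assigned (reach e k z V1) c /\ L2 c).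
  apply: nested_and => //.
  - by move=> u c; apply: assigned_cons.
  - rewrite cats0; apply: nested_impl N1 => //; exact: tol_le.
have w0 : wf e distinct [::] by [].
rewrite cats0 in N5.
have [|c [wc [Lc1 Lc2] lc cin]] := nested_ex gg ds di rho'0 _ ul w0 N5.
  by lra.
rewrite cats0 in wc Lc1 Lc2.
have x0 : T.
  by have := gg_n gg; move=> /card_gt0P/sigW[x _]; exact: x.
have uc : uniq (unzip1 c) by rewrite lc rev_uniq.
pose f := look x0 c.
have fc : forall u, u \in c -> f u.1 = u.2 by apply: look_assigned.
have fX j : (j < k)%N -> f j \in X (k + j)%N.
  move=> jk; have jl : ((j, 0%N), X (k + j)%N) \in l.
    by apply: (map_f (fun j => ((j, 0%N), X (k + j)%N))); rewrite mem_iota.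
  apply: (cin _ (j, f j) jl) => //.
  by apply: look_in; rewrite lc mem_rev -map_comp map_id mem_iota.
have [cs1 [u1 s1 n1 p1]] := Lc1 f fc.
have [cs2 [u2 s2 n2 p2]] := Lc2 f fc.
pose rs := [seq f j | j <- iota 0 k].
have Ers : [seq (f \o g) j | j <- iota 0 k] = rev rs.
  apply: (@eq_from_nth _ x0); first by rewrite size_rev !size_map.
  move=> i; rewrite !size_map size_iota => ik.
  rewrite nth_rev ?size_map ?size_iota // /rs.
  rewrite !(nth_map 0%N) ?size_iota; try nlia.
  rewrite !nth_iota /=; try nlia.
  by congr f; rewrite /g; nlia.
rewrite Ers -(kpath_rev _ _ es) !rev_cat !revK in p2.
have rsX x : x \in rs -> exists2 j, (j < k)%N & x \in X (k + j)%N.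
  case/mapP => j; rewrite mem_iota => /= jk ->; exists j => //; exact: fX.
exists (cs1 ++ rs ++ rev cs2); split.
- rewrite !cat_uniq u1 rev_uniq u2 andbT /=; apply/and3P; split.
  + apply/hasPn => x; rewrite mem_cat mem_rev => xx; apply/negP => /s1 x1.
    case/orP: xx => [/rsX[j jk /(V1r _ _ jk)[h _]]|/s2 x2]; first exact: h.
    exact: (V12 _ x1 x2).
  + rewrite map_inj_in_uniq ?iota_uniq // => i j; rewrite !mem_iota /= => ik jk fij.
    by apply/(@addnI k)/(Xi (f i)); rewrite ?fX //; [nlia|nlia|rewrite fij fX].
  + apply/hasPn => x; rewrite mem_rev => /s2 x2; apply/negP => /rsX[j jk].
    by move/(V1r _ _ jk) => [_]; apply.
- move=> x; rewrite !mem_cat mem_rev => /or3P[/s1|/rsX[j jk]|/s2].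
  + exact: (subsetP V1U).
  + have im : (k + j < m)%N by rewrite /m; nlia.
    by move=> xX; apply: (subsetP (SU (k + j)%N)); apply: (subsetP (XS _ im).1).
  + exact: (subsetP V2U).
- by rewrite !size_cat size_rev size_map size_iota; nlia.
have -> : z ++ (cs1 ++ rs ++ rev cs2) ++ y = (z ++ cs1) ++ rs ++ (rev cs2 ++ y).
  by rewrite -!catA.
apply: kpath_glue; first by rewrite size_map size_iota.
  by rewrite -catA.
by rewrite -catA in p2.
Qed.

End Connect.

(** * Reaching most edges by squares of paths *)

Definition rg2 : rel nat :=
  fun a b => ((a <= 1) && (b <= 2) || (a <= 2) && (b <= 1))%N.

Lemma rg2_sym : symmetric rg2.
Proof. by move=> a b; rewrite /rg2 orbC andbC; congr (_ || _); rewrite andbC. Qed.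

Lemma tol_double (R : realType) m : tol R m.+1 + tol R m.+1 <= tol R m.
Proof. by have := tolS R m; have := tol_gt0 R m; have := tol_le4 R m; rewrite expr2; nra. Qed.

Section Counting.
Variables (R : realType) (T : finType) (e : rel T) (p : R) (rg : rel nat).
Variables (eta rho : R).
Hypothesis gg : good_graph e p rg eta.
Hypothesis rg02 : rg 0 2.
Local Notation nb := (nb e).
Local Notation lev := (lev T p).

Lemma levn : lev 0 = #|T|%:R.
Proof. by rewrite levE expr0 mul1r. Qed.

(* Reversing the direction of the quantifiers needs an upper bound on degrees:
   few vertices of [Y] have more than [2 p |X|] neighbours in [X]. *)
Lemma many_rich (X Y : {set T}) (S : T -> {set T}) :
  0 < rho -> 2%:R * eta <= rho -> [disjoint X & Y] ->
  rho * lev 0 <= #|X|%:R ->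
  (forall x, S x \subset Y :&: nb x) ->
  most (4%:R^-1 : R) X (fun x => rho * lev 2 <= #|S x|%:R) ->
  exists Z : {set T}, [/\ Z \subset Y, rho / 256%:R * lev 1 <= #|Z|%:R &
    forall y, y \in Z -> rho ^+ 2 / 8%:R * lev 2 <= #|[set x in X | y \in S x]|%:R].
Proof.
move=> rho0 er dXY cX SY /most_bad; set B := [set x in X | _] => cB.
have lv a := lev_gt0 a gg; have e0 := gg_eta gg; have p0 := gg_p0 gg.
have es := gg_sym gg.
have n0 : 0 < #|T|%:R :> R by rewrite ltr0n (gg_n gg).
have X0 : 0 < #|X|%:R :> R by apply: lt_le_trans cX; rewrite mulr_gt0.
pose H := [set y in Y | 2%:R * p * #|X|%:R < #|X :&: nb y|%:R].
have cH : #|H|%:R <= eta * lev 2.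
  rewrite leNgt; apply/negP => hH.
  have dXH : [disjoint X & H].
    by apply: disjointWr dXY; apply/subsetP=> y; rewrite inE => /andP[].
  have hX : eta * lev 0 <= #|X|%:R by apply: le_trans cX; rewrite ler_pM2r //; lra.
  have /andP[_] := gg_reg gg rg02 dXH hX (ltW hH).
  rewrite leNgt => /negP; apply; rewrite (ecountC es) /ecount natr_sum mulr_natr -sumr_const.
  have H0 : (0 < #|H|)%N by rewrite -(ltr0n R); apply: lt_trans hH; rewrite mulr_gt0.
  apply: ltr_sum => [|y]; last by rewrite inE => /andP[].
  by apply/hasP; case/card_gt0P: H0 => y yH; exists y; rewrite ?mem_index_enum.
pose S' x := S x :\: H.
have cS' x : x \in X -> x \notin B -> rho / 2%:R * lev 2 <= #|S' x|%:R.
  rewrite inE => -> /= /asboolPn/contrapT cS.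
  have := card_setDr R (S x) H; rewrite -/(S' x).
  have : 2%:R * eta * lev 2 <= rho * lev 2 by rewrite ler_pM2r.
  by lra.
pose Q y := [set x in X | y \in S x].
pose t := rho / 8%:R * (p / 16%:R) ^+ 2 * #|X|%:R.
pose Z := [set y in Y :\: H | t <= #|Q y|%:R].
exists Z; split.
- by apply/subsetP=> y; rewrite !inE => /andP[/andP[_ ->]].
- pose w := rho / 2%:R * lev 2; have w0 : 0 < w by rewrite mulr_gt0 // divr_gt0.
  have lo : 3%:R / 4%:R * #|X|%:R * w <= (\sum_(x in X) #|S' x|)%:R.
    have cXB : 3%:R / 4%:R * #|X|%:R <= #|X :\: B|%:R :> R.
      by have := card_setDr R X B; lra.
    apply: (@le_trans _ _ (#|X :\: B|%:R * w)); first by rewrite ler_pM2r.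
    have -> : #|X :\: B|%:R * w = \sum_(x in X) (if x \notin B then w else 0).
      rewrite -big_mkcondr mulr_natl -sumr_const; apply: eq_bigl => x.
      by rewrite in_setD andbC.
    rewrite natr_sum; apply: ler_sum => x xX.
    by case: ifP => // xB; apply: cS'.
  have EQ : (\sum_(x in X) #|S' x| = \sum_(y in Y :\: H) #|Q y|)%N.
    rewrite -(card_pairsC X (Y :\: H) (fun x y => y \in S x)).
    apply: eq_bigr => x _; congr #|pred_of_set _|; apply/setP=> y.
    rewrite [RHS]inE !in_setD; case: (boolP (y \in S x)) => [yS|]; rewrite ?andbF // !andbT.
    by have := subsetP (SY x) _ yS; rewrite inE => /andP[-> _]; rewrite andbT.
  have up : (\sum_(x in X) #|S' x|)%:R <= 2%:R * p * #|X|%:R * #|Z|%:R + t * #|T|%:R.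
    have t0 : 0 <= t.
      apply/ltW/mulr_gt0 => //; apply: mulr_gt0; first by rewrite divr_gt0.
      by rewrite exprn_gt0 // divr_gt0.
    apply: (@le_trans _ _ (\sum_(y in Y :\: H) ((if y \in Z then 2%:R * p * #|X|%:R else 0) + t))).
      rewrite EQ natr_sum; apply: ler_sum => y yY.
      case: ifP => yZ.
        rewrite -[leLHS]addr0 lerD //; apply: (@le_trans _ _ #|X :&: nb y|%:R).
          rewrite ler_nat; apply/subset_leq_card/subsetP => x; rewrite !inE => /andP[-> yS] /=.
          by have := subsetP (SY x) _ yS; rewrite !inE es => /andP[].
        move: yY; rewrite in_setD => /andP[+ yY]; rewrite inE yY /= -leNgt //.
      rewrite add0r; move/negbT: yZ; rewrite inE yY /= -ltNge; exact: ltW.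
    have c0 : 0 <= 2%:R * p * #|X|%:R by rewrite ltW // !mulr_gt0.
    rewrite big_split /=; apply: lerD.
      rewrite -big_mkcondr sumr_const -[leLHS]mulr_natr; apply: ler_wpM2l => //.
      rewrite ler_nat; apply: subset_leq_card.
      by apply/subsetP => y; rewrite unfold_in => /andP[].
    by rewrite sumr_const -[leLHS]mulr_natr; apply: ler_wpM2l; rewrite // ler_nat max_card.
  have tE : t * #|T|%:R = rho / 8%:R * lev 2 * #|X|%:R.
    by rewrite /t levE; ring.
  rewrite tE in up; rewrite levS in w w0 lo up.
  have h : #|X|%:R * (rho / 4%:R * (p / 16%:R * lev 1)) <= #|X|%:R * (2%:R * p * #|Z|%:R).
    have := le_trans lo up; rewrite /w levS; lra.
  move: h; rewrite ler_pM2l // => h.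
  have h' : p * (rho / 128%:R * lev 1) <= p * #|Z|%:R by lra.
  move: h'; rewrite ler_pM2l // => h'.
  have : 0 < rho * lev 1 by rewrite mulr_gt0.
  by lra.
- move=> y; rewrite inE => /andP[_]; apply: le_trans.
  rewrite /t levE; move: cX; rewrite levn => cX.
  have : rho / 8%:R * (p / 16%:R) ^+ 2 * (rho * #|T|%:R) <=
         rho / 8%:R * (p / 16%:R) ^+ 2 * #|X|%:R.
    by rewrite ler_wpM2l // mulr_ge0 ?exprn_ge0 ?divr_ge0 // ltW.
  by apply: le_trans; rewrite le_eqVlt; apply/orP; left; apply/eqP; ring.
Qed.

End Counting.

Ltac edge wc i j :=
  apply: (wf_edge (i := i) (j := j) wc); rewrite ?inE ?eqxx ?orbT //.

Section LeftTwo.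
Variables (R : realType) (T : finType) (e : rel T) (p : R).
Variables (eta rho rho2 : R).
Hypothesis gg : good_graph e p rg2 eta.
Variables (z0 z1 : T) (P : nat -> {set T}) (V : {set T}).
Hypotheses (rho_gt0 : 0 < rho) (rho2_gt0 : 0 < rho2).
Hypotheses (rho2_1 : rho2 <= rho / 256%:R) (rho2_2 : rho2 <= rho ^+ 2 / 8%:R).
Hypothesis small : 24%:R * eta <= tol R 9 * rho2.
Hypotheses (z01 : e z0 z1).
Hypothesis Psz : forall i, (i < 6)%N -> rho * lev T p (2 - i) <= #|P i|%:R.
Hypothesis P0 : forall x, x \in P 0%N -> e z0 x && e z1 x.
Hypothesis P1 : forall x, x \in P 1%N -> e z1 x.
Hypothesis Pd : forall i j, (i < 6)%N -> (j < 6)%N -> i != j -> [disjoint P i & P j].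
Local Notation lev := (lev T p).
Local Notation nb := (nb e).
Local Notation near2 := (near 2).

Let es := gg_sym gg.
Let ns := near_sym 2.
Let ni := near_irr 2.
Let w0 : wf e near2 [::] := fun u v h => match notF h with end.

Let rho2_rho : rho2 <= rho. Proof. apply: le_trans rho2_1 _; have h := rho_gt0; lra. Qed.
Let eta0 : 0 < eta. Proof. exact: (gg_eta gg). Qed.
Let small' m r : (m <= 9)%N -> rho2 <= r -> 24%:R * eta <= tol R m * r.
Proof.
move=> m9 r2; apply: le_trans small _; apply: ler_pM => //; first exact: ltW (tol_gt0 _ _).
- exact: ltW.
- exact: tol_le.
Qed.
Let small3 r : rho2 <= r -> 3%:R * eta <= r.
Proof.
move=> r2; have h := small' (leqnn 9) r2.
have r0 : 0 < r by exact: lt_le_trans r2.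
have : tol R 9 * r <= r.
  by apply: ler_piMl; [exact: ltW|apply: le_trans (tol_le4 _ _) _; lra].
have e0 := eta0; lra.
Qed.

Definition two_path a0 a1 : Prop := exists c0 c1,
  [/\ c0 \in P 0, c1 \in P 1 & kpath e 2 [:: z0; z1; c0; c1; a0; a1]].
Definition rich a0 := [set y in P 5 :&: nb a0 | `[< two_path a0 y >]].

(** Only [a0] is moved ahead of [c0] and [c1]. Moving [a1] past [c1] as well would compare exponents
    1 and 3, so [a1] is merely watched and the number of its candidates is kept. *)
Lemma most_rich : most (4%:R^-1 : R) (P 4) (fun a0 => rho * lev 2 <= #|rich a0|%:R).
Proof.
pose i0 : item T := ((0, 2)%N, P 0); pose i1 : item T := ((1, 1)%N, P 1).
pose i2 : item T := ((2, 0)%N, P 4); pose i3 : item T := ((3, 0)%N, P 5).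
have sz0 : all_sized e p rho near2 ([:: i0; i1; i2] ++ [:: i3]) [::].
  have c0 (I : item T) : cand e near2 I [::] = I.2 by apply/setP=> x; rewrite inE andbT.
  move=> I; rewrite /sized c0 /expo /= addn0 !inE => /or4P[] /eqP-> /=.
  - exact: (Psz (i := 0)).
  - exact: (Psz (i := 1)).
  - exact: (Psz (i := 4)).
  - exact: (Psz (i := 5)).
have N1 : nested e p rho near2 (tol R 9) [:: i0; i1; i2] [::] (all_sized e p rho near2 [:: i3]).
  apply: (nested_init gg rho_gt0) => //; first exact: small3.
  by rewrite [size _]/=; have := small' (leqnn 9) rho2_rho; have := eta0; lra.
have N2 : nested e p rho near2 (tol R 7) (i2 :: [:: i0; i1] ++ [::]) [::] (all_sized e p rho near2 [:: i3]).
  apply: (nested_move gg ns rho_gt0 (M := 9) (N := 4)) => //.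
  - exact: all_sized_perm.
  - by move=> I; rewrite !inE => /orP[] /eqP-> /=; apply: Pd.
  - by have := small' (leqnn 9) rho2_rho; lra.
case: N2 => _; have -> : cand e near2 i2 [::] = P 4 by apply/setP=> x; rewrite inE andbT.
apply: most_impl => [|a0 a0P]; first exact: tol_le4.
change (nested e p rho near2 (tol R 7) [:: i0; i1] [:: (2%N, a0)]
  (all_sized e p rho near2 [:: i3]) -> rho * lev 2 <= #|rich a0|%:R) => N3.
have w2 : wf e near2 [:: (2%N, a0)].
  by move=> u v; rewrite !inE => /eqP-> /eqP->.
have [||c [wc sz lc cin]] := nested_ex gg ns ni rho_gt0 _ _ w2 N3 => //.
  by apply: le_lt_trans (tol_le4 _ _) _; lra.
case: c lc wc sz cin => [|[j1 c1] [|[j0 c0] [|? ?]]] //= [-> ->] wc sz cin.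
have h0 : c0 \in P 0 by apply: (cin i0 (0%N, c0)) => //; rewrite !inE ?eqxx ?orbT.
have h1 : c1 \in P 1 by apply: (cin i1 (1%N, c1)) => //; rewrite !inE ?eqxx ?orbT.
have {}sz := sz i3 (mem_head _ _); rewrite /sized /expo /= in sz.
apply: le_trans sz _; rewrite ler_nat; apply/subset_leq_card/subsetP => y.
rewrite !inE /= andbT => /and3P[yP c1y a0y].
rewrite yP a0y /=; apply/asboolP; exists c0, c1; split=> //=.
have e01 : e c0 c1 by edge wc 0%N 1%N.
have e02 : e c0 a0 by edge wc 0%N 2%N.
have e12 : e c1 a0 by edge wc 1%N 2%N.
by rewrite z01 (P1 h1) e01 e02 e12 c1y a0y; have /andP[-> ->] := P0 h0.
Qed.

Definition two_path' a1 r0 : Prop := exists c0 c1 a0,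
  [/\ c0 \in P 0, c1 \in P 1, a0 \in P 4 &
    kpath e 2 [:: z0; z1; c0; c1; a0; a1; r0]].

(** By [many_rich], many [a1] are reached from many [a0]. For such an [a1], most [r0] are adjacent
    to a suitable [a0]; then [r0] and [r1] are moved ahead of [a1]. Labels 2, 3 stand for [a0],
    [a1], and labels 4, 5 for [r0], [r1]. *)
Lemma nested_last : nested e p rho2 distinct (tol R 4)
  [:: ((0%N, 0%N), P 2); ((1%N, 0%N), P 3)] [::]
  (assigned (fun f => exists c0 c1 a0 a1,
    [/\ c0 \in P 0, c1 \in P 1, a0 \in P 4, a1 \in P 5 &
      kpath e 2 [:: z0; z1; c0; c1; a0; a1; f 0%N; f 1%N]])).
Proof.
have e0 := eta0; have lv a := lev_gt0 a gg.
have [|||||X2 [X2P cX2 HX2]] := many_rich gg (isT : rg2 0 2) (X := P 4) (Y := P 5)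
    (S := rich) rho_gt0.
- by have := small3 rho2_rho; lra.
- exact: Pd.
- exact: (Psz (i := 4)).
- by move=> x; apply/subsetP => y; rewrite inE => /andP[].
- exact: most_rich.
pose back a1 := [set x in P 4 | a1 \in rich x].
pose i3 : item T := ((3, 1)%N, X2).
pose i4 : item T := ((4, 0)%N, P 2); pose i5 : item T := ((5, 0)%N, P 3).
have c0 (I : item T) : cand e near2 I [::] = I.2 by apply/setP=> x; rewrite inE andbT.
have sz0 : all_sized e p rho2 near2 [:: i3; i4; i5] [::].
  move=> I; rewrite /sized c0 /expo /= addn0 !inE => /or3P[] /eqP-> /=.
  - by apply: le_trans cX2; rewrite ler_pM2r.
  - by apply: le_trans (Psz (i := 2) isT); rewrite ler_pM2r.
  - by apply: le_trans (Psz (i := 3) isT); rewrite ler_pM2r.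
have N1 : nested e p rho2 near2 (tol R 8) [:: i3; i4; i5] [::] (all_sized e p rho2 near2 [::]).
  apply: (nested_init gg rho2_gt0) => //; first exact: small3.
  by rewrite [size _]/=; have := small' (isT : (8 <= 9)%N) (lexx rho2); lra.
have N2 : nested e p rho2 near2 (tol R 8) [:: i3; i4] [::]
    (assigned (fun f => two_path' (f 3) (f 4))).
  split; first by move=> I II; apply: sz0; move: II; rewrite !inE => /orP[->|->]; rewrite ?orbT.
  have [|||W cW HW] := typical_step (adj := near2) (I := i3) (c := [::]) (l := [:: i4]) gg rho2_gt0.
  - exact: small3.
  - by move=> K; rewrite inE => /eqP->.
  - by move=> I; rewrite inE => /eqP->; apply: sz0; rewrite !inE eqxx orbT.
  exists W.
    apply: le_trans cW _; rewrite c0 [size _]/= mul1r.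
    have h := small' (isT : (8 <= 9)%N) (lexx rho2).
    apply: (@le_trans _ _ (tol R 8 * (rho2 * lev 1))).
      have : (3%:R * eta) * lev 1 <= (tol R 8 * rho2) * lev 1 by rewrite ler_pM2r //; lra.
      by rewrite -!mulrA.
    apply: ler_wpM2l; first exact: ltW (tol_gt0 _ _).
    by apply: le_trans cX2; rewrite ler_pM2r.
  move=> a1; rewrite c0 => a1X a1W; have sz1 := HW a1 a1W; split=> //.
  (* [back a1] already lies in the neighbourhood of [a1]. Its size is of order [lev 2]: exponent 1
     for the pool and 1 for the chosen label 3. *)
  pose i2 : item T := ((2, 1)%N, back a1).
  have cB : cand e near2 i2 [:: (3%N, a1)] = back a1.
    apply/setP=> x; rewrite [LHS]inE /=; case: (boolP (x \in back a1)) => // xB.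
    by move: xB; rewrite !inE andbT => /and3P[_ /andP[_ xa] _]; rewrite es.
  have sz2 : all_sized e p rho2 near2 [:: i2; i4] [:: (3%N, a1)].
    move=> I; rewrite !inE => /orP[] /eqP->; last by apply: sz1; rewrite inE.
    rewrite /sized cB /expo /=; apply: le_trans (HX2 _ a1X).
    by rewrite ler_pM2r.
  have M1 : nested e p rho2 near2 (tol R 9) [:: i2; i4] [:: (3%N, a1)]
      (all_sized e p rho2 near2 [::]).
    apply: (nested_init gg rho2_gt0) => //; first exact: small3.
    by rewrite [size _]/=; have := small' (isT : (9 <= 9)%N) (lexx rho2); lra.
  have M2 : nested e p rho2 near2 (tol R 8) (i4 :: [:: i2] ++ [::]) [:: (3%N, a1)]
      (all_sized e p rho2 near2 [::]).
    apply: (nested_move gg ns rho2_gt0 (M := 9) (N := 4)) => //.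
    - by move=> I; rewrite inE => /eqP->; apply: disjointWl (Pd (i := 4) (j := 2) isT isT isT);
        apply/subsetP => x; rewrite inE => /andP[].
    - by have := small' (leqnn 9) (lexx rho2); lra.
  case: M2 => _; apply: most_impl => // r0 r0i.
  change (nested e p rho2 near2 (tol R 8) [:: i2] [:: (4%N, r0); (3%N, a1)]
    (all_sized e p rho2 near2 [::]) -> assigned (fun f => two_path' (f 3) (f 4))
    [:: (4%N, r0); (3%N, a1)]) => M3 f fc.
  have w3 : wf e near2 [:: (3%N, a1)] by move=> u v; rewrite !inE => /eqP-> /eqP->.
  have w4 : wf e near2 [:: (4%N, r0); (3%N, a1)] by apply: (wf_cons gg ns ni w3 r0i).
  have [||c [wc _ lc cin]] := nested_ex gg ns ni rho2_gt0 _ _ w4 M3 => //.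
    by apply: le_lt_trans (tol_le4 _ _) _; lra.
  have := fc (4%N, r0); have := fc (3%N, a1); rewrite !inE !eqxx ?orbT => /(_ isT) -> /(_ isT) ->.
  case: c lc wc cin => [|[j a0] [|? ?]] //= [->] wc cin.
  have : a0 \in back a1 by apply: (cin i2 (2%N, a0)); rewrite ?inE.
  rewrite inE => /andP[a0P]; rewrite inE => /andP[_ /asboolP[c0' [c1 [h0 h1 ph]]]].
  exists c0', c1, a0; split=> //.
  have e23 : e a0 a1 by edge wc 2%N 3%N.
  have e24 : e a0 r0 by edge wc 2%N 4%N.
  have e34 : e a1 r0 by edge wc 3%N 4%N.
  apply: (@kpath_glue _ _ _ [:: z0; z1; c0'; c1] [:: a0; a1] [:: r0]) => //=.
  by rewrite e23 e24 e34.
have ta : 0 <= tol R 8 by exact: ltW (tol_gt0 _ _).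
pose L := fun c => all_sized e p rho2 near2 [::] c /\
  assigned (fun f => two_path' (f 3) (f 4)) c.
have HL : perm_inv L.
  move=> c c' cc [h1 h2]; split; first exact: all_sized_perm cc h1.
  exact: assigned_perm cc h2.
have N3 : nested e p rho2 near2 (tol R 7) ([:: i3] ++ i4 :: [:: i5]) [::] L.
  have := nested_and (l1 := [:: i3; i4]) (l2 := [:: i5]) (@assigned_cons T (fun f => two_path' (f 3) (f 4))) N1 N2 ta.
  by apply: nested_impl => //; exact: tol_double.
have N4 : nested e p rho2 near2 (tol R 6) (i4 :: [:: i3] ++ [:: i5]) [::] L.
  apply: (nested_move gg ns rho2_gt0 (M := 9) (N := 4)) => //.
  - by move=> I; rewrite inE => /eqP->; apply: disjointWl X2P (Pd (i := 5) (j := 2) isT isT isT).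
  - by have := small' (leqnn 9) (lexx rho2); lra.
have N5 : nested e p rho2 near2 (tol R 5) ([:: i4; i5] ++ [:: i3]) [::] L.
  case: N4 => sz M4; split.
    by apply: all_sized_sub sz => I; rewrite !inE => /or3P[] ->; rewrite ?orbT.
  apply: most_impl M4 => [|r0 _]; first exact: tol_le.
  change (nested e p rho2 near2 (tol R 6) ([:: i3] ++ i5 :: [::]) [:: (4%N, r0)] L ->
    nested e p rho2 near2 (tol R 5) (i5 :: [:: i3] ++ [::]) [:: (4%N, r0)] L) => M5.
  apply: (nested_move gg ns rho2_gt0 (M := 9) (N := 4)) => //.
  - by move=> I; rewrite inE => /eqP->; apply: disjointWl X2P (Pd (i := 5) (j := 3) isT isT isT).
  - by have := small' (leqnn 9) (lexx rho2); lra.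
have N6 := nested_track gg ns ni w0 (nested_split N5).
apply: nested_impl (tol_le R (isT : (4 <= 5)%N)) (fun c h => h) _.
apply: (@nested_relabel _ _ _ _ _ near2 _ (subn^~ 4) _ _ [::] _ _
  [pred i | (i == 4) || (i == 5)]%N _ _ _ _ N6) => //.
- by move=> i j; rewrite !inE => /orP[] /eqP-> /orP[] /eqP->.
- by move=> i; rewrite /= !inE.
- move=> c [Nc wc lc] f fc.
  have [||c' [wc' [_ Qc] lc' cin]] := nested_ex gg ns ni rho2_gt0 _ _ wc Nc => //.
    by apply: le_lt_trans (tol_le4 _ _) _; lra.
  case: c lc fc wc Nc wc' Qc => [|[j5 r1] [|[j4 r0] [|? ?]]] //= [-> ->] fc _ _.
  case: c' lc' cin => [|[j3 a1] [|? ?]] //= [->] cin wc Qc.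
  have a1X : a1 \in X2 by apply: (cin i3 (3%N, a1)); rewrite ?inE.
  have f1 : f 1%N = r1 by apply: (fc (1%N, r1)); rewrite !inE eqxx.
  have f0 : f 0%N = r0 by apply: (fc (0%N, r0)); rewrite !inE eqxx orbT.
  rewrite f0 f1.
  have [|c0' [c1 [a0 [h0 h1 h2 ph]]]] := Qc (fun i => if i == 3%N then a1 else if i == 4%N then r0 else r1).
    by move=> u; rewrite !inE => /or3P[] /eqP->.
  rewrite /= in ph; exists c0', c1, a0, a1; split=> //; first exact: (subsetP X2P).
  have e34 : e a1 r0 by edge wc 3%N 4%N.
  have e35 : e a1 r1 by edge wc 3%N 5%N.
  have e45 : e r0 r1 by edge wc 4%N 5%N.
  have := @kpath_glue _ e 2 [:: z0; z1; c0'; c1; a0] [:: a1; r0] [:: r1] isT ph.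
  by rewrite /= e34 e35 e45; apply.
Qed.

End LeftTwo.

Lemma left_two (R : realType) : left_spec R 2 rg2.
Proof.
move=> rho rho0; pose rho2 := Num.min (rho / 256%:R) (rho ^+ 2 / 8%:R).
have rho20 : 0 < rho2 by rewrite lt_min !divr_gt0 // exprn_gt0.
have t0 := tol_gt0 R 9.
exists rho2, (tol R 9 * rho2 / 24%:R); split=> //; first by rewrite divr_gt0 // mulr_gt0.
move=> T e p gg [|z0 [|z1 [|? ?]]] P V //= _ /andP[/andP[z01 _] _] Psz PN Pd PV.
have P0 x : x \in P 0%N -> e z0 x && e z1 x.
  by move/(subsetP (PN 0%N isT)); rewrite inE /= andbT.
have P1 x : x \in P 1%N -> e z1 x.
  by move/(subsetP (PN 1%N isT)); rewrite inE /= andbT.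
have := nested_last gg rho0 rho20 _ _ _ z01 Psz P0 P1 Pd.
have h1 : rho2 <= rho / 256%:R by rewrite ge_min lexx.
have h2 : rho2 <= rho ^+ 2 / 8%:R by rewrite ge_min lexx orbT.
move/(_ h1 h2); rewrite mulrC divfK ?pnatr_eq0 // => /(_ (lexx _)).
apply: nested_impl => // c; apply: assigned_mono => f [c0 [c1 [a0 [a1 [h0 h1' h4 h5 ph]]]]].
exists [:: c0; c1; a0; a1]; split=> //.
- have ne i j x y : (i < 6)%N -> (j < 6)%N -> i != j -> x \in P i -> y \in P j -> x != y.
    move=> i6 j6 ij xi yj; apply/eqP => xy; have /pred0P/(_ x) := Pd i j i6 j6 ij.
    by rewrite /= xi xy yj.
  rewrite /= !inE !negb_or.
  rewrite (ne 0%N 1%N) // (ne 0%N 4%N) // (ne 0%N 5%N) // (ne 1%N 4%N) // (ne 1%N 5%N) //.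
  by rewrite (ne 4%N 5%N).
- move=> x; rewrite !inE => /or4P[] /eqP->.
  + exact: (subsetP (PV 0%N isT)).
  + exact: (subsetP (PV 1%N isT)).
  + exact: (subsetP (PV 4%N isT)).
  + exact: (subsetP (PV 5%N isT)).
Qed.

(** * Absorbers *)

Definition suff (T : Type) (j : nat) (s : seq T) : seq T := drop (size s - j) s.

Lemma suff_rcons (T : Type) j (s : seq T) v :
  suff j.+1 (rcons s v) = rcons (suff j s) v.
Proof. by rewrite /suff size_rcons subSS drop_rcons // leq_subr. Qed.

Lemma suff_cat (T : Type) j (s t : seq T) : (j <= size t)%N -> suff j (s ++ t) = suff j t.
Proof.
move=> jt; rewrite /suff size_cat drop_cat ifF; last by lia.
by congr drop; lia.
Qed.

Lemma kpath_rcons (T : eqType) (e : rel T) k s v : symmetric e ->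
  kpath e k (rcons s v) = kpath e k s && all (e v) (suff k s).
Proof.
move=> es; rewrite -(kpath_rev _ _ es) rev_rcons /= (kpath_rev _ _ es) andbC.
by rewrite take_rev all_rev.
Qed.

Section Extend.
Variables (R : realType) (k : nat) (rg : rel nat) (T : finType) (e : rel T) (p eta : R).
Hypothesis gg : good_graph e p rg eta.
Hypothesis k_gt0 : (0 < k)%N.
Hypothesis rg_k : forall a, (a < k)%N -> rg a k.
Local Notation lev := (lev T p).
Local Notation nb := (nb e).
Implicit Types (P U X : {set T}) (Q v : seq T).

Lemma commons_rcons P s x : P :&: commons e (rcons s x) = (P :&: commons e s) :&: nb x.
Proof. by apply/setP=> y; rewrite !inE all_rcons; case: (y \in P); rewrite //= andbC. Qed.

(** What allows a power of a path ending with [Q] to be continued in [P]. For a [k]-tuple it agrees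
    with [good], by [gd_good]. *)
Definition gd rho Q P : Prop := forall j, (j <= k)%N -> (j <= size Q)%N ->
  rho * lev j <= #|P :&: commons e (suff j Q)|%:R.

(** For sets that are watched but not consumed: only the last [t] vertices were chosen with regard
    to [P], and the factor 2 gained at a typical vertex is kept. *)
Definition trk rho t Q P : Prop := forall j, (0 < j <= t)%N ->
  2%:R * (rho * lev j) <= #|P :&: commons e (suff j Q)|%:R.

Lemma commons_nil P : P :&: commons e [::] = P.
Proof. by apply/setP => y; rewrite !inE andbT. Qed.

Lemma suff0 (s : seq T) : suff 0 s = [::].
Proof. by rewrite /suff subn0 drop_size. Qed.

Lemma pick_typical rho X (Ss : seq ({set T} * nat)) :
  rho * lev k <= #|X|%:R -> 3%:R * (size Ss)%:R * eta < rho ->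
  exists2 v, v \in X & forall u, u \in Ss -> (u.2 < k)%N ->
    3%:R * (eta * lev u.2) <= #|u.1|%:R ->
    p / 8%:R * #|u.1|%:R <= #|u.1 :&: nb v|%:R.
Proof.
move=> cX small.
have lv a := lev_gt0 a gg; have e0 := gg_eta gg; have p0 := gg_p0 gg.
pose B (u : {set T} * nat) : {set T} :=
  if (u.2 < k)%N && (3%:R * (eta * lev u.2) <= #|u.1|%:R) then
  [set y | #|u.1 :&: nb y|%:R < p / 8%:R * #|u.1|%:R] else set0.
have [|W cW BW] := @union_bound R T _ Ss B (3%:R * (eta * lev k)).
  move=> u _; rewrite /B; case: ifP => [/andP[uk c]|_]; last first.
    by rewrite cards0 mulr_ge0 // mulr_ge0 // ltW.
  have r := rg_k uk.
  apply: (typical (gg_sym gg) p0 (gg_reg gg r) _ _ c); first exact: (gg_big gg r).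
  by rewrite mulr_gt0.
have : (#|W| < #|X|)%N.
  rewrite -(ltr_nat R); apply: le_lt_trans cW _; apply: lt_le_trans cX.
  by rewrite !mulrA ltr_pM2r // mulrAC mulrC mulrA.
case: (set_0Vmem (X :\: W)) => [XW|[v]].
  have : X \subset W by rewrite -setD_eq0 XW.
  by move/subset_leq_card; rewrite leqNgt => /negP.
rewrite inE => /andP[vW vX] _; exists v => // u uS uk c.
have := subsetP (BW u uS) v; rewrite /B uk c /= inE leNgt.
by case: ltP => // _ /(_ isT); rewrite (negbTE vW).
Qed.

Variables (rho rho' : R).
Hypotheses (rho'_gt0 : 0 < rho') (rho'_le : rho' <= rho).

(** Greedy choice. The bound for the last [j + 1] vertices comes from the bound for the last [j]
    before the new vertex, and ultimately from the size of what remains of [U]; hence it does not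
    deteriorate with [m]. The factor 2 gained pays for deleting the new vertex from [U]. *)
Lemma extend m t Q U (Ps : seq {set T}) :
  3%:R * ((size Ps).+1 * k)%:R * eta < rho' ->
  kpath e k Q -> gd rho' Q U -> (t <= k)%N -> (t <= size Q)%N ->
  (forall P, P \in Ps -> rho * lev 0 <= #|P|%:R) ->
  (forall P, P \in Ps -> trk rho t Q P) ->
  rho' * lev 0 + m%:R <= #|U|%:R ->
  exists v, [/\ size v = m, uniq v, {subset v <= U}, kpath e k (Q ++ v) &
    gd rho' (Q ++ v) (U :\: [set x in v]) /\
    (forall a, (a <= m)%N -> forall P, P \in Ps -> trk rho (minn k (t + a)) (Q ++ take a v) P)].
Proof.
move=> small pQ gQ tk tQ cP tP.
have lv a := lev_gt0 a gg; have e0 := gg_eta gg; have p0 := gg_p0 gg.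
have ks : 1 <= ((size Ps).+1 * k)%:R :> R by rewrite ler1n muln_gt0.
have e3 : 3%:R * eta <= rho' by nra.
have lv1 : 1 <= rho' * lev k.
  have r := rg_k k_gt0; rewrite (gg_rg gg) in r.
  apply: le_trans (gg_big gg r) _; rewrite ler_pM2r //; lra.
elim: m => [|m IH] cU.
  exists [::]; rewrite cats0; split=> //; split=> [|[|a]] //.
    by have -> : U :\: [set x in [::]] = U by apply/setP=> x; rewrite !inE.
  by move=> _ P PP; rewrite addn0 (minn_idPr _) //; apply: tP.
have [|v [sv uv vU pv [gv tv]]] := IH.
  by apply: le_trans cU; rewrite lerD2l ler_nat.
set S := [set x in v] in gv; set Q' := Q ++ v in pv gv.
pose Ss := [seq (P :&: commons e (suff j Q'), j) | P <- (U :\: S) :: Ps, j <- iota 0 k].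
have sSs : size Ss = ((size Ps).+1 * k)%N by rewrite size_allpairs size_iota.
pose s := minn k (size Q').
have [||x xX Hx] := @pick_typical rho' ((U :\: S) :&: commons e (suff s Q')) Ss.
- apply: le_trans (gv _ _ _); rewrite ?geq_minl ?geq_minr //.
  by rewrite ler_pM2l //; apply: (le_lev gg); exact: geq_minl.
- by rewrite sSs.
have sE : suff s Q' = suff k Q'.
  rewrite /suff /s; congr drop; nlia.
move: xX; rewrite in_setI in_setD inE => /andP[/andP[xv xU]]; rewrite inE sE => ax.
have grow P j r : 0 < r -> 3%:R * eta <= r -> P \in (U :\: S) :: Ps -> (j < k)%N ->
    r * lev j <= #|P :&: commons e (suff j Q')|%:R ->
    2%:R * (r * lev j.+1) <= #|P :&: commons e (suff j.+1 (rcons Q' x))|%:R.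
  move=> r0 er PP jk c; rewrite suff_rcons commons_rcons.
  have uS : (P :&: commons e (suff j Q'), j) \in Ss.
    by apply: (@allpairs_f _ _ _ (fun P j => (P :&: commons e (suff j Q'), j)));
      rewrite ?mem_iota.
  have := Hx _ uS jk; rewrite /= => H; apply: le_trans (H _); last first.
    by apply: le_trans c; rewrite mulrA ler_pM2r.
  have : p / 8%:R * (r * lev j) <= p / 8%:R * #|P :&: commons e (suff j Q')|%:R.
    by rewrite ler_pM2l // divr_gt0.
  apply: le_trans; rewrite levS.
  by rewrite le_eqVlt; apply/orP; left; apply/eqP; field.
exists (rcons v x); rewrite size_rcons sv -rcons_cat -/Q'; split=> //.
- by rewrite rcons_uniq xv.
- by move=> y; rewrite mem_rcons inE => /orP[/eqP->|/vU].
- rewrite kpath_rcons ?pv; last exact: (gg_sym gg).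
  by apply: sub_all ax => y; rewrite (gg_sym gg).
split=> [j jk js|a am P PP].
  have SE : U :\: [set y in rcons v x] = (U :\: S) :\ x.
    by apply/setP => y; rewrite !inE mem_rcons inE negb_or andbA.
  rewrite SE; case: j jk js => [|j] jk js.
    rewrite suff0 commons_nil.
    have := card_setDr R U [set y in rcons v x]; rewrite SE.
    have : #|[set y in rcons v x]|%:R <= m.+1%:R :> R.
      by rewrite ler_nat; apply: leq_trans (card_set_seq _) _; rewrite size_rcons sv.
    by lra.
  have h := grow (U :\: S) j rho' rho'_gt0 e3 (mem_head _ _) jk.
  have {}h := h (gv j (ltnW jk) _).
  have h2 : (#|(U :\: S) :&: commons e (suff j.+1 (rcons Q' x))| <=
      #|((U :\: S) :\ x) :&: commons e (suff j.+1 (rcons Q' x))| + 1)%N.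
    rewrite (cardsD1 x) addnC leq_add ?leq_b1 //; apply/subset_leq_card/subsetP => y.
    by rewrite !in_setI !in_setD1 !in_setI => /and3P[-> -> ->].
  move: h2; rewrite -(ler_nat R) natrD => h2.
  have h3 : rho' * lev k <= rho' * lev j.+1 by rewrite ler_pM2l //; apply: (le_lev gg).
  have {}h := h _; rewrite size_rcons ltnS in js; have {}h := h js; lra.
case: (leqP a m) => am'.
  rewrite -cats1 take_cat sv; case: ltnP => am2.
    by apply: tv => //; exact: ltnW.
  have -> : (a - m = 0)%N by nlia.
  rewrite take0 cats0.
  by have := tv m (leqnn m) P PP; rewrite -[X in take X]sv take_size; have -> : a = m by nlia.
have -> : a = m.+1 by nlia.
rewrite take_oversize ?size_rcons ?sv // -rcons_cat -/Q' => -[//|j] /andP[_].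
rewrite leq_min => /andP[jk jt].
apply: grow => //; first exact: lt_le_trans rho'_le; first exact: le_trans rho'_le.
  by rewrite inE PP orbT.
case: j jk jt => [|j] jk jt; first by rewrite suff0 commons_nil; apply: cP.
have := tv m (leqnn m) P PP; rewrite -[X in take X]sv take_size => /(_ j.+1 _).
have jm : (0 < j.+1 <= minn k (t + m))%N by nlia.
move=> /(_ jm); have : 0 < rho * lev j.+1 by rewrite mulr_gt0 // (lt_le_trans rho'_gt0).
by move=> h1 h2; lra.
Qed.

End Extend.

Section Shrink.
Variables (R : realType) (k : nat) (rg : rel nat) (T : finType) (e : rel T) (p eta : R).
Hypothesis gg : good_graph e p rg eta.
Local Notation lev := (lev T p).

Lemma gd_shrink rho rho' Q (P : {set T}) (s : seq T) m :
  rho' <= rho -> m%:R <= (rho - rho') * lev k -> (size s <= m)%N ->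
  gd k e p rho Q P -> gd k e p rho' Q (P :\: [set x in s]).
Proof.
move=> rr mk sm H j jk jQ; have := H j jk jQ; set C := commons _ _ => h.
have h1 := card_setDr R (P :&: C) [set x in s]; rewrite -setIDAC in h1.
have h3 : #|[set x in s]|%:R <= m%:R :> R by rewrite ler_nat (leq_trans (card_set_seq s)).
have h2 : (rho - rho') * lev k <= (rho - rho') * lev j.
  by rewrite ler_wpM2l ?subr_ge0 //; exact: (le_lev gg).
by lra.
Qed.

Lemma gd_le rho rho' Q (P P' : {set T}) : rho' <= rho -> P \subset P' ->
  gd k e p rho Q P -> gd k e p rho' Q P'.
Proof.
move=> rr PP H j jk jQ; apply: (le_trans _ (le_trans (H j jk jQ) _)).
  by rewrite ler_wpM2r // ltW // (lev_gt0 _ gg).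
by rewrite ler_nat subset_leq_card // setSI.
Qed.

Lemma gd_good rho z (U : {set T}) : size z = k -> gd k e p rho z U <-> good e p rho z U.
Proof.
move=> zk; split=> H j; last first.
  move=> jk _; have := H (k - j)%N; rewrite /suff zk leq_subr subKn //; exact.
rewrite zk => jk; have := H (k - j)%N; rewrite /suff zk subKn //.
by move/(_ (leq_subr _ _) (leq_subr _ _)).
Qed.
End Shrink.

Lemma gd_of_trk (R : realType) (T : finType) k (e : rel T) (p r : R) Q (P : {set T}) : r * lev T p 0 <= #|P|%:R ->
  trk e p (r / 2%:R) k Q P -> gd k e p r Q P.
Proof.
move=> cP H [|j] jk _; first by rewrite suff0 commons_nil.
have := H j.+1 jk; have -> : 2%:R * (r / 2%:R * lev T p j.+1) = r * lev T p j.+1 by field.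
by [].
Qed.

(** Here the quality of the new end may drop from [rho] to [rho'], and only [U] is followed;
    [absorb_of_core] repairs both. *)
Definition core_spec (R : realType) (k : nat) (rg : rel nat) (C : nat) : Prop :=
  forall rho : R, 0 < rho -> exists rho' eta : R, [/\ 0 < rho', 0 < eta &
  forall (T : finType) (e : rel T) (p : R), good_graph e p rg eta ->
  forall (U : {set T}) (w : T) (z : seq T), w \notin U -> size z = k ->
  kpath e k z -> gd k e p rho z U -> rho * lev T p 1 <= #|U :&: nb e w|%:R ->
  exists q0 q1 y a b : seq T, [/\ [/\ (size q0 <= C)%N, uniq q0 & {subset q0 <= U}],
    perm_eq q1 (w :: q0), kpath e k (z ++ q0) && kpath e k (z ++ q1),
    [/\ size y = k, q0 = a ++ y & q1 = b ++ y] &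
    gd k e p rho' y (U :\: [set x in q0])]].

Definition absorbing (R : realType) (k C : nat) (T : finType) (e : rel T) (p rho : R) : Prop :=
  forall (U : {set T}) (w : T) (z : seq T) (Ps : seq {set T}), (size Ps <= 4)%N ->
  w \notin U -> size z = k -> kpath e k z -> gd k e p rho z U ->
  rho * lev T p 1 <= #|U :&: nb e w|%:R ->
  (forall P, P \in U :: Ps -> 2%:R * (rho * lev T p 0) <= #|P|%:R) ->
  exists q0 q1 y a b : seq T, [/\ [/\ (size q0 <= C)%N, uniq q0 & {subset q0 <= U}],
    perm_eq q1 (w :: q0), kpath e k (z ++ q0) && kpath e k (z ++ q1),
    [/\ size y = k, q0 = a ++ y & q1 = b ++ y] &
    forall P, P \in U :: Ps -> gd k e p rho y (P :\: [set x in q0])].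

Definition absorb_spec (R : realType) (k : nat) (rg : rel nat) (C : nat) : Prop :=
  forall rho : R, 0 < rho -> exists2 eta : R, 0 < eta &
  forall (T : finType) (e : rel T) (p : R), good_graph e p rg eta -> absorbing k C e p rho.

(** Appending [k] greedily chosen vertices replaces the end altogether, so its quality depends on
    the sizes of the watched sets and no longer on [y]. Quality [rho] before and after lets
    absorbers be chained. *)
Lemma absorb_of_core (R : realType) k (rg : rel nat) C : (0 < k)%N ->
  (forall a, (a < k)%N -> rg a k) -> core_spec R k rg C -> absorb_spec R k rg (C + k).
Proof.
move=> k0 rgk core rho rho0.
have [rho1 [eta1 [rho10 eta10 H]]] := core rho rho0.
pose rho2 := Num.min (rho1 / 2%:R) rho.
have rho20 : 0 < rho2 by rewrite lt_min rho0 divr_gt0.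
pose N := (20 * (C + k))%N.
have N0 : 0 < N%:R :> R by rewrite ltr0n /N; nlia.
exists (Num.min eta1 (rho2 / N%:R)); first by rewrite lt_min eta10 divr_gt0.
move=> T e p; set eta := Num.min _ _ => gg U w z Ps sP wU zk pz gz dw cP.
have h1 : eta <= eta1 by rewrite ge_min lexx.
have h2 : eta <= rho2 / N%:R by rewrite ge_min lexx orbT.
have gg1 := good_graph_le h1 gg.
have e0 := gg_eta gg.
have [q0 [q1 [y [a [b [[c0 u0 s0] pq /andP[p0 p1] [yk q0y q1y] gy]]]]]] :=
  H T e p gg1 U w z wU zk pz gz dw.
have Neta : N%:R * eta <= rho2 by rewrite mulrC -ler_pdivlMr.
have r2r : rho2 <= rho by rewrite ge_min lexx orbT.
have r21 : rho2 <= rho1 / 2%:R by rewrite ge_min lexx.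
have big : 1 <= eta * lev T p k.
  have r := rgk 0%N k0; rewrite (gg_rg gg) in r; exact: (gg_big gg r).
have lk : N%:R <= rho2 * lev T p k.
  apply: (@le_trans _ _ (N%:R * (eta * lev T p k))); first by rewrite ler_peMr // ltW.
  by rewrite mulrA ler_wpM2r // ltW // (lev_gt0 _ gg).
have l0 : rho2 * lev T p k <= rho2 * lev T p 0 by rewrite ler_pM2l //; apply: (le_lev gg).
have CkN : 20%:R * (C + k)%:R <= rho2 * lev T p k by rewrite -natrM.
have kC : k%:R <= (C + k)%:R :> R by rewrite ler_nat leq_addl.
have kC0 : 0 <= k%:R :> R by [].
have := @extend R k rg T e p eta gg k0 rgk rho rho2 rho20 r2r k 0 y
  (U :\: [set x in q0]) (U :: Ps) _ _ _ _ _ _ _ _.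
case=> //.
- apply: le_lt_trans (_ : 3%:R * (6%:R * k%:R) * eta < _).
    rewrite ler_pM2r // ler_pM2l // -natrM ler_nat leq_mul2r; apply/orP; right.
    by rewrite /=; nlia.
  have : 0 < N%:R * eta by rewrite mulr_gt0.
  have : 20%:R * k%:R * eta <= N%:R * eta.
    by rewrite ler_pM2r // -natrM ler_nat /N leq_mul2l leq_addl orbT.
  have : 0 < k%:R * eta by rewrite mulr_gt0 // ltr0n.
  by move=> x1 x2 x3; lra.
- by move: p0; rewrite q0y => /kpath_catr/kpath_catr.
- by apply: (gd_le gg _ _ gy) => //; lra.
- move=> P /cP; have := mulr_gt0 rho0 (lev_gt0 0 gg).
  by move=> x1 x2; lra.
- by move=> P _ [|j].
- have := gy 0%N (leq0n _) (leq0n _); rewrite suff0 commons_nil.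
  have : (rho2 * 2%:R) * lev T p 0 <= rho1 * lev T p 0.
    by apply: ler_wpM2r; [exact: ltW (lev_gt0 _ gg)|lra].
  by move=> x1 x2; lra.
move=> v [sv uv vU pv [_ tv]].
exists (q0 ++ v), (q1 ++ v), v, q0, q1; split=> //.
- split; first by rewrite size_cat sv leq_add2r.
    rewrite cat_uniq u0 uv andbT; apply/hasPn => x /vU.
    by rewrite !inE => /andP[].
  move=> x; rewrite mem_cat => /orP[/s0 //|/vU]; by rewrite inE => /andP[].
- by rewrite -cat_cons perm_cat2r.
- move: p0 p1; rewrite q0y q1y !catA => p0 p1.
  rewrite -!(catA (z ++ _)); apply/andP; split; apply: kpath_glue; rewrite ?yk //.
move=> P PP; have s1 : (size (q0 ++ v) <= C + k)%N by rewrite size_cat sv leq_add2r.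
have rr : rho <= 2%:R * rho by lra.
have rk : rho2 * lev T p k <= rho * lev T p k by rewrite ler_wpM2r // ltW // (lev_gt0 _ gg).
have c0' : 0 <= (C + k)%:R :> R by [].
apply: (gd_shrink gg rr _ s1); first by lra.
apply: gd_of_trk => [|j jk]; first by rewrite -mulrA; apply: cP.
have := tv k (leqnn k) P PP; rewrite add0n minnn take_oversize ?sv // => /(_ j jk).
rewrite suff_cat ?sv; last by case/andP: jk.
by have -> : 2%:R * rho / 2%:R = rho by field.
Qed.

(** The labels from [k] to [3k - 1] form the path in the neighbourhood of [w], whence the exponent
    1. The labels on both sides are watched continuations. A label has exponent at most [k + 1] when
    chosen, and its neighbours still to come have at most [k]. *)
Lemma init_ok_window (rg : rel nat) k : symmetric rg ->
  (forall a b, (a <= k.+1)%N -> (b <= k)%N -> rg a b) ->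
  init_ok rg (near k) [::] [seq (i, 1%N) | i <- iota k (2 * k)]
    ([seq (i, 0%N) | i <- iota 0 k] ++ [seq (i, 0%N) | i <- iota (3 * k) k]).
Proof.
move=> rs H.
suff h m j : (j + m = 2 * k)%N -> init_ok rg (near k) (rev (iota k j))
    [seq (i, 1%N) | i <- iota (k + j) m]
    ([seq (i, 0%N) | i <- iota 0 k] ++ [seq (i, 0%N) | i <- iota (3 * k) k]).
  by have := h (2 * k)%N 0%N (add0n _); rewrite addn0.
elim: m j => //= m IH j jm; apply/andP; split; last first.
  have := IH j.+1; rewrite addSnnS => /(_ jm).
  by rewrite -[j.+1]addn1 iotaD rev_cat /= addnA addn1.
apply/allP => K; rewrite !mem_cat => KK; apply/implyP; rewrite {1}/near => /and3P[h0 h1 h2].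
apply: H; first by rewrite /expo count_rev /= count_near; nlia.
move: h0 h1 h2; case/or3P: KK => /mapP[i]; rewrite mem_iota => ii -> /= h0 h1 h2;
by rewrite /expo count_rev /= count_near; nlia.
Qed.

(* [w] is inserted in the middle of a [k]-th power of a path on [2 k] vertices
   contained in its neighbourhood. *)
Lemma core_general (R : realType) k (rg : rel nat) : (0 < k)%N -> symmetric rg ->
  (forall a b, (a <= k.+1)%N -> (b <= k)%N -> rg a b) ->
  connect_spec R k rg -> core_spec R k rg (7 * k).
Proof.
move=> k0 rs H conn rho rho0.
have kR : 0 < k%:R :> R by rewrite ltr0n.
pose m := (2 * k)%N; have mE : m = (2 * k)%N by [].
have mR : 0 < m%:R :> R by rewrite ltr0n; nlia.
pose rho1 := rho / (2%:R * m%:R).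
have rho10 : 0 < rho1 by rewrite divr_gt0 // mulr_gt0.
have rho11 : 0 < rho1 / 2%:R by rewrite divr_gt0.
have [eta1 eta10 CN] := conn _ rho11.
exists (rho1 / 2%:R), (Num.min eta1 (rho1 / (100%:R * k%:R))); split=> //.
  by rewrite lt_min eta10 divr_gt0 // mulr_gt0.
move=> T e p; set eta := Num.min _ _ => gg U w z wU zk pz gz dw.
have h1 : eta <= eta1 by rewrite ge_min lexx.
have h2 : eta <= rho1 / (100%:R * k%:R) by rewrite ge_min lexx orbT.
have gg1 := good_graph_le h1 gg; have e0 := gg_eta gg; have es := gg_sym gg.
have eN : 100%:R * k%:R * eta <= rho1 by rewrite mulrC -ler_pdivlMr // mulr_gt0.
have k1 : 1 <= k%:R :> R by rewrite ler1n.
have ek : eta <= k%:R * eta by apply: ler_peMl => //; exact: ltW.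
have big : 1 <= eta * lev T p k by exact: (gg_big gg (H k 0%N (leqnSn k) (leq0n k))).
have lv a := lev_gt0 a gg.
have lk : 100%:R * k%:R <= rho1 * lev T p k.
  apply: (@le_trans _ _ (100%:R * k%:R * (eta * lev T p k))).
    by apply: ler_peMr => //; apply: ltW; rewrite !mulr_gt0.
  by rewrite mulrA ler_wpM2r // ltW.
have rho1r : rho1 <= rho.
  rewrite ler_pdivrMr ?mulr_gt0 //; apply: ler_peMr; first exact: ltW.
  by have : 1 <= m%:R :> R; [rewrite ler1n; nlia | move=> x; lra].
have [X [XS Xd]] := disjoint_pools (fun _ => U :&: nb e w) m.
have XU i : (i < m)%N -> {subset X i <= U}.
  by move=> /XS[h _] x /(subsetP h); rewrite inE => /andP[].
have Xw i : (i < m)%N -> forall x, x \in X i -> e w x.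
  by move=> /XS[h _] x /(subsetP h); rewrite !inE => /andP[].
have cX i : (i < m)%N -> rho1 * lev T p 1 <= #|X i|%:R.
  move=> im; have [_ ] := XS i im; rewrite -(ltr_nat R) natrM -natr1 => lt.
  have h3 : m%:R * (rho1 * lev T p 1) * 2%:R = rho * lev T p 1.
    by rewrite /rho1; field; rewrite gt_eqF.
  have h4 : 1 <= rho1 * lev T p 1.
    have : rho1 * lev T p k <= rho1 * lev T p 1 by rewrite ler_pM2l //; apply: (le_lev gg).
    by move=> x; lra.
  have : m%:R * (rho1 * lev T p 1 * 2%:R) < m%:R * (#|X i|%:R + 1).
    by rewrite mulrA h3; apply: le_lt_trans dw lt.
  by rewrite ltr_pM2l //; move: h4; clear; move=> h4 x; lra.
pose it (i : nat) : item T := ((i, 1%N), X (i - k)%N).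
pose pt (i : nat) : item T := ((i, 0%N), U).
pose l := [seq it i | i <- iota k (2 * k)].
pose ps := [seq pt i | i <- iota 0 k] ++ [seq pt i | i <- iota (3 * k) k].
have ns := near_sym k; have ni := near_irr k.
have cand0 (I : item T) : cand e (near k) I [::] = I.2.
  by apply/setP=> x; rewrite inE andbT.
have U0 : rho * lev T p 0 <= #|U|%:R.
  by have := gz 0%N (leq0n _) (leq0n _); rewrite suff0 commons_nil.
have N1 : nested e p rho1 (near k) 2%:R^-1 l [::] (all_sized e p rho1 (near k) ps).
  apply: (nested_init gg rho10).
  - have := init_ok_window rs H; rewrite /l /ps /unzip1 -!map_comp map_cat -!map_comp.
    by congr (init_ok _ _ _ _ _).
  - move=> I; rewrite /sized cand0 /expo /= addn0 !mem_cat => /or3P[] /mapP[i + ->];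
      rewrite mem_iota => ii /=.
    + by apply: cX; nlia.
    + by apply: le_trans U0; rewrite ler_pM2r.
    + by apply: le_trans U0; rewrite ler_pM2r.
  - by lra.
  - have -> : size (l ++ ps) = (4 * k)%N.
      by rewrite !size_cat !size_map !size_iota; nlia.
    by rewrite natrM; lra.
have w0 : wf e (near k) [::] by [].
have lab : [seq J.1.1 | J <- l] = iota k (2 * k) by rewrite -map_comp map_id.
have [||c [wc sz lc cin]] := nested_ex gg ns ni rho10 _ _ w0 N1.
- by lra.
- by rewrite lab iota_uniq.
rewrite cats0 in wc sz; rewrite lab in lc.
pose f := look w c.
have fc i : (k <= i < 3 * k)%N -> (i, f i) \in c.
  by move=> ik; apply: look_in; rewrite lc mem_rev mem_iota; nlia.
have fX i : (k <= i < 3 * k)%N -> f i \in X (i - k)%N.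
  move=> ik; apply: (cin (it i) (i, f i)) => //; last exact: fc.
  by apply: map_f; rewrite mem_iota; nlia.
pose g1 := [seq f i | i <- iota k k]; pose g2 := [seq f i | i <- iota (2 * k) k].
have g12 : g1 ++ g2 = [seq f i | i <- iota k (2 * k)].
  by rewrite -map_cat [in iota (2 * k) k]mul2n -addnn -iotaD addnn -mul2n.
have s1 : size g1 = k by rewrite size_map size_iota.
have s2 : size g2 = k by rewrite size_map size_iota.
have pg : kpath e k (g1 ++ g2).
  rewrite g12; apply: kpath_iota => i j ki jk ij.
  apply: (wf_edge wc (fc i _) (fc j _)); rewrite /near; nlia.
have gU : {subset g1 ++ g2 <= U}.
  move=> x; rewrite g12 => /mapP[i]; rewrite mem_iota => ii ->.
  by apply: (XU (i - k)%N); [nlia|apply: fX; nlia].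
have gw : all (e w) (g1 ++ g2).
  apply/allP => x; rewrite g12 => /mapP[i]; rewrite mem_iota => ii ->.
  by apply: (Xw (i - k)%N); [nlia|apply: fX; nlia].
have ug : uniq (g1 ++ g2).
  rewrite g12 map_inj_in_uniq ?iota_uniq // => i j; rewrite !mem_iota => ii jj fij.
  apply/eqP/negPn/negP => ij.
  have : [disjoint X (i - k)%N & X (j - k)%N].
    by apply: Xd; [nlia|nlia|apply: contraNneq ij => ?; apply/eqP; nlia].
  by move/pred0P/(_ (f i)) => /=; rewrite fX /=; [rewrite fij fX //; nlia|nlia].
(* The watched label [a] is near the [j] chosen labels at one end of the window, so its candidates
   are common neighbours of that end. The left end serves the connection from [z], the right end the
   continuation. *)
have window a j q : pt a \in ps -> (a < k)%N || (k + 2 * k <= a)%N ->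
    (minn (a + k).+1 (k + 2 * k) - maxn (a - k) k = j)%N ->
    {subset q <= [seq f i | i <- iota k (2 * k) & near k i a]} ->
    rho1 * lev T p j <= #|U :&: commons e q|%:R.
  move=> pin ak <- qs; have := sz _ pin; rewrite /sized /expo /= lc count_rev count_near // add0n.
  move=> h; apply: le_trans h _; rewrite ler_nat; apply/subset_leq_card/subsetP => x.
  rewrite !inE => /andP[-> /allP ac]; apply/allP => y /qs/mapP[i].
  rewrite mem_filter mem_iota => /andP[nia ii] ->.
  by have := ac (i, f i) (fc i _); rewrite /= nia; apply; nlia.
have gR : gd k e p rho1 (rev g1) U.
  move=> [|j] jk _; first by rewrite suff0 commons_nil; apply: le_trans U0; rewrite ler_pM2r.
  apply: (window j); [by rewrite mem_cat map_f // mem_iota|nlia|nlia|] => x.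
  rewrite /suff size_rev s1 drop_rev mem_rev s1 /g1 -map_take take_iota => /mapP[i].
  by rewrite mem_iota => ii ->; apply: map_f; rewrite mem_filter mem_iota /near; nlia.
have gS : gd k e p rho1 g2 U.
  move=> [|j] jk _; first by rewrite suff0 commons_nil; apply: le_trans U0; rewrite ler_pM2r.
  apply: (window (3 * k + (k - j.+1))%N); [|nlia|nlia|] => [|x].
    by rewrite mem_cat orbC map_f // mem_iota; nlia.
  rewrite /suff s2 /g2 -map_drop drop_iota => /mapP[i].
  by rewrite mem_iota => ii ->; apply: map_f; rewrite mem_filter mem_iota /near; nlia.
have nat2 : (2 * k)%:R = 2%:R * k%:R :> R by rewrite natrM.
have nat7 : (7 * k)%:R = 7%:R * k%:R :> R by rewrite natrM.
have sg : (size (g1 ++ g2) <= 2 * k)%N by rewrite size_cat s1 s2; nlia.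
have r12 : rho1 / 2%:R <= rho1 by lra.
have sh : (2 * k)%:R <= (rho1 - rho1 / 2%:R) * lev T p k by rewrite nat2; lra.
have [||cs [ucs scs ncs pcs]] := CN T e p gg1 z g1 (U :\: [set x in g1 ++ g2]) zk s1 pz (kpath_catl pg).
- by apply/(gd_good _ _ _ _ zk); apply: (gd_shrink gg r12 sh sg); apply: (gd_le gg rho1r _ gz).
- have rk : size (rev g1) = k by rewrite size_rev.
  by apply/(gd_good _ _ _ _ rk); exact: (gd_shrink gg r12 sh sg gR).
exists (cs ++ g1 ++ g2), (cs ++ g1 ++ w :: g2), g2, (cs ++ g1), (cs ++ g1 ++ [:: w]).
split.
- split; first by rewrite !size_cat s1 s2; move: ncs; move: (size cs) => n0; clear; lia.
    rewrite cat_uniq ucs ug andbT; apply/hasPn => x xg; apply/negP => /scs.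
    by rewrite !inE xg.
  move=> x; rewrite mem_cat => /orP[/scs|/gU //]; by rewrite inE => /andP[].
- by rewrite !catA perm_catC /= perm_cons perm_catC.
- have pw := kpath_insert es pg gw.
  rewrite !catA -!(catA (z ++ cs)); rewrite -(catA z) in pcs *.
  by rewrite !catA; apply/andP; split; rewrite -!catA catA;
    apply: kpath_glue; rewrite ?s1 // -catA.
- by split; rewrite -?catA.
have sh7 : (7 * k)%:R <= (rho1 - rho1 / 2%:R) * lev T p k by rewrite nat7; lra.
apply: (gd_shrink gg r12 sh7 _ gS).
by rewrite !size_cat s1 s2; move: ncs; move: (size cs) => n0; clear; lia.
Qed.

(** * Absorbers for squares *)

Section NestedMore.
Variables (R : realType) (T : finType) (e : rel T) (p rho : R) (adj : rel nat).

(** Allows exchanges to be performed behind the choices [pre]. *)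
Lemma nested_prefix d d' pre l l' c L : d <= d' -> {subset l' <= l} ->
  (forall c', unzip1 c' = rev [seq J.1.1 | J <- pre] ++ unzip1 c ->
    nested e p rho adj d l c' L -> nested e p rho adj d' l' c' L) ->
  nested e p rho adj d (pre ++ l) c L -> nested e p rho adj d' (pre ++ l') c L.
Proof.
move=> dd' ll'; elim: pre c => [|I pre IH] c H /=; first exact: H.
case=> sz M; split.
  apply: all_sized_sub sz => K; rewrite !inE !mem_cat => /or3P[->|->|/ll' ->];
  by rewrite ?orbT.
apply: most_impl M => // y _; apply: IH => c' E; apply: H.
by rewrite E /= rev_cons cat_rcons.
Qed.

(** A chosen vertex not adjacent to any label still to come affects neither candidates nor
    exponents, so it can be hidden in the final property. *)
Lemma nested_drop d l c i x L :
  {in [seq J.1.1 | J <- l], forall j, ~~ adj i j} ->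
  nested e p rho adj d l (c ++ [:: (i, x)]) L ->
  nested e p rho adj d l c (fun c' => L (c' ++ [:: (i, x)])).
Proof.
have key J c0 : ~~ adj i J.1.1 ->
    cand e adj J (c0 ++ [:: (i, x)]) = cand e adj J c0 /\
    expo adj J.1 (unzip1 (c0 ++ [:: (i, x)])) = expo adj J.1 (unzip1 c0).
  move=> nij; split.
    by apply/setP=> y; rewrite !inE all_cat /= (negbTE nij) !andbT.
  by rewrite /expo /unzip1 map_cat count_cat /= (negbTE nij) !addn0.
elim: l c => [|J l IH] c H //= [sz M]; split.
  move=> K Kl; have := sz K Kl; rewrite /sized.
  have [|-> ->] // := key K c; apply: H; exact: (map_f (fun J : item T => J.1.1)).
have nJ : ~~ adj i J.1.1 by apply: H; rewrite mem_head.
move: M; have [-> _] := key J c nJ; apply: most_impl => // y _.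
by apply: (IH ((J.1.1, y) :: c)) => j jl; apply: H; rewrite inE jl orbT.
Qed.

Lemma gd_pair (U : {set T}) x y :
  rho * lev T p 0 <= #|U|%:R -> rho * lev T p 1 <= #|U :&: commons e [:: x]|%:R ->
  rho * lev T p 2 <= #|U :&: commons e [:: y; x]|%:R -> gd 2 e p rho [:: y; x] U.
Proof.
move=> h0 h1 h2 [|[|[|j]]] // _ _; first by rewrite suff0 commons_nil.
Qed.
End NestedMore.

(* Labels 0, .., 6 stand for b, a, f1, e1, f2, e2, f3: the path b f1 f2 f3, and
   a, e1, e2 adjacent to one of its vertices and to its neighbours on the path.
   Labels 10, .., 15 are the sets of continuations of the pairs (b, a),
   (f1, e1), (f2, e2). *)
Definition chain_up (i : nat) : seq nat :=
  match i with
  | 0 => [:: 1; 2; 3; 11] | 1 => [:: 2; 10; 11] | 2 => [:: 3; 4; 5; 13]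
  | 3 => [:: 4; 12; 13] | 4 => [:: 5; 6; 15] | 5 => [:: 6; 14; 15]
  | _ => [::]
  end%N.
Definition chain_adj : rel nat := fun i j => (j \in chain_up i) || (i \in chain_up j).

Lemma chain_sym : symmetric chain_adj.
Proof. by move=> i j; rewrite /chain_adj orbC. Qed.

Lemma chain_irr : irreflexive chain_adj.
Proof. by case=> [|[|[|[|[|[|i]]]]]]. Qed.

Section Chain.
Variables (R : realType) (T : finType) (e : rel T) (p eta rho : R).
Hypothesis gg : good_graph e p rg2 eta.
Hypothesis rho_gt0 : 0 < rho.
Hypothesis small : 72%:R * eta <= tol R 12 * rho.
Variables (b : T) (A F1 E1 F2 E2 F3 U : {set T}).
Local Notation lev := (lev T p).
Local Notation nb := (nb e).
Hypothesis cA : rho * lev 2 <= #|A :&: nb b|%:R.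
Hypothesis cF1 : rho * lev 1 <= #|F1 :&: nb b|%:R.
Hypothesis cE1 : rho * lev 1 <= #|E1 :&: nb b|%:R.
Hypothesis cU1 : rho * lev 1 <= #|U :&: nb b|%:R.
Hypothesis cU : rho * lev 0 <= #|U|%:R.
Hypothesis cF2 : rho * lev 0 <= #|F2|%:R.
Hypothesis cE2 : rho * lev 0 <= #|E2|%:R.
Hypothesis cF3 : rho * lev 0 <= #|F3|%:R.
Hypothesis dAF1 : [disjoint A & F1].
Hypothesis dAF2 : [disjoint A & F2].
Hypothesis dE1F2 : [disjoint E1 & F2].
Hypothesis dF1F2 : [disjoint F1 & F2].
Hypothesis dF1F3 : [disjoint F1 & F3].
Hypothesis dAF3 : [disjoint A & F3].
Hypothesis dE1F3 : [disjoint E1 & F3].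
Hypothesis dE2F3 : [disjoint E2 & F3].

(** Half of an absorber; the other half is its mirror image at a neighbour [d] of [b], with [f2] and
    [f3] interchanged. The pieces [a b f1 e1] and [e2 f2 f3] serve the path without [w], the piece
    [e1 f1 f2 e2] the path with [w]. *)
Definition gadget_half (f2 f3 : T) : Prop := exists a f1 e1 e2,
  [/\ [/\ a \in A, f1 \in F1, e1 \in E1 & e2 \in E2],
      [/\ kpath e 2 [:: a; b; f1; e1], kpath e 2 [:: e1; f1; f2; e2] &
          kpath e 2 [:: e2; f2; f3]] &
      [/\ gd 2 e p rho [:: b; a] U, gd 2 e p rho [:: f1; e1] U &
          gd 2 e p rho [:: f2; e2] U]].

Lemma nested_half : nested e p rho distinct (tol R 4)
  [:: ((0%N, 0%N), F2); ((1%N, 0%N), F3)] [::]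
  (assigned (fun f => gadget_half (f 0%N) (f 1%N))).
Proof.
have e0 := gg_eta gg; have lv a := lev_gt0 a gg.
have ns := chain_sym; have ni := chain_irr.
have t4 m := tol_le4 R m.
have sm m : (m <= 12)%N -> 72%:R * eta <= tol R m * rho.
  by move=> m12; apply: le_trans small _; rewrite ler_pM2r //; apply: tol_le.
have s3 : 3%:R * eta <= rho.
  have h : tol R 12 * rho <= rho.
    by apply: ler_piMl; [exact: ltW|apply: le_trans (t4 _) _; lra].
  by have s := small; lra.
pose ia : item T := ((1, 1)%N, A); pose if1 : item T := ((2, 0)%N, F1).
pose ie1 : item T := ((3, 0)%N, E1); pose if2 : item T := ((4, 0)%N, F2).
pose ie2 : item T := ((5, 0)%N, E2); pose if3 : item T := ((6, 0)%N, F3).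
pose u (i : nat) : item T := ((i, 0)%N, U).
pose ps := [:: u 10%N; u 11%N; u 12%N; u 13%N; u 14%N; u 15%N].
pose c0 := [:: (0%N, b)].
pose L := all_sized e p rho chain_adj ps.
have HL : perm_inv L by exact: all_sized_perm.
have cand1 (J : item T) : chain_adj 0 J.1.1 -> cand e chain_adj J c0 = J.2 :&: nb b.
  by move=> a; rewrite /c0 cand_cons a; apply/setP => x; rewrite !inE andbT.
have cand0 (J : item T) : ~~ chain_adj 0 J.1.1 -> cand e chain_adj J c0 = J.2.
  by move=> a; rewrite /c0 cand_cons (negbTE a); apply/setP => x; rewrite !inE andbT.
have sz0 : all_sized e p rho chain_adj ([:: ia; if1; ie1; if2; ie2; if3] ++ ps) c0.
  move=> J; rewrite !inE /sized.
  do 3 (case/orP => [/eqP->|]; first by rewrite cand1).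
  do 4 (case/orP => [/eqP->|]; first by rewrite cand0).
  case/orP => [/eqP->|]; first by rewrite cand1.
  do 3 (case/orP => [/eqP->|]; first by rewrite cand0).
  by move/eqP->; rewrite cand0.
have N0 : nested e p rho chain_adj (tol R 12) [:: ia; if1; ie1; if2; ie2; if3] c0 L.
  apply: (nested_init gg rho_gt0) => //.
  by rewrite [size _]/=; have := sm 12%N (leqnn _); lra.
have mv m (l1 : seq (item T)) (J : item T) (l2 : seq (item T)) (c : seq (nat * T)) : (m + size l1 <= 12)%N -> (size (l1 ++ l2) < 12)%N ->
    (forall K, K \in l1 -> [disjoint K.2 & J.2]) ->
    move_ok rg2 chain_adj (unzip1 c) (unzip1 l1) J.1 (unzip1 l2) ->
    nested e p rho chain_adj (tol R (m + size l1)) (l1 ++ J :: l2) c L ->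
    nested e p rho chain_adj (tol R m) (J :: l1 ++ l2) c L.
  move=> m12 s12 dis ok; apply: (nested_move gg ns rho_gt0 (M := 12) (N := 12)) => //.
  by have := sm 12%N (leqnn _); lra.
(* The two halves share [f2] and [f3], which must therefore come first. The order of the moves keeps
   all exponents compared within [rg2]; here [f1] has exponent 1 and [a] has 2. *)
have N1 : nested e p rho chain_adj (tol R 11) [:: if1; ia; ie1; if2; ie2; if3] c0 L.
  apply: (mv 11%N [:: ia] if1 [:: ie1; if2; ie2; if3]) => //.
  by move=> K; rewrite inE => /eqP->.
have N2 : nested e p rho chain_adj (tol R 9) [:: if1; if2; ia; ie1; ie2; if3] c0 L.
  apply: (nested_prefix (pre := [:: if1]) (l := [:: ia; ie1; if2; ie2; if3])) N1.
  - exact: tol_le.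
  - by move=> K; rewrite !inE; do !(case/orP => [->|]; rewrite ?orbT //); move=> ->; rewrite ?orbT.
  move=> c Ec; apply: (mv 9%N [:: ia; ie1] if2 [:: ie2; if3]) => //.
    by move=> K; rewrite !inE => /orP[] /eqP->.
  by rewrite Ec.
have N3 : nested e p rho chain_adj (tol R 8) [:: if2; if1; ia; ie1; ie2; if3] c0 L.
  apply: (mv 8%N [:: if1] if2 [:: ia; ie1; ie2; if3]) => //.
  by move=> K; rewrite inE => /eqP->.
have N4 : nested e p rho chain_adj (tol R 4) ([:: if2; if3] ++ [:: if1; ia; ie1; ie2]) c0 L.
  apply: (nested_prefix (pre := [:: if2]) (l := [:: if1; ia; ie1; ie2; if3])
    (l' := [:: if3; if1; ia; ie1; ie2])) N3.
  - exact: tol_le.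
  - by move=> K; rewrite !inE; do !(case/orP => [->|]; rewrite ?orbT //); move=> ->; rewrite ?orbT.
  move=> c Ec; apply: (mv 4%N [:: if1; ia; ie1; ie2] if3 [::]) => //.
    by move=> K; rewrite !inE => /or4P[] /eqP->.
  by rewrite Ec.
have w0 : wf e chain_adj c0 by move=> x y; rewrite !inE => /eqP-> /eqP->.
have N5 := nested_track gg ns ni w0 (nested_split N4).
have nd : {in [seq J.1.1 | J <- [:: if2; if3]], forall j, ~~ chain_adj 0 j}.
  by move=> j; rewrite !inE => /orP[] /eqP->.
have N6 := nested_drop (c := [::]) nd N5.
apply: (@nested_relabel _ _ _ _ _ chain_adj _ (fun i => if i == 4%N then 0%N else 1%N) _ _ [::] _ _
  [pred i | (i == 4) || (i == 6)]%N _ _ _ _ N6) => //.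
- by move=> i j; rewrite !inE => /orP[] /eqP-> /orP[] /eqP->.
- by move=> i; rewrite /= !inE.
- move=> c [Nc wc lc] f fc.
  have [||c' [wc' sz lc' cin]] := nested_ex gg ns ni rho_gt0 _ _ wc Nc => //.
    by apply: le_lt_trans (t4 _) _; lra.
  have sc : size c = 2.
    by have := congr1 size lc; rewrite size_map size_cat addn1 => -[].
  case: c sc lc fc wc Nc wc' sz => [|[j6 f3] [|[j4 f2] [|? ?]]] //= _ [-> ->] fc _ _.
  case: c' lc' cin => [|[j5 e2] [|[j3 e1] [|[j1 a] [|[j2 f1] [|? ?]]]]] //= [-> -> -> ->].
  move=> cin wc sz.
  have h1 : f 1%N = f3 by apply: (fc (1%N, f3)); rewrite /= !inE eqxx.
  have h0 : f 0%N = f2 by apply: (fc (0%N, f2)); rewrite /= !inE eqxx orbT.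
  rewrite h0 h1.
  have hA : a \in A by apply: (cin ia (1%N, a)); rewrite ?inE ?eqxx ?orbT.
  have hF1 : f1 \in F1 by apply: (cin if1 (2%N, f1)); rewrite ?inE ?eqxx ?orbT.
  have hE1 : e1 \in E1 by apply: (cin ie1 (3%N, e1)); rewrite ?inE ?eqxx ?orbT.
  have hE2 : e2 \in E2 by apply: (cin ie2 (5%N, e2)); rewrite ?inE ?eqxx ?orbT.
  have ab : e a b by edge wc 1%N 0%N.
  have af : e a f1 by edge wc 1%N 2%N.
  have bf : e b f1 by edge wc 0%N 2%N.
  have be : e b e1 by edge wc 0%N 3%N.
  have fe : e f1 e1 by edge wc 2%N 3%N.
  have ef : e e1 f1 by edge wc 3%N 2%N.
  have ef2 : e e1 f2 by edge wc 3%N 4%N.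
  have ff2 : e f1 f2 by edge wc 2%N 4%N.
  have fe2 : e f1 e2 by edge wc 2%N 5%N.
  have f2e : e f2 e2 by edge wc 4%N 5%N.
  have e2f : e e2 f2 by edge wc 5%N 4%N.
  have e2f3 : e e2 f3 by edge wc 5%N 6%N.
  have f2f3 : e f2 f3 by edge wc 4%N 6%N.
  exists a, f1, e1, e2; split=> //.
    by rewrite /= ab af bf be fe ef ef2 ff2 fe2 f2e e2f e2f3 f2f3.
  have szu i : u i \in ps -> forall s : seq T,
      (forall x y, y \in U -> all (fun v => chain_adj v.1 i ==> e v.2 y)
        [:: (5%N, e2); (3%N, e1); (1%N, a); (2%N, f1); (6%N, f3); (4%N, f2); (0%N, b)] ->
        x \in s -> e x y) ->
      rho * lev (expo chain_adj (i, 0%N) [:: 5; 3; 1; 2; 6; 4; 0]%N) <= #|U :&: commons e s|%:R.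
    move=> /sz h s hs; apply: le_trans h _; rewrite ler_nat.
    apply/subset_leq_card/subsetP => y; rewrite !in_setI inE => /andP[yU yall].
    by rewrite yU inE; apply/allP => x; apply: hs.
  split; apply: gd_pair => //.
  - by apply: (szu 10%N) => [|x y yU /=]; rewrite !inE ?eqxx ?orbT // => /andP[ay _] /eqP->.
  - by apply: (szu 11%N) => [|x y yU /=]; rewrite !inE ?eqxx ?orbT // => /and3P[ay byy _] /orP[] /eqP->.
  - by apply: (szu 12%N) => [|x y yU /=]; rewrite !inE ?eqxx ?orbT // => /andP[ay _] /eqP->.
  - by apply: (szu 13%N) => [|x y yU /=]; rewrite !inE ?eqxx ?orbT // => /and3P[ay byy _] /orP[] /eqP->.
  - by apply: (szu 14%N) => [|x y yU /=]; rewrite !inE ?eqxx ?orbT // => /andP[ay _] /eqP->.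
  - by apply: (szu 15%N) => [|x y yU /=]; rewrite !inE ?eqxx ?orbT // => /and3P[ay byy _] /orP[] /eqP->.
Qed.

End Chain.

(** Labels 0 and 1 are the two centres [b] and [d]. Labels 2 to 5 are the sets in which [b] needs
    many neighbours, labels 6 to 9 those of [d]. *)
Definition pair_adj : rel nat := fun i j =>
  [|| (i == 0) && (j \in [:: 1; 2; 3; 4; 5]), (j == 0) && (i \in [:: 1; 2; 3; 4; 5]),
      (i == 1) && (j \in [:: 6; 7; 8; 9]) | (j == 1) && (i \in [:: 6; 7; 8; 9])]%N.

Lemma pair_sym : symmetric pair_adj.
Proof. by move=> i j; rewrite /pair_adj orbCA; congr [|| _, _ | _]; rewrite orbC. Qed.

Lemma pair_irr : irreflexive pair_adj.
Proof. by case=> [|[|i]]. Qed.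

Section CoreTwo.
Variables (R : realType) (T : finType) (e : rel T) (p eta rho rho1 : R).
Hypothesis gg : good_graph e p rg2 eta.
Hypotheses (rho1_gt0 : 0 < rho1) (small : 200%:R * eta <= tol R 12 * rho1).
Variables (U : {set T}) (w : T) (X : nat -> {set T}).
Hypothesis cU : rho1 * lev T p 0 <= #|U|%:R.
Hypothesis cX : forall i, (i < 12)%N -> rho1 * lev T p (i < 4)%N <= #|X i|%:R.
Hypothesis Xd : forall i j, (i < 12)%N -> (j < 12)%N -> i != j -> [disjoint X i & X j].
Local Notation lev := (lev T p).
Local Notation nb := (nb e).

Lemma choose_centers : exists b d, [/\ b \in X 1, d \in X 3, e b d,
  [/\ rho1 * lev 2 <= #|X 0 :&: nb b|%:R, rho1 * lev 1 <= #|X 4 :&: nb b|%:R,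
      rho1 * lev 1 <= #|X 8 :&: nb b|%:R & rho1 * lev 1 <= #|U :&: nb b|%:R] &
  [/\ rho1 * lev 2 <= #|X 2 :&: nb d|%:R, rho1 * lev 1 <= #|X 7 :&: nb d|%:R,
      rho1 * lev 1 <= #|X 11 :&: nb d|%:R & rho1 * lev 1 <= #|U :&: nb d|%:R]].
Proof.
have e0 := gg_eta gg; have ns := pair_sym; have ni := pair_irr.
have tl : tol R 12 * rho1 <= rho1 / 4%:R.
  by have := tol_le4 R 12; have := rho1_gt0; nra.
have sm := small.
pose ps : seq (item T) := [:: ((2, 1)%N, X 0); ((3, 0)%N, X 4); ((4, 0)%N, X 8);
  ((5, 0)%N, U); ((6, 1)%N, X 2); ((7, 0)%N, X 7); ((8, 0)%N, X 11); ((9, 0)%N, U)].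
pose l : seq (item T) := [:: ((0, 1)%N, X 1); ((1, 1)%N, X 3)].
have cand0 (J : item T) : cand e pair_adj J [::] = J.2.
  by apply/setP => x; rewrite inE andbT.
have N1 : nested e p rho1 pair_adj 2%:R^-1 l [::] (all_sized e p rho1 pair_adj ps).
  apply: (nested_init gg rho1_gt0) => //.
  - move=> J; rewrite /sized cand0 /l /ps !inE /expo /=.
    case/orP => [/eqP->|]; first exact: (cX (i := 1)).
    case/orP => [/eqP->|]; first exact: (cX (i := 3)).
    case/orP => [/eqP->|]; first exact: (cX (i := 0)).
    case/orP => [/eqP->|]; first exact: (cX (i := 4)).
    case/orP => [/eqP->|]; first exact: (cX (i := 8)).
    case/orP => [/eqP->|]; first exact: cU.
    case/orP => [/eqP->|]; first exact: (cX (i := 2)).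
    case/orP => [/eqP->|]; first exact: (cX (i := 7)).
    case/orP => [/eqP->|]; first exact: (cX (i := 11)).
    by move/eqP->.
  - by lra.
  - by rewrite [size _]/=; lra.
have w0 : wf e pair_adj [::] by [].
have [|//|c [wc sz lc cin]] := nested_ex gg ns ni rho1_gt0 _ _ w0 N1; first by lra.
rewrite cats0 in wc sz.
case: c lc wc sz cin => [|[j1 d] [|[j0 b] [|? ?]]] //= [-> ->] wc sz cin.
exists b, d.
have szu (J : item T) i x : J \in ps -> (i, x) \in [:: (1%N, d); (0%N, b)] ->
    pair_adj i J.1.1 ->
    rho1 * lev (expo pair_adj J.1 [:: 1; 0]%N) <= #|J.2 :&: nb x|%:R.
  move=> /sz h xs ax; apply: le_trans h _; rewrite ler_nat.
  apply/subset_leq_card/subsetP => y; rewrite inE => /andP[yJ /allP ya].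
  by rewrite inE yJ inE; apply: (implyP (ya _ xs) ax).
have x0 : (0%N, b) \in [:: (1%N, d); (0%N, b)] by rewrite !inE eqxx orbT.
have x1 : (1%N, d) \in [:: (1%N, d); (0%N, b)] by rewrite !inE eqxx.
split.
- by apply: (cin ((0, 1)%N, X 1) (0%N, b)); rewrite ?inE ?eqxx ?orbT.
- by apply: (cin ((1, 1)%N, X 3) (1%N, d)); rewrite ?inE ?eqxx ?orbT.
- by edge wc 0%N 1%N.
- by split; [apply: (szu ((2, 1)%N, X 0) _ _ _ x0)|apply: (szu ((3, 0)%N, X 4) _ _ _ x0)
    |apply: (szu ((4, 0)%N, X 8) _ _ _ x0)|apply: (szu ((5, 0)%N, U) _ _ _ x0)];
    rewrite ?inE ?eqxx ?orbT.
by split; [apply: (szu ((6, 1)%N, X 2) _ _ _ x1)|apply: (szu ((7, 0)%N, X 7) _ _ _ x1)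
  |apply: (szu ((8, 0)%N, X 11) _ _ _ x1)|apply: (szu ((9, 0)%N, U) _ _ _ x1)];
  rewrite ?inE ?eqxx ?orbT.
Qed.

(** The half at [b] holds for most [f2] and then most [f3], the half at [d] with the two choices in
    the opposite order; one exchange makes them compatible. *)
Lemma choose_halves b d :
  [/\ rho1 * lev 2 <= #|X 0 :&: nb b|%:R, rho1 * lev 1 <= #|X 4 :&: nb b|%:R,
      rho1 * lev 1 <= #|X 8 :&: nb b|%:R & rho1 * lev 1 <= #|U :&: nb b|%:R] ->
  [/\ rho1 * lev 2 <= #|X 2 :&: nb d|%:R, rho1 * lev 1 <= #|X 7 :&: nb d|%:R,
      rho1 * lev 1 <= #|X 11 :&: nb d|%:R & rho1 * lev 1 <= #|U :&: nb d|%:R] ->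
  exists f2 f3, [/\ f2 \in X 5, f3 \in X 6,
    gadget_half e p rho1 b (X 0) (X 4) (X 8) (X 9) U f2 f3 &
    gadget_half e p rho1 d (X 2) (X 7) (X 11) (X 10) U f3 f2].
Proof.
case=> b0 b4 b8 bU [d2 d7 d11 dU].
have e0 := gg_eta gg.
have sm : 72%:R * eta <= tol R 12 * rho1 by apply: le_trans small; rewrite ler_pM2r // ler_nat.
have N1 : nested e p rho1 distinct (tol R 4) [:: ((0%N, 0%N), X 5); ((1%N, 0%N), X 6)] [::]
    (assigned (fun f => gadget_half e p rho1 b (X 0) (X 4) (X 8) (X 9) U (f 0%N) (f 1%N))).
  apply: (nested_half gg rho1_gt0 sm) => //; try (exact: Xd).
  - exact: (cX (i := 5)).
  - exact: (cX (i := 9)).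
  - exact: (cX (i := 6)).
have N2 : nested e p rho1 distinct (tol R 4) [:: ((0%N, 0%N), X 6); ((1%N, 0%N), X 5)] [::]
    (assigned (fun f => gadget_half e p rho1 d (X 2) (X 7) (X 11) (X 10) U (f 0%N) (f 1%N))).
  apply: (nested_half gg rho1_gt0 sm) => //; try (exact: Xd).
  - exact: (cX (i := 6)).
  - exact: (cX (i := 10)).
  - exact: (cX (i := 5)).
pose l : seq (item T) := [:: ((0%N, 0%N), X 5); ((1%N, 0%N), X 6)].
pose L2 := assigned (fun f : nat -> T =>
  gadget_half e p rho1 d (X 2) (X 7) (X 11) (X 10) U (f 1%N) (f 0%N)).
have ds : symmetric distinct by move=> i j; rewrite /distinct eq_sym.
have di : irreflexive distinct by move=> i; rewrite /distinct eqxx.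
have N3 : nested e p rho1 distinct (tol R 4) (rev l) [::] L2.
  apply: (@nested_relabel _ _ _ _ _ distinct _ (subn 1) _ _ [::] _ _
    [pred i | i < 2]%N _ _ _ _ N2) => //.
  - by move=> [|[|i]] [|[|j]].
  - by move=> i; rewrite /= !inE => /orP[] /eqP->.
  - move=> c Lc f fc; apply: (Lc (f \o subn 1)) => u uc /=.
    by apply: (fc (1 - u.1, u.2)%N); apply: (map_f (fun u => (1 - u.1, u.2)%N)).
have N4 : nested e p rho1 distinct (tol R 0) l [::] L2.
  apply: (nested_rev gg ds rho1_gt0 (M := 12) (N := 2)) => //.
  - exact: assigned_perm.
  - move=> I J; rewrite !inE => /orP[] /eqP-> /orP[] /eqP-> //=; rewrite ?eqxx // => _;
    exact: Xd.
  - by apply: le_trans sm; rewrite -natrM ler_pM2r // ler_nat.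
have N5 : nested e p rho1 distinct (tol R 0 + tol R 0) (l ++ [::]) [::]
    (fun c => assigned (fun f => gadget_half e p rho1 b (X 0) (X 4) (X 8) (X 9) U (f 0%N) (f 1%N)) c /\ L2 c).
  apply: nested_and N4 _ => //.
  - by move=> u c; apply: assigned_cons.
  - by apply: nested_impl N1 => //; exact: tol_le.
  - exact: ltW (tol_gt0 _ _).
have w0 : wf e distinct [::] by [].
have [|//|c [wc [H1 H2] lc cin]] := nested_ex gg ds di rho1_gt0 _ _ w0 N5.
  by have := tol_le4 R 0; lra.
rewrite cats0 in wc H1 H2.
case: c lc wc H1 H2 cin => [|[j1 f3] [|[j0 f2] [|? ?]]] //= [-> ->] wc H1 H2 cin.
exists f2, f3; split.
- by apply: (cin ((0%N, 0%N), X 5) (0%N, f2)); rewrite ?inE ?eqxx ?orbT.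
- by apply: (cin ((1%N, 0%N), X 6) (1%N, f3)); rewrite ?inE ?eqxx ?orbT.
- by apply: (H1 (fun i => if i == 0%N then f2 else f3)) => u; rewrite !inE => /orP[] /eqP->.
- by apply: (H2 (fun i => if i == 0%N then f2 else f3)) => u; rewrite !inE => /orP[] /eqP->.
Qed.

End CoreTwo.

Lemma uniq_pools (T : finType) (X : nat -> {set T}) m (s : seq (nat * T)) :
  (forall i j, (i < m)%N -> (j < m)%N -> i != j -> [disjoint X i & X j]) ->
  (forall u, u \in s -> (u.1 < m)%N && (u.2 \in X u.1)) ->
  uniq (unzip1 s) -> uniq (unzip2 s).
Proof.
move=> Xd; elim: s => //= u s IH H /andP[us uu]; rewrite IH // ?andbT; last first.
  by move=> v vs; apply: H; rewrite inE vs orbT.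
apply: contra us => /mapP[v vs uv]; apply/mapP; exists v => //; apply/eqP.
have /andP[um ux] := H u (mem_head _ _).
have /andP[vm vx] : (v.1 < m)%N && (v.2 \in X v.1) by apply: H; rewrite inE vs orbT.
apply: contraT => /(Xd _ _ um vm)/pred0P/(_ u.2).
by rewrite /= ux {1}uv vx.
Qed.

Lemma uniq_cat_setD (T : finType) (U : {set T}) (s1 s2 : seq T) :
  uniq s1 -> uniq s2 -> {subset s2 <= U :\: [set x in s1]} -> uniq (s1 ++ s2).
Proof.
move=> u1 u2 s12; rewrite cat_uniq u1 u2 andbT; apply/hasPn => x /s12.
by rewrite !inE => /andP[].
Qed.

Ltac gen_lia :=
  repeat match goal with
  | |- context [nat_of_bool ?b] => move: (nat_of_bool b) => ?
  | |- context [count ?P ?s] => move: (count P s) => ?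
  end; clear; lia.

(** The twelve vertices of the two halves and three connections of at most ten vertices each make
    42. Pools 0 to 3, inside the neighbourhood of [w], are for [a], [b], [c], [d]. *)
Lemma core_two (R : realType) : connect_spec R 2 rg2 -> core_spec R 2 rg2 42.
Proof.
move=> conn rho rho0.
(* Twelve pools, and a factor 2 for rounding. *)
pose rho1 := rho / 24%:R.
have rho10 : 0 < rho1 by rewrite divr_gt0.
have rho11 : 0 < rho1 / 2%:R by rewrite divr_gt0.
have [eta1 eta10 CN] := conn _ rho11.
exists (rho1 / 2%:R), (Num.min eta1 (tol R 12 * rho1 / 200%:R)); split=> //.
  by rewrite lt_min eta10 divr_gt0 // mulr_gt0 // tol_gt0.
move=> T e p; set eta := Num.min _ _ => gg U w z wU zk pz gz dw.
have h1 : eta <= eta1 by rewrite ge_min lexx.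
have h2 : eta <= tol R 12 * rho1 / 200%:R by rewrite ge_min lexx orbT.
have small : 200%:R * eta <= tol R 12 * rho1 by rewrite mulrC -ler_pdivlMr.
have gg1 := good_graph_le h1 gg; have e0 := gg_eta gg; have es := gg_sym gg.
have lv a := lev_gt0 a gg.
have big : 1 <= eta * lev T p 2 by apply: (gg_big gg (b := 0%N)).
have lk : 800%:R <= rho1 * lev T p 2.
  have h3 : 800%:R * eta <= rho1 by have := tol_le4 R 12; nra.
  apply: (@le_trans _ _ (800%:R * (eta * lev T p 2))); first by rewrite ler_peMr.
  by rewrite mulrA ler_wpM2r // ltW.
have U0 : rho * lev T p 0 <= #|U|%:R.
  by have := gz 0%N (leq0n _) (leq0n _); rewrite suff0 commons_nil.
have rho1r : rho1 <= rho by rewrite /rho1; lra.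
have cU : rho1 * lev T p 0 <= #|U|%:R by apply: le_trans U0; rewrite ler_pM2r.
have [X [XS Xd]] := disjoint_pools (fun i => if (i < 4)%N then U :&: nb e w else U) 12.
have cX i : (i < 12)%N -> rho1 * lev T p (i < 4)%N <= #|X i|%:R.
  move=> i12; have [_] := XS i i12.
  set S := if _ then _ else _.
  have cS : rho * lev T p (i < 4)%N <= #|S|%:R.
    by rewrite /S; case: ifP => _; [exact: dw|exact: U0].
  rewrite -(ltr_nat R) natrM -natr1 => lt.
  have h3 : rho1 * lev T p 2 <= rho1 * lev T p (i < 4)%N.
    by rewrite ler_pM2l //; apply: (le_lev gg); case: (i < 4)%N.
  have h4 : rho * lev T p (i < 4)%N = 24%:R * (rho1 * lev T p (i < 4)%N).
    by rewrite /rho1; field.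
  move: (rho1 * lev T p (i < 4)%N) (rho * lev T p (i < 4)%N) cS (le_trans lk h3) h4 lt => x y.
  by clear; move=> a1 a2 a3 a4; lra.
have XU i x : (i < 12)%N -> x \in X i -> x \in U.
  move=> /XS[h _] /(subsetP h); case: ifP => _ //; by rewrite inE => /andP[].
have Xw i x : (i < 4)%N -> x \in X i -> e w x.
  move=> i4; have i12 : (i < 12)%N by apply: leq_trans i4 _.
  by have [h _] := XS i i12; move/(subsetP h); rewrite i4 !inE => /andP[].
have [b [d [bX dX bd B D]]] := choose_centers gg rho10 small cU cX.
have [f2 [f3 [f2X f3X [a [f1 [e1 [e2 [[aX f1X e1X e2X] [p1 p2 p3] [g1 g2 g3]]]]]]
  [c [f4 [e4 [e3 [[cX' f4X e4X e3X] [p4 p5 p6] [g4 g5 g6]]]]]]]]] :=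
  choose_halves gg rho10 small cU cX Xd B D.
pose G := [:: a; b; f1; e1; c; d; f4; e4; e2; f2; f3; e3].
pose sG := [:: (0, a); (1, b); (4, f1); (8, e1); (2, c); (3, d); (7, f4); (11, e4);
  (9, e2); (5, f2); (6, f3); (10, e3)]%N.
have GX u : u \in sG -> (u.1 < 12)%N && (u.2 \in X u.1).
  rewrite !inE => uG.
  by do 11 (case/orP: uG => [/eqP-> //|uG]); move/eqP: uG => ->.
have uG : uniq G by apply: (uniq_pools Xd GX).
have GU x : x \in G -> x \in U.
  rewrite -[G]/(unzip2 sG) => /mapP[u /GX/andP[u1 u2] ->]; exact: XU u2.
have r12 : rho1 / 2%:R <= rho1 by move: rho10; clear; move=> ?; lra.
have sh : 42%:R <= (rho1 - rho1 / 2%:R) * lev T p 2.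
  by move: lk; move: (lev T p 2) => x; clear; move=> lx; nra.
have sgd Q (s : seq T) : size Q = 2 -> (size s <= 42)%N -> gd 2 e p rho1 Q U ->
    good e p (rho1 / 2%:R) Q (U :\: [set x in s]).
  by move=> Q2 s42 H; apply/(gd_good _ _ _ _ Q2); apply: (gd_shrink gg r12 sh s42 H).
have gz' : gd 2 e p rho1 z U by apply: (gd_le gg rho1r _ gz).
have ab : e a b by case/andP: p1 => /andP[].
have cd : e c d by case/andP: p4 => /andP[].
have dc : e d c by rewrite es.
have wa : e w a by exact: (@Xw 0%N).
have wb : e w b by exact: (@Xw 1%N).
have wc : e w c by exact: (@Xw 2%N).
have wd : e w d by exact: (@Xw 3%N).
have pr s : kpath e 2 s -> kpath e 2 (rev s) by rewrite kpath_rev.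
have [|||K1 [uK1 sK1 nK1 pK1]] := CN T e p gg1 z [:: a; b] (U :\: [set x in G]) zk erefl pz.
- by rewrite /= ab.
- exact: sgd.
- exact: sgd.
have [||||K2 [uK2 sK2 nK2 pK2]] := CN T e p gg1 [:: d; c] [:: e1; f1]
  (U :\: [set x in G ++ K1]) erefl erefl.
- by rewrite /= dc.
- by have := kpath_catl (s1 := [:: e1; f1]) p2.
- by apply: sgd => //; rewrite size_cat /=; move: nK1; move: (size K1) => n1; clear; lia.
- by apply: sgd => //; rewrite size_cat /=; move: nK1; move: (size K1) => n1; clear; lia.
have s12 : (size (G ++ K1 ++ K2) <= 42)%N.
  by rewrite !size_cat /=; move: nK1 nK2; move: (size K1) (size K2) => n1 n2; clear; lia.
have [||||K3 [uK3 sK3 nK3 pK3]] := CN T e p gg1 [:: f2; e2] [:: e4; f4]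
  (U :\: [set x in G ++ K1 ++ K2]) erefl erefl.
- by have := kpath_catr (s1 := [:: e1; f1]) p2.
- by have := kpath_catl (s1 := [:: e4; f4]) p5.
- exact: sgd.
- exact: sgd.
(* [w] is skipped by running backwards through [K2] and [K3]. *)
pose q0 := K1 ++ [:: a, b, f1, e1 & rev K2 ++ [:: c, d, f4, e4 & rev K3 ++ [:: e2; f2; f3; e3]]].
pose q1 := K1 ++ [:: a, b, w, d, c & K2 ++ [:: e1, f1, f2, e2 & K3 ++ [:: e4; f4; f3; e3]]].
have pq : perm_eq q0 (G ++ K1 ++ K2 ++ K3).
  apply/permP => P; rewrite /q0 /G /= !(count_cat, count_rev) /= !(count_cat, count_rev) /= !(count_cat, count_rev) /=.
  gen_lia.
have pq1 : perm_eq q1 (w :: q0).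
  apply/permP => P; rewrite /q0 /q1 /= !(count_cat, count_rev) /= !(count_cat, count_rev) /= !(count_cat, count_rev) /=.
  gen_lia.
have glue (s1 s2 : seq T) x y : kpath e 2 (s1 ++ [:: x; y]) -> kpath e 2 [:: x, y & s2] ->
    kpath e 2 (s1 ++ [:: x, y & s2]).
  by move=> h3 h4; apply: (@kpath_glue _ _ _ s1 [:: x; y] s2).
exists q0, q1, [:: f3; e3],
  (K1 ++ [:: a, b, f1, e1 & rev K2 ++ [:: c, d, f4, e4 & rev K3 ++ [:: e2; f2]]]),
  (K1 ++ [:: a, b, w, d, c & K2 ++ [:: e1, f1, f2, e2 & K3 ++ [:: e4; f4]]]).
split=> //.
- split.
  + rewrite (perm_size pq) !size_cat /=.
    by move: nK1 nK2 nK3; move: (size K1) (size K2) (size K3) => n1 n2 n3; clear; lia.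
  + have u2 := uniq_cat_setD (uniq_cat_setD uG uK1 sK1) uK2 sK2; rewrite -catA in u2.
    by have u3 := uniq_cat_setD u2 uK3 sK3; rewrite (perm_uniq pq) !catA in u3 *.
  + move=> x; rewrite (perm_mem pq) !mem_cat => /or4P[/GU //|/sK1|/sK2|/sK3];
      by rewrite in_setD => /andP[].
- apply/andP; split; rewrite /q0 /q1.
  + rewrite catA; apply: (glue); first by rewrite -catA.
    apply: (glue [:: a; b]) => //.
    apply: (glue [:: f1, e1 & rev K2]).
      by have := pr _ pK2; rewrite !rev_cat.
    apply: (glue [:: c; d]) => //.
    apply: (glue [:: f4, e4 & rev K3]).
      by have := pr _ pK3; rewrite !rev_cat.
    apply: (glue [:: e2]) => //.
    by have := pr _ p6.
  + rewrite catA; apply: (glue); first by rewrite -catA.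
    have h5 : kpath e 2 [:: a; b; w; d; c].
      by rewrite /= ab bd wd wc dc !(es _ w) wa wb.
    apply: (glue [:: a; b; w]) => //.
    apply: (glue [:: d, c & K2]) => //.
    apply: (glue [:: e1; f1]) => //.
    by apply: (glue [:: f2, e2 & K3]).
- by split=> //; rewrite /q0 /q1 -!(catA, cat_cons).
by apply: (gd_shrink gg r12 sh _ g6); rewrite (perm_size pq) !size_cat /=;
  move: nK1 nK2 nK3; move: (size K1) (size K2) (size K3) => n1 n2 n3; clear; lia.
Qed.

(** * Paths with optional vertices *)

Section Flexible.
Variables (R : realType) (k : nat) (rg : rel nat) (T : finType) (e : rel T) (p eta : R).
Hypothesis gg : good_graph e p rg eta.
Variable x : seq T.
Local Notation lev := (lev T p).
Local Notation nb := (nb e).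
Implicit Types (A D P S U W : {set T}) (s z : seq T).

(* The path starts with [x], ends with [z], covers [A] and any prescribed part of
   [D]. *)
Definition flexible A D z : Prop := [disjoint A & D] /\ size z = k /\
  forall D', D' \subset D -> exists s s1 s2,
    [/\ uniq s, s =i A :|: D', kpath e k s, s = x ++ s1 & s = s2 ++ z].

Lemma flexible_kpath A D z : flexible A D z -> kpath e k z.
Proof.
case=> _ [_ /(_ set0 (sub0set _))[s [s1 [s2 [_ _ ps _ sz]]]]].
by move: ps; rewrite sz; apply: kpath_catr.
Qed.

Lemma flexible_extend A D z v U : flexible A D z -> [disjoint U & A :|: D] ->
  uniq v -> {subset v <= U} -> kpath e k (z ++ v) ->
  flexible (A :|: [set y in v]) D (suff k (z ++ v)).
Proof.
move=> [dAD [zk F]] dU uv vU pv.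
have vAD y : y \in v -> (y \in A) = false /\ (y \in D) = false.
  move=> /vU yU; move/pred0P/(_ y): dU; rewrite /= yU inE /=.
  by case: (y \in A); case: (y \in D).
split; last split.
- rewrite -setI_eq0; apply/eqP/setP => y; rewrite !inE.
  case yv: (y \in v); first by have [_ ->] := vAD y yv; rewrite andbF.
  by rewrite orbF; have /pred0P/(_ y) := dAD.
- by rewrite /suff size_drop size_cat zk; lia.
move=> D' D'D; have [s [s1 [s2 [us sE ps sx sz]]]] := F D' D'D.
exists (s ++ v), (s1 ++ v), (s2 ++ take (size v) (z ++ v)); split.
- rewrite cat_uniq us uv andbT; apply/hasPn => y /vAD[yA yD]; rewrite sE inE yA /=.
  by apply/negP => /(subsetP D'D); rewrite yD.
- by move=> y; rewrite mem_cat sE !inE orbAC.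
- by rewrite sz -catA; apply: kpath_glue; rewrite ?zk // -sz.
- by rewrite sx catA.
- rewrite -catA /suff size_cat zk (_ : k + size v - k = size v)%N ?addKn //.
  by rewrite cat_take_drop sz -catA.
Qed.

(** The path is prolonged by [q1] if [w] is requested and by [q0] otherwise. Vertices of [D] used in
    [q0] become compulsory, and the earlier part of the path skips them. *)
Lemma flexible_absorb A D z w (q0 q1 y a b : seq T) U : flexible A D z ->
  [disjoint U & A] -> w \notin A :|: D :|: U -> uniq q0 -> {subset q0 <= U} ->
  perm_eq q1 (w :: q0) -> kpath e k (z ++ q0) -> kpath e k (z ++ q1) ->
  size y = k -> q0 = a ++ y -> q1 = b ++ y ->
  flexible (A :|: [set v in q0]) (D :\: [set v in q0] :|: [set w]) y.
Proof.
move=> [dAD [zk F]] dU; rewrite !inE !negb_or => /andP[/andP[wA wD] wU] u0 s0 pq p0 p1 yk q0y q1y.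
have wq : w \notin q0 by apply: contra wU => /s0.
have q0A v : v \in q0 -> (v \in A) = false.
  by move=> /s0 vU; move/pred0P/(_ v): dU; rewrite /= vU.
split; last split=> //.
  rewrite -setI_eq0; apply/eqP/setP => v; rewrite !inE.
  case: (eqVneq v w) => [->|vw]; first by rewrite (negbTE wA) (negbTE wq).
  rewrite orbF; case vq: (v \in q0); first by rewrite (q0A v vq).
  by rewrite orbF; have /pred0P/(_ v) := dAD.
move=> D' D'D.
have D'w v : v \in D' -> v != w -> (v \in D) && (v \notin q0).
  by move=> /(subsetP D'D); rewrite !inE => /orP[/andP[-> ->] //|->].
have sub : D' :\ w \subset D.
  by apply/subsetP => v; rewrite !inE => /andP[vw /D'w/(_ vw)/andP[]].
have [s [s1 [s2 [us sE ps sx sz]]]] := F _ sub.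
have glue q : kpath e k (z ++ q) -> kpath e k (s ++ q).
  by move=> pzq; rewrite sz -catA; apply: kpath_glue; rewrite ?zk // -sz.
have sq v : v \in q0 -> v \notin s.
  move=> vq; rewrite sE !inE (q0A v vq) /=; apply/negP => /andP[vw /D'w/(_ vw)].
  by rewrite vq andbF.
have sw : w \notin s by rewrite sE !inE (negbTE wA) eqxx.
case wD' : (w \in D').
- exists (s ++ q1), (s1 ++ q1), (s ++ b); split; rewrite ?sx ?catA //; last 2 first.
  + by rewrite -sx; apply: glue.
  + by rewrite -sx q1y -catA.
  + rewrite -sx cat_uniq us (perm_uniq pq) /= wq u0 !andbT; apply/hasPn => v.
    by rewrite (perm_mem pq) inE => /orP[/eqP-> //|/sq].
  move=> v; rewrite -sx mem_cat (perm_mem pq) sE !inE.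
  case: (eqVneq v w) => [->|vw]; first by rewrite wD' !orbT.
  by rewrite -!orbA; congr (_ || _); rewrite orbC.
exists (s ++ q0), (s1 ++ q0), (s ++ a); split; rewrite ?sx ?catA //; last 2 first.
- by rewrite -sx; apply: glue.
- by rewrite -sx q0y -catA.
- rewrite -sx cat_uniq us u0 !andbT; apply/hasPn => v; exact: sq.
move=> v; rewrite -sx mem_cat sE !inE.
case: (eqVneq v w) => [->|vw]; first by rewrite wD' /= !orbF.
by rewrite -!orbA; congr (_ || _); rewrite orbC.
Qed.

Lemma flexible_eq A D A' D' z : A = A' -> D = D' -> flexible A D z -> flexible A' D' z.
Proof. by move=> <- <-. Qed.

Variables (C : nat) (rho : R).
Hypothesis absorb : absorbing k C e p rho.

(** Absorbs vertices of [W] as long as one of them has enough neighbours in what remains of [U]. *)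
Lemma absorb_all m A D z U W (Ps : seq {set T}) : (size Ps <= 4)%N -> (#|W| <= m)%N ->
  flexible A D z -> [disjoint U & A] -> [disjoint W & A :|: D :|: U] ->
  (forall P, P \in U :: Ps -> gd k e p rho z P) ->
  (forall P S, P \in U :: Ps -> S \subset U -> (#|S| <= C * m)%N ->
    2%:R * (rho * lev 0) <= #|P :\: S|%:R) ->
  exists W' S z', [/\ W' \subset W, S \subset U, (#|S| <= C * m)%N,
    flexible (A :|: S) (D :\: S :|: (W :\: W')) z' &
    (forall P, P \in U :: Ps -> gd k e p rho z' (P :\: S)) /\
    (forall w, w \in W' -> #|(U :\: S) :&: nb w|%:R < rho * lev 1)].
Proof.
elim: m A D z U W Ps => [|m IH] A D z U W Ps sP Wm F dUA dW gP cP.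
  have W0 : W = set0 by apply/eqP; rewrite -cards_eq0 -leqn0.
  exists set0, set0, z; split; rewrite ?sub0set ?cards0 //.
    by apply: flexible_eq F; rewrite ?setU0 // W0 !setD0 setU0.
  by split=> [P|w]; rewrite ?inE // setD0; apply: gP.
have [/existsP[w /andP[wW cw]]|] := boolP [exists w, (w \in W) && (rho * lev 1 <= #|U :&: nb w|%:R)]; last first.
  rewrite negb_exists => /forallP H.
  exists W, set0, z; split; rewrite ?sub0set ?cards0 //.
    by apply: flexible_eq F; rewrite ?setU0 // setD0 setDv setU0.
  split=> [P PP|w wW]; rewrite setD0; first exact: gP.
  by have := H w; rewrite wW /= -ltNge.
have wAD : w \notin A :|: D :|: U.
  by apply/negP => h; move/pred0P/(_ w): dW; rewrite /= wW h.
have wU : w \notin U by apply: contra wAD; rewrite !inE => ->; rewrite !orbT.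
have zk : size z = k by case: F => _ [].
have [|q0 [q1 [y [a [b [[c0 u0 s0] pq /andP[p0 p1] [yk q0y q1y] gy]]]]]] :=
  absorb sP wU zk (flexible_kpath F) (gP U (mem_head _ _)) cw.
  by move=> P PP; have := cP P set0 PP (sub0set _); rewrite cards0 setD0; apply.
have F1 := flexible_absorb F dUA wAD u0 s0 pq p0 p1 yk q0y q1y.
set Q := [set v in q0] in F1 gy.
have QU : Q \subset U by apply/subsetP => v; rewrite inE => /s0.
have cQ : (#|Q| <= C)%N by rewrite cardsE; apply: leq_trans (card_size _) c0.
have [|||||||W' [S [z' [W'W SU cS F2 [gS uS]]]]] :=
  IH (A :|: Q) (D :\: Q :|: [set w]) y (U :\: Q) (W :\ w) [seq P :\: Q | P <- Ps].
- by rewrite size_map.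
- by move: Wm; rewrite (cardsD1 w) wW.
- exact: F1.
- rewrite -setI_eq0; apply/eqP/setP => v; rewrite !inE.
  have := pred0P dUA v; rewrite /= => h.
  by case: (v \in q0) => //=; rewrite orbF; move: h; case: (v \in U).
- rewrite -setI_eq0; apply/eqP/setP => v; rewrite !inE.
  have := pred0P dW v; rewrite /= !inE => h.
  case: eqP => //= _; case vW : (v \in W) h => //= /negbT.
  rewrite !negb_or => /andP[/andP[/negbTE-> /negbTE->] vU].
  by rewrite (negbTE vU) !andbF !orbF /=; apply: contraNF vU => /s0.
- move=> P; rewrite inE => /orP[/eqP->|/mapP[P' PP' ->]]; apply: gy; rewrite inE ?eqxx //.
  by rewrite PP' orbT.
- move=> P S; rewrite inE => PP SU cS.
  have SQ : Q :|: S \subset U.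
    by rewrite subUset QU; apply: subset_trans SU (subsetDl _ _).
  have cSQ : (#|Q :|: S| <= C * m.+1)%N.
    by apply: leq_trans (leq_card_setU _ _) _; rewrite mulnS leq_add.
  case/orP: PP => [/eqP->|/mapP[P' PP' ->]]; rewrite setDDl; apply: cP; rewrite ?mem_head //.
  by rewrite inE PP' orbT.
exists W', (Q :|: S), z'; split.
- exact: subset_trans W'W (subsetDl _ _).
- by rewrite subUset QU; apply: subset_trans SU (subsetDl _ _).
- by apply: leq_trans (leq_card_setU _ _) _; rewrite mulnS leq_add.
- apply: flexible_eq F2; first by rewrite setUA.
  apply/setP => v; rewrite !inE.
  case: (eqVneq v w) => [->|vw] /=; last by rewrite orbF negb_or [_ && (v \notin S)]andbC -andbA [X in _ || X]andbC;
    case: (v \in W); case: (v \in W').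
  have wS : w \notin S by apply: contra wU => /(subsetP SU); rewrite inE => /andP[].
  have wW' : w \notin W' by apply/negP => /(subsetP W'W); rewrite !inE eqxx.
  by rewrite wS wW' wW !orbT.
split=> [P|w' /uS]; last by rewrite setDDl.
rewrite -setDDl inE => /orP[/eqP->|PP]; apply: gS; rewrite inE ?eqxx //.
by apply/orP; right; apply/mapP; exists P.
Qed.

Hypotheses (rg0k : rg 0 k) (eta_le : 3%:R * eta <= rho).

(** The vertices that could not be absorbed are atypical for the remainder of [U], so [typical]
    bounds their number. *)
Lemma absorb_most m A D z U W (Ps : seq {set T}) : (size Ps <= 4)%N -> (#|W| <= m)%N ->
  flexible A D z -> [disjoint U & A] -> [disjoint W & A :|: D :|: U] ->
  (forall P, P \in U :: Ps -> gd k e p rho z P) ->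
  (forall P S, P \in U :: Ps -> S \subset U -> (#|S| <= C * m)%N ->
    2%:R * (rho * lev 0) <= #|P :\: S|%:R) ->
  exists W' S z', [/\ W' \subset W, S \subset U, (#|S| <= C * m)%N,
    flexible (A :|: S) (D :\: S :|: (W :\: W')) z' &
    [/\ forall P, P \in U :: Ps -> gd k e p rho z' (P :\: S),
        forall w, w \in W' -> #|(U :\: S) :&: nb w|%:R < rho * lev 1 &
        #|W'|%:R <= 3%:R * (eta * lev k)]].
Proof.
move=> sP Wm F dUA dW gP cP.
have [W' [S [z' [W'W SU cS F' [gP' uW]]]]] := absorb_all sP Wm F dUA dW gP cP.
exists W', S, z'; split=> //; split=> //.
have lv a := lev_gt0 a gg; have e0 := gg_eta gg; have p0 := gg_p0 gg.
have cU := cP U S (mem_head _ _) SU cS.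
have l0 := lv 0%N; have r0 : 0 < rho by apply: lt_le_trans eta_le; rewrite mulr_gt0.
apply: le_trans (typical (gg_sym gg) p0 (gg_reg gg rg0k) (gg_big gg rg0k) _ (_ : 3%:R * (eta * lev 0) <= #|U :\: S|%:R)).
- rewrite ler_nat; apply/subset_leq_card/subsetP => w /uW; rewrite inE => h.
  apply: lt_le_trans h _; rewrite levS.
  have : p / 8%:R * (2%:R * (rho * lev 0)) <= p / 8%:R * #|U :\: S|%:R.
    by rewrite ler_pM2l // divr_gt0.
  have : 0 < p * (rho * lev 0) by rewrite !mulr_gt0.
  by move=> h1 h2; lra.
- by rewrite mulr_gt0.
- have : 3%:R * eta * lev 0 <= rho * lev 0 by rewrite ler_pM2r.
  have : 0 < rho * lev 0 by rewrite mulr_gt0.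
  by move=> h1 h2; lra.
Qed.

End Flexible.

(** * Reservoirs and the closing of the cycle *)

Lemma disjoint_mem (T : finType) (A B : {set T}) v : [disjoint A & B] ->
  (v \in A) && (v \in B) = false.
Proof. by move/pred0P/(_ v). Qed.

Lemma subset_mem (T : finType) (A B : {set T}) v : A \subset B -> (v \in A) ==> (v \in B).
Proof. by move/subsetP => h; apply/implyP => /h. Qed.

(* Boolean identities between set memberships at [v], from the inclusions and
   disjointness relations in the context. *)
Ltac mem_cases v :=
  repeat match goal with
  | H : is_true [disjoint _ & _] |- _ => move: (disjoint_mem v H); clear H
  | H : is_true (_ \subset _) |- _ => move: (subset_mem v H); clear H
  | H : forall _, is_true (_ || _) |- _ => move: (H v); clear H
  end;
  rewrite ?inE;
  repeat match goal with
  | |- context [v \in ?A] => case: (v \in A); rewrite //=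
  end.

Ltac set_disj := let v := fresh "v" in
  rewrite -setI_eq0; apply/eqP/setP => v; mem_cases v.

(** The hierarchy of constants: [eta] far below [rho], [rho n] far below the reservoir size [M], and
    [M] far below [n] and at most [beta n]. Terms with [C] appear because absorbing [q] vertices
    uses up to [C q] others. The quality is [2 rho] while the reservoirs are built and [rho] at the
    end. *)
Record assembly (R : realType) (k : nat) (rg : rel nat) (T : finType) (e : rel T)
    (p eta : R) (C M : nat) (rho beta : R) : Prop := Assembly {
  as_good : good_graph e p rg eta;
  as_k : (0 < k)%N;
  as_rg : forall a, (a < k)%N -> rg a k;
  as_absorb1 : absorbing k C e p rho;
  as_absorb2 : absorbing k C e p (2%:R * rho);
  as_conn : forall (z y : seq T) (U : {set T}), size z = k -> size y = k ->
    kpath e k z -> kpath e k y -> good e p rho z U -> good e p rho (rev y) U ->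
    exists cs, [/\ uniq cs, {subset cs <= U}, (size cs <= 5 * k)%N &
      kpath e k (z ++ cs ++ y)];
  as_degree : forall v, beta * p * #|T|%:R <= #|nb e v|%:R;
  as_rho : 0 < rho;
  as_rhoM : 20%:R * (rho * lev T p 0) + 20%:R * (C%:R * (rho * lev T p 0)) <= M%:R;
  as_M : 20%:R * M%:R + 20%:R * (C%:R * M%:R) <= lev T p 0;
  as_M_beta : M%:R <= beta * lev T p 0;
  as_rho_beta : rho <= beta;
  as_eta : 100%:R * eta + 100%:R * (C%:R * eta) + 100%:R * (k%:R * eta) <= rho }.

Lemma levn0 (R : realType) (T : finType) (p : R) : lev T p 0 = #|T|%:R.
Proof. by rewrite levE expr0 mul1r. Qed.

Lemma assembly_bounds (R : realType) k rg (T : finType) (e : rel T) (p eta : R) C M rho beta :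
  assembly k rg e p eta C M rho beta ->
  [/\ [/\ 1 <= eta * lev T p k, 0 < rho * lev T p 0, 0 <= C%:R * (rho * lev T p 0),
        0 <= C%:R * M%:R :> R & 0 <= C%:R * (eta * lev T p k)],
     [/\ 100%:R * (eta * lev T p k) + 100%:R * (C%:R * (eta * lev T p k)) + 100%:R * k%:R
          <= rho * lev T p k,
       rho * lev T p k <= rho * lev T p 0, rho * lev T p k <= rho * lev T p 1 &
       0 <= k%:R :> R] &
     [/\ 0 < eta, 0 <= C%:R * eta & 0 <= k%:R * eta]].
Proof.
case=> gg k_gt0 rgk _ _ _ _ rho0 _ _ _ _ small.
have lv a := lev_gt0 a gg; have e0 := gg_eta gg.
have y1 : 1 <= eta * lev T p k.
  by have r := rgk 0%N k_gt0; rewrite (gg_rg gg) in r; exact: (gg_big gg r).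
split; split=> //; rewrite ?mulr_ge0 ?(ltW e0) ?(ltW (lv _)) ?(ltW rho0) ?mulr_gt0 //; last 2 first.
- by rewrite ler_pM2l //; apply: (le_lev gg).
- by rewrite ler_pM2l //; apply: (le_lev gg).
have h : (100%:R * eta + 100%:R * (C%:R * eta) + 100%:R * (k%:R * eta)) * lev T p k
    <= rho * lev T p k by rewrite ler_pM2r.
have : k%:R * 1 <= k%:R * (eta * lev T p k) by apply: ler_wpM2l.
have -> : k%:R * (eta * lev T p k) = (k%:R * eta) * lev T p k by rewrite mulrA.
have -> : C%:R * (eta * lev T p k) = (C%:R * eta) * lev T p k by rewrite mulrA.
by move: h; clear; move=> h1 h2; lra.
Qed.

Lemma choose_reservoirs (R : realType) k rg (T : finType) (e : rel T) (p eta : R) C M rho beta :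
  assembly k rg e p eta C M rho beta -> exists (R1 R2 B : {set T}) (x : seq T),
  [/\ [/\ #|R1| = M, #|R2| = M, [disjoint R1 & R2], [disjoint R1 & B] &
      #|B|%:R <= 3%:R * (eta * lev T p k)],
      forall v, (v \notin B) = (p / 8%:R * M%:R <= #|R2 :&: nb e v|%:R),
      [/\ size x = k, uniq x, kpath e k x & [disjoint [set v in x] & R1 :|: R2 :|: B]] &
      [/\ gd k e p (2%:R * rho) x (~: (R1 :|: R2 :|: B :|: [set v in x])),
          gd k e p (2%:R * rho) x R1, gd k e p (2%:R * rho) x R2 &
          gd k e p (2%:R * rho) (rev x) R2]].
Proof.
move=> H; have [[y1 rn0 crn cM cy] [t1 t2 t3 k0] [e0 ce ke]] := assembly_bounds H.
case: H => gg k_gt0 rg_k _ _ _ _ rho_gt0 rhoM M_small _ _ eta_small.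
have lv a := lev_gt0 a gg; have p0 := gg_p0 gg.
have [||R2 [_ _ cR2]] := @card_superset_between T set0 setT M; first exact: sub0set.
  rewrite cards0 cardsT leq0n -(ler_nat R) -(levn0 T p).
  by rlra.
pose B := [set v | #|R2 :&: nb e v|%:R < p / 8%:R * #|R2|%:R].
have rg0 := rg_k 0%N k_gt0.
have cB : #|B|%:R <= 3%:R * (eta * lev T p k).
  apply: (typical (gg_sym gg) p0 (gg_reg gg rg0) (gg_big gg rg0)); first by rewrite mulr_gt0.
  rewrite cR2; have : eta * lev T p 0 <= rho * lev T p 0.
    by rewrite ler_pM2r //; rlra.
  by rlra.
have HB v : (v \notin B) = (p / 8%:R * M%:R <= #|R2 :&: nb e v|%:R).
  by rewrite inE -leNgt cR2.
clearbody B.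
have [||R1 [_ sR1 cR1]] := @card_superset_between T set0 (~: (R2 :|: B)) M; first exact: sub0set.
  rewrite cards0 leq0n -(ler_nat R).
  have := card_setCr R (R2 :|: B); rewrite -(levn0 T p).
  have := card_setUr R R2 B; rewrite cR2.
  by rlra.
pose X := ~: (R1 :|: R2 :|: B).
have cX : lev T p 0 - 2%:R * M%:R - 3%:R * (eta * lev T p k) <= #|X|%:R.
  have := card_setCr R (R1 :|: R2 :|: B); rewrite -(levn0 T p).
  have := card_setUr R (R1 :|: R2) B; have := card_setUr R R1 R2; rewrite cR1 cR2.
  by rewrite -/X; rlra.
have r20 : 0 < 2%:R * rho by rewrite mulr_gt0.
have [||||||||x [sx ux xX px [gx tx]]] := @extend R k rg T e p eta gg k_gt0 rg_k _ _ r20 (lexx _)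
  k 0 [::] X [:: R1; R2].
- by rewrite [size _]/= natrM; rlra.
- by [].
- move=> [|j] // _ _; rewrite suff0 commons_nil; apply: le_trans cX.
  by rlra.
- by [].
- by [].
- by move=> P; rewrite !inE => /orP[] /eqP->; rewrite ?cR1 ?cR2;
    rlra.
- by move=> P _ [|j].
- by apply: le_trans cX; rlra.
have trx a P : (a <= k)%N -> P \in [:: R1; R2] -> trk e p (2%:R * rho) a (take a x) P.
  by move=> ak PP; have := tx a ak P PP; rewrite add0n (minn_idPr ak).
have g4 P : P \in [:: R1; R2] -> 2%:R * rho * lev T p 0 <= #|P|%:R.
  by rewrite !inE => /orP[] /eqP->; rewrite ?cR1 ?cR2;
    rlra.
have gP P : P \in [:: R1; R2] -> gd k e p (2%:R * rho) x P.
  move=> PP; apply: gd_of_trk (g4 P PP) _.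
  move=> j jk; have := trx k P (leqnn k) PP j jk; rewrite take_oversize ?sx //.
  have : 0 < rho * lev T p j by rewrite mulr_gt0.
  have -> : 2%:R * rho / 2%:R = rho by field.
  by clear; move=> *; lra.
exists R1, R2, B, x; split.
- split=> //.
    by set_disj.
  by set_disj.
- exact: HB.
- split=> //; rewrite -setI_eq0; apply/eqP/setP => v; rewrite in_set0 in_setI in_set.
  by case vx: (v \in x) => //=; have := xX v vx; rewrite in_setC => /negbTE.
split; try (by apply: gP; rewrite !inE eqxx ?orbT).
  by rewrite setCU -setDE; exact: gx.
(* The last [j] vertices of [rev x] are the first [j] of [x]; their common neighbourhood was
   controlled when they were the whole path. *)
move=> j jk _; have := trx j R2 jk; rewrite !inE eqxx orbT => /(_ isT).
have -> : suff j (rev x) = rev (take j x).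
  by rewrite /suff size_rev drop_rev sx subKn.
have -> : commons e (rev (take j x)) = commons e (take j x).
  by apply/setP => v; rewrite !inE all_rev.
have st : size (take j x) = j by rewrite size_takel // sx.
have ss : suff j (take j x) = take j x by rewrite /suff st subnn drop0.
case: j jk st ss => [|j] jk st ss; first by rewrite take0 commons_nil => _; apply: g4; rewrite !inE eqxx orbT.
move/(_ j.+1); rewrite ss ltnSn => /(_ isT).
have : 0 < rho * lev T p j.+1 by rewrite mulr_gt0.
by clear; move=> *; lra.
Qed.

Lemma flexible_init (T : finType) (k : nat) (e : rel T) x : size x = k -> uniq x ->
  kpath e k x -> flexible k e x [set v in x] set0 x.
Proof.
move=> sx ux px; split; first by rewrite -setI_eq0 setI0.
split=> // D'; rewrite subset0 => /eqP->; exists x, [::], [::]; split; rewrite ?cats0 //.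
by move=> v; rewrite !inE orbF.
Qed.

Lemma mulCnat (R : realType) (C : nat) (r : R) m q : (m <= C * q)%N -> q%:R <= r -> m%:R <= C%:R * r.
Proof.
by rewrite -(ler_nat R) natrM => h1 h2; apply: le_trans h1 _; apply: ler_wpM2l.
Qed.

Lemma absorb_reservoirs (R : realType) k rg (T : finType) (e : rel T) (p eta : R) C M rho beta :
  assembly k rg e p eta C M rho beta -> exists (x z : seq T) (A D X W R1 R2 : {set T}),
  [/\ [/\ size x = k, kpath e k x, flexible k e x A D z & gd k e p (2%:R * rho) (rev x) R2],
      [/\ gd k e p (2%:R * rho) z X, gd k e p (2%:R * rho) z R1 & gd k e p (2%:R * rho) z R2],
      [/\ [disjoint X & A :|: D], [disjoint W & A :|: D], [disjoint X & W],
          [disjoint R1 & A :|: X] & [disjoint R2 & A :|: X]] /\ [disjoint R1 & R2],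
      forall v, [|| v \in A, v \in D, v \in X | v \in W] &
      [/\ #|W|%:R <= 3%:R * (eta * lev T p k), lev T p 0 / 2%:R <= #|X|%:R,
          M%:R / 2%:R <= #|R1|%:R :> R, M%:R / 2%:R <= #|R2|%:R :> R &
          forall v, v \notin A :|: D -> p / 8%:R * M%:R <= #|R2 :&: nb e v|%:R]].
Proof.
move=> H; have [[y1 rn0 crn cM cy] [t1 t2 t3 k0] [e0 ce ke]] := assembly_bounds H.
have [R1 [R2 [B [x [[cR1 cR2 d12 d1B cB] hB [sx ux px dx] [gX g1 g2 gr]]]]]] :=
  choose_reservoirs H.
case: H => gg k_gt0 rg_k _ absorb _ degree rho_gt0 rhoM M_small M_beta rho_beta eta_small.
have lv a := lev_gt0 a gg; have p0 := gg_p0 gg.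
have rg0 := rg_k 0%N k_gt0.
have F0 := flexible_init sx ux px.
have cx : #|[set v in x]|%:R = k%:R :> R by rewrite cardsE (card_uniqP ux) sx.
set xs := [set v in x] in dx gX F0 cx; clearbody xs.
pose X := ~: (R1 :|: R2 :|: B :|: xs); rewrite -/X in gX.
have cX : lev T p 0 - 2%:R * M%:R - 3%:R * (eta * lev T p k) - k%:R <= #|X|%:R.
  have := card_setCr R (R1 :|: R2 :|: B :|: xs); rewrite -(levn0 T p) -/X.
  have := card_setUr R (R1 :|: R2 :|: B) xs; have := card_setUr R (R1 :|: R2) B.
  have := card_setUr R R1 R2; rewrite cR1 cR2 cx.
  by rlra.
have dX : [disjoint X & R1 :|: R2 :|: B :|: xs].
  by rewrite -setI_eq0; apply/eqP/setP => v; rewrite !inE andNb.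
have covX v : [|| v \in X, v \in R1, v \in R2, v \in B | v \in xs].
  by rewrite !inE; case: (v \in R1); case: (v \in R2); case: (v \in B); case: (v \in xs).
clearbody X.
have eta3 : 3%:R * eta <= 2%:R * rho.
  by rlra.
have small (q : nat) (S : {set T}) : (q%:R <= 3%:R * (eta * lev T p k)) -> (#|S| <= C * q)%N ->
    #|S|%:R <= 3%:R * (C%:R * (eta * lev T p k)) :> R.
  by move=> h1 h2; apply: le_trans (mulCnat h2 h1) _; rewrite mulrCA.
have [||||WA [SA [zA [WWA SUA cSA FA [gA uA _]]]]] := absorb_most gg absorb rg0 eta3
  (Ps := [:: X; R1; R2]) (U := X :|: R1) (W := B) isT (leqnn _) F0.
- by rewrite -setI_eq0; apply/eqP/setP => v; move: dX dx; clear; move=> dX dx; mem_cases v.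
- by rewrite -setI_eq0; apply/eqP/setP => v; move: dX dx d1B; clear; move=> dX dx d1B; mem_cases v.
- move=> P; rewrite !inE => /or4P[]/eqP-> //.
  by apply: (gd_le gg (lexx _) _ gX); exact: subsetUl.
- move=> P S PP _ cS; have := small _ _ cB cS => {}cS.
  have := card_setDr R P S; have : #|X|%:R <= #|X :|: R1|%:R :> R by apply/card_subr/subsetUl.
  by move: PP; rewrite !inE => /or4P[]/eqP->; move: cS cX rhoM M_small rn0 crn cM cB t1 t2 cy k0 y1;
    rewrite ?cR1 ?cR2; clear; move=> *; lra.
have {}cSA := small _ _ cB cSA.
(* A vertex of [B] has at least [beta p n] neighbours, few of them in [R2]; the rest of the graph
   outside [X] and [R1], and the vertices used up, are too few to contain the others. *)
have WA0 : WA = set0.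
  apply/setP => w; rewrite inE; apply/negP => wW; have := uA w wW.
  have wB : w \in B by apply: (subsetP WWA).
  have sub : nb e w \subset (((X :|: R1) :\: SA) :&: nb e w :|: R2 :&: nb e w) :|: (B :|: xs :|: SA).
    move: (nb e w) => N; apply/subsetP => v; move: covX; clear; move=> covX; mem_cases v.
  have h3 := card_subr R sub; have h4 := degree w.
  have h5 : #|R2 :&: nb e w|%:R < p / 8%:R * M%:R by rewrite ltNge -hB wB.
  have := card_setUr R (B :|: xs) SA; have := card_setUr R B xs.
  have := card_setUr R (((X :|: R1) :\: SA) :&: nb e w :|: R2 :&: nb e w) (B :|: xs :|: SA).
  have := card_setUr R (((X :|: R1) :\: SA) :&: nb e w) (R2 :&: nb e w).
  move=> h6 h7 h8 h9.
  have h10 : p * M%:R <= p * (beta * lev T p 0) by rewrite ler_pM2l.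
  have h11 : rho * (p * lev T p 0) <= beta * (p * lev T p 0).
    by apply: ler_wpM2r => //; apply: mulr_ge0; apply: ltW.
  have h12 : 0 < rho * (p * lev T p 0) by rewrite !mulr_gt0.
  rewrite cx in h8; rewrite levS in t3 *; rewrite -(levn0 T p) in h4.
  move: h3 h4 h5 h6 h7 h8 h9 h10 h11 h12 cSA cB t1 t3 cy k0 y1; clear.
  have -> : p * (beta * lev T p 0) = beta * (p * lev T p 0) by rewrite mulrCA.
  have -> : rho * (p / 16%:R * lev T p 0) = rho * (p * lev T p 0) / 16%:R by field.
  have -> : 2%:R * rho * (p / 16%:R * lev T p 0) = rho * (p * lev T p 0) / 8%:R by field.
  have -> : beta * p * lev T p 0 = beta * (p * lev T p 0) by rewrite mulrA.
  have -> : p / 8%:R * M%:R = p * M%:R / 8%:R by field.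
  by move=> *; lra.
rewrite WA0 in FA.
have {WA0 WWA uA}FA : flexible k e x (xs :|: SA) B zA.
  by apply: flexible_eq FA; rewrite // set0D set0U setD0.
have gAX := gA X; have gA1 := gA R1; have gA2 := gA R2; rewrite !inE !eqxx !orbT in gAX gA1 gA2.
have {gA}gAX := gAX isT; have {}gA1 := gA1 isT; have {}gA2 := gA2 isT.
have eR2 : R2 :\: SA = R2.
  by apply/setP => v; move: dX dx d12 SUA; clear; move=> dX dx d12 SUA; mem_cases v.
rewrite eR2 in gA2.
have dAD : [disjoint X :\: SA & xs :|: SA :|: B].
  by move: dX; clear; move=> dX; set_disj.
have dR1 : [disjoint R1 :\: SA & xs :|: SA :|: B :|: (X :\: SA)].
  by move: dX dx d1B; clear; move=> dX dx d1B; set_disj.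
have dR2 : [disjoint R2 & xs :|: SA :|: (X :\: SA)].
  by move: dX dx d12 SUA; clear; move=> dX dx d12 SUA; set_disj.
have d12' : [disjoint R1 :\: SA & R2] by move: d12; clear; move=> d12; set_disj.
have cov v : [|| v \in xs :|: SA, v \in B, v \in X :\: SA, v \in R1 :\: SA | v \in R2].
  by move: covX; clear; move=> covX; mem_cases v.
have cX1 : lev T p 0 - 3%:R * M%:R <= #|X :\: SA|%:R.
  have := card_setDr R X SA.
  by rlra.
have cR1' : 3%:R * M%:R <= 4%:R * #|R1 :\: SA|%:R :> R.
  have := card_setDr R R1 SA; rewrite cR1.
  by rlra.
have cR1u : #|R1 :\: SA|%:R <= M%:R :> R by rewrite -cR1; apply/card_subr/subsetDl.
move: (xs :|: SA) (X :\: SA) (R1 :\: SA) FA gAX gA1 gA2 dAD dR1 dR2 d12' cov cX1 cR1' cR1u.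
move=> A X' R1' {eR2 SUA cSA covX dX cX d1B d12 dx}.
move=> {gX g1 F0 cx X cR1 R1}.
move: X' R1' => X R1 FA gX g1 {}g2 dX d1 d2 d12 cov cX cR1 cR1u.
(* The vertices of [B] are optional by now; the other reservoir vertices are to become so. *)
pose W := (R1 :|: R2) :\: B.
have cW : #|W|%:R <= 2%:R * M%:R :> R.
  have h1 := card_subr R (subsetDl (R1 :|: R2) B); have h2 := card_setUr R R1 R2.
  by rewrite cR2 in h2; move: h1 h2 cR1u; rewrite -/W; clear; move=> *; lra.
have eR (S P : {set T}) : S \subset X -> P \in [:: R1; R2] -> P :\: S = P.
  rewrite !inE => SX /orP[]/eqP->; apply/setP => v; move: SX d1 d2; clear;
    by move=> SX d1 d2; mem_cases v.
have cSW (S : {set T}) : (#|S| <= C * #|W|)%N -> #|S|%:R <= 2%:R * (C%:R * M%:R) :> R.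
  by move=> cS; apply: le_trans (mulCnat cS cW) _; rewrite mulrCA.
have [||||W' [S [z' [W'W SX cS FB [gB _ cW']]]]] := absorb_most gg absorb rg0 eta3
  (Ps := [:: R1; R2]) (U := X) (W := W) isT (leqnn _) FA.
- by move: dX; clear; move=> dX; set_disj.
- by rewrite /W; move: dX d1 d2; clear; move=> dX d1 d2; set_disj.
- by move=> P; rewrite !inE => /or3P[]/eqP->.
- move=> P S PP SX /cSW cS; move: PP; rewrite inE => /orP[/eqP->|PP].
    by have := card_setDr R X S; rlra.
  by rewrite eR //; move: PP; rewrite !inE => /orP[]/eqP->; rewrite ?cR2; rlra.
have {}cS := cSW S cS.
exists x, z', (A :|: S), (B :\: S :|: (W :\: W')), (X :\: S), W', R1, R2; split.
- by [].
- split; first by apply: gB; rewrite inE eqxx.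
    by rewrite -(eR S R1) ?inE ?eqxx //; apply: gB; rewrite !inE eqxx ?orbT.
  by rewrite -(eR S R2) ?inE ?eqxx ?orbT //; apply: gB; rewrite !inE eqxx ?orbT.
- rewrite /W in W'W *; move: dX d1 d2 d12 SX W'W; clear; move=> dX d1 d2 d12 SX W'W.
  by split=> //; split; set_disj.
- by move=> v; rewrite /W in W'W *; move: cov SX W'W dX; clear; move=> cov SX W'W dX; mem_cases v.
split=> //.
- have := card_setDr R X S.
  by rlra.
- by rlra.
- by rewrite cR2; rlra.
move=> v hv; rewrite -hB; move: hv SX dX; rewrite /W; clear; move=> hv SX dX.
by move: hv; mem_cases v.
Qed.

Lemma suff_suff (T : Type) j k (s : seq T) : (j <= k)%N -> suff j (suff k s) = suff j s.
Proof. by move=> jk; rewrite /suff size_drop drop_drop; congr drop; lia. Qed.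

Lemma gd_shrink_set (R : realType) k rg (T : finType) (e : rel T) (p eta rho rho' : R) Q
    (P S : {set T}) : good_graph e p rg eta -> rho' <= rho ->
  #|S|%:R <= (rho - rho') * lev T p k -> gd k e p rho Q P -> gd k e p rho' Q (P :\: S).
Proof.
move=> gg rr cS H; rewrite -(set_enum S).
by apply: (gd_shrink gg rr cS _ H); rewrite cardE.
Qed.

Lemma power_cycle_exists (R : realType) k rg (T : finType) (e : rel T) (p eta : R) C M rho beta :
  assembly k rg e p eta C M rho beta ->
  exists c, [/\ uniq c, forall v, v \in c & kpath e k (c ++ take k c)].
Proof.
move=> H; have [[y1 rn0 crn cM cy] [t1 t2 t3 k0] [e0 ce ke]] := assembly_bounds H.
have [x [z [A [D [X [W [R1 [R2 [[sx px FA gr] [gX g1 g2]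
  [[dX dW dXW d1 d2] d12] cov [cW cX cR1 cR2 hR]]]]]]]]]] := absorb_reservoirs H.
case: H => gg k_gt0 rg_k absorb _ conn _ rho_gt0 rhoM M_small _ _ eta_small.
have lv a := lev_gt0 a gg; have p0 := gg_p0 gg.
have rg0 := rg_k 0%N k_gt0.
have eta3 : 3%:R * eta <= rho.
  by rlra.
have zk : size z = k by case: FA => _ [].
have rr : rho <= 2%:R * rho by move: rho_gt0; clear => ?; lra.
have cP P : P \in [:: R1; R2] -> 2%:R * rho * lev T p 0 <= #|P|%:R.
  by rewrite !inE => /orP[]/eqP->; rlra.
(* The greedy path stops when about [rho n] vertices of [X] remain, as many as [extend] has to
   keep. *)
pose m := Num.truncn (#|X|%:R - rho * lev T p 0).
have mP : m%:R <= #|X|%:R - rho * lev T p 0 < m.+1%:R.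
  apply: truncn_itv; rlra.
have [|||||||v [sv uv vX pv [_ tv]]] := @extend R k rg T e p eta gg k_gt0 rg_k rho rho rho_gt0
  (lexx _) m k z X [:: R1; R2] _ (flexible_kpath FA).
- by rewrite [size _]/= natrM; rlra.
- by apply: (gd_le gg rr _ gX).
- exact: leqnn.
- by rewrite zk.
- move=> P /cP; have : 0 < rho * lev T p 0 by []; clear; move=> *; lra.
- move=> P PP j /andP[j0 jk].
  have : gd k e p (2%:R * rho) z P by move: PP; rewrite !inE => /orP[]/eqP->.
  by move=> /(_ j jk); rewrite zk mulrA; apply.
- by move: mP; clear => /andP[h1 h2]; lra.
have dXAD : [disjoint X & A :|: D] by [].
have F3 := flexible_extend FA dXAD uv vX pv.
set z3 := suff k (z ++ v) in F3.
have g3 P : P \in [:: R1; R2] -> gd k e p (2%:R * rho) z3 P.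
  move=> PP; apply: gd_of_trk (cP P PP) _ => j jk; rewrite suff_suff; last by case/andP: jk.
  have := tv m (leqnn m) P PP j; rewrite -sv take_size (minn_idPl (leq_addr _ _)) => /(_ jk).
  by have -> : 2%:R * rho / 2%:R = rho by field.
have {g1}g1 : gd k e p (2%:R * rho) z3 R1 by apply: g3; rewrite !inE eqxx.
have {g2 g3}g2 : gd k e p (2%:R * rho) z3 R2 by apply: g3; rewrite !inE eqxx orbT.
have cV : #|[set u in v]| = m by rewrite cardsE (card_uniqP uv).
have VX : [set u in v] \subset X by apply/subsetP => u; rewrite inE => /vX.
move: [set u in v] cV VX F3 => V cV VX F3.
clearbody z3; move: z3 F3 g1 g2 => {tv pv vX uv v sv FA gX zk}z3 F3 g1 g2.
(* All that is neither on the path nor optional; [W] consists of the reservoir vertices that could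
   not be absorbed. *)
pose W3 := X :\: V :|: W.
have cW3 : #|W3|%:R <= 2%:R * (rho * lev T p 0).
  have h1 := card_setUr R (X :\: V) W.
  have h2 : #|X :\: V|%:R + m%:R = #|X|%:R :> R.
    rewrite -natrD -cV -(cardsID V X) addnC (_ : X :&: V = V) //.
    by apply/setIidPr.
  move: h1 h2 mP cW t1 t2 y1 cy k0; rewrite -natr1 -/W3; clear => h1 h2 /andP[h3 h4] *; lra.
have cWt : #|W|%:R <= (2%:R * rho - rho) * lev T p k.
  by rlra.
have {}g1 := gd_shrink_set gg rr cWt g1.
have {}g2 := gd_shrink_set gg rr cWt g2.
have cRe := card_setDr R R1 W; have cRf := card_setDr R R2 W.
(* Outside [W] the reservoir vertices are optional, so the absorbing paths may use them. *)
have [||||W4 [S4 [z4 [W43 S4R cS4 F4 [g4 _ cW4]]]]] := absorb_most gg absorb rg0 eta3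
  (Ps := [:: R2 :\: W]) (U := R1 :\: W) (W := W3) isT (leqnn _) F3.
- by move: d1 VX; clear => d1 VX; set_disj.
- by rewrite /W3; move: d1 VX dX dW dXW; clear => d1 VX dX dW dXW; set_disj.
- by move=> P; rewrite !inE => /orP[]/eqP->.
- move=> P S PP SR cS; have := mulCnat cS cW3; rewrite mulrCA => {}cS.
  move: PP; rewrite !inE => /orP[]/eqP->.
    have := card_setDr R (R1 :\: W) S.
    by rlra.
  have -> : (R2 :\: W) :\: S = R2 :\: W.
    by apply/setP => u; move: SR d12; clear => SR d12; mem_cases u.
  by rlra.
have {g4}g4 : gd k e p rho z4 (R2 :\: W).
  have := g4 (R2 :\: W); rewrite !inE eqxx orbT => /(_ isT).
  have -> // : (R2 :\: W) :\: S4 = R2 :\: W.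
  by apply/setP => u; move: S4R d12; clear => SR d12; mem_cases u.
have [||||W5 [S5 [z5 [W54 S5R cS5 F5 [g5 u5 _]]]]] := absorb_most gg absorb rg0 eta3
  (Ps := [::]) (U := R2 :\: W) (W := W4) isT (leqnn _) F4.
- by move: d2 VX d12 S4R; clear => d2 VX d12 S4R; set_disj.
- rewrite /W3 in W43 *; move: d1 d2 VX dX dW dXW W43 S4R.
  by clear => d1 d2 VX dX dW dXW W43 S4R; set_disj.
- by move=> P; rewrite !inE => /eqP->.
- move=> P S; rewrite inE => /eqP-> SR cS; have := mulCnat cS cW4; rewrite mulrCA => {}cS.
  have := card_setDr R (R2 :\: W) S.
  by rlra.
have {}cS5 : #|S5|%:R <= 3%:R * (C%:R * (eta * lev T p k)) :> R.
  by have := mulCnat cS5 cW4; rewrite mulrCA.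
have {}g5 := g5 _ (mem_head _ _).
(* By [hR], a vertex that was neither on the path nor optional has at least [p M / 8] neighbours in
   [R2], far more than [W] and [S5] can remove. *)
have eW5 : W5 = set0.
  apply/setP => w; rewrite inE; apply/negP => wW; have h1 := u5 w wW.
  have wAD : w \notin A :|: D.
    rewrite /W3 in W43; move: wW VX dX dW W43 W54; clear => wW VX dX dW W43 W54.
    by move: wW; mem_cases w.
  have h2 := hR w wAD.
  have h3 : R2 :&: nb e w \subset ((R2 :\: W) :\: S5) :&: nb e w :|: (W :|: S5).
    by move: (nb e w) => N; apply/subsetP => u; clear; mem_cases u.
  have := card_subr R h3; have := card_setUr R (((R2 :\: W) :\: S5) :&: nb e w) (W :|: S5).
  have := card_setUr R W S5 => h4 h5 h6.
  have h7 : p * (20%:R * (rho * lev T p 0)) <= p * M%:R.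
    by rewrite ler_pM2l //; rlra.
  have h8 : 0 < rho * (p * lev T p 0) by rewrite !mulr_gt0.
  move: h1 h2 h4 h5 h6 h7 h8 cW cS5 t1 t3 y1 cy k0; rewrite levS; clear.
  have -> : rho * (p / 16%:R * lev T p 0) = rho * (p * lev T p 0) / 16%:R by field.
  have -> : p * (20%:R * (rho * lev T p 0)) = 20%:R * (rho * (p * lev T p 0)) by ring.
  have -> : p / 8%:R * M%:R = p * M%:R / 8%:R by field.
  by move=> *; lra.
rewrite eW5 setD0 in F5.
have {}gr : gd k e p rho (rev x) ((R2 :\: W) :\: S5).
  rewrite setDDl; apply: (gd_shrink_set gg rr _ gr); apply: le_trans (card_setUr _ _ _) _.
  by rlra.
have zk : size z5 = k by case: F5 => _ [].
have rxk : size (rev x) = k by rewrite size_rev.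
have [||cs [ucs scs _ pcs]] := conn z5 x ((R2 :\: W) :\: S5) zk sx (flexible_kpath F5) px.
- exact/(gd_good _ _ _ _ zk).
- exact/(gd_good _ _ _ _ rxk).
have subcs : [set u in cs] \subset (R2 :\: W) :\: S5 by apply/subsetP => u; rewrite inE => /scs.
case: F5 => _ [_ /(_ _ (subsetDl _ [set u in cs]))[s [s1 [s2 [us sE ps sx1 sz]]]]].
exists (s ++ cs); split.
- rewrite cat_uniq us ucs andbT; apply/hasPn => u ucsu; rewrite sE inE.
  have ucs' : u \in [set u in cs] by rewrite inE.
  move: [set u in cs] ucs' subcs => CS ucs' subcs.
  move: ucs' d2 VX d12 S4R subcs; clear => ucs' d2 VX d12 S4R subcs.
  by move: ucs'; mem_cases u.
- move=> u; rewrite mem_cat sE; have -> : (u \in cs) = (u \in [set u in cs]) by rewrite inE.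
  move: [set u in cs] => CS; rewrite /W3; move: cov; clear => cov; mem_cases u.
- have -> : take k (s ++ cs) = x by rewrite sx1 -catA take_size_cat.
  by rewrite sz -!catA; apply: kpath_glue; rewrite ?zk // -sz.
Qed.

(** * From cyclic sequences to powers of Hamilton cycles *)

Lemma next_index (T : eqType) (c : seq T) x x0 : uniq c -> x \in c ->
  next c x = nth x0 c ((index x c).+1 %% size c).
Proof.
move=> uc xc; rewrite next_nth xc; case: c uc xc => // y c uc xc.
have := xc; rewrite -index_mem; move: (index x (y :: c)) => i; rewrite [size _]/= => iy.
case: (ltngtP i.+1 (size c).+1) => [lt|gt|[E]].
- by rewrite modn_small //= (set_nth_default x0).
- by move: iy gt; rewrite ltnS => h1 h2; lia.
- by rewrite E modnn /= nth_default.
Qed.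

(** A walk makes [a] steps forward and [b] backward; keeping both numbers avoids signed
    positions. *)
Lemma cycle_graph_path (T : finType) (c : seq T) x s : uniq c -> x \in c ->
  path (cycle_graph c) x s -> exists a b, (a + b <= size s)%N /\
    (index x c + a = index (last x s) c + b %[mod size c])%N.
Proof.
move=> uc; elim: s x => [|y s IH] x xc /=; first by exists 0%N, 0%N.
case/andP => /and3P[_ yc nx] /(IH y yc)[a [b [ab E]]].
have step u v : u \in c -> v \in c -> next c u = v ->
    ((index u c).+1 = index v c %[mod size c])%N.
  move=> uc' vc nuv; have := next_index u uc uc'; rewrite nuv => ->.
  rewrite index_uniq ?modn_mod // ltn_mod; by case: c uc' {uc xc yc nx IH E vc nuv}.
case/orP: nx => /eqP nx; have E1 := step _ _ _ _ nx.
  exists a.+1, b; split; first by lia.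
  by rewrite addnS -addSn -modnDml E1 // modnDml.
exists a, b.+1; split; first by lia.
by rewrite -modnDml -E1 // modnDml addSn addnS -[(index y c + a).+1]addn1 -modnDml E modnDml addn1.
Qed.

Lemma Hamilton_of_kpath (T : finType) (e : rel T) k c : symmetric e -> irreflexive e ->
  (3 <= #|T|)%N -> uniq c -> (forall v, v \in c) -> kpath e k (c ++ take k c) ->
  has_power_Hamilton_cycle k e.
Proof.
move=> es ei T3 uc vc pc.
have sc : size c = #|T|.
  by rewrite -(card_uniqP uc); apply: eq_card => v; rewrite vc.
exists c; split=> //; first by rewrite sc.
have N0 : (0 < size c)%N by rewrite sc; lia.
have [x0 _] : exists x0, x0 \in c by case: c N0 {uc vc pc sc} => // x0 c _; exists x0; rewrite mem_head.
(* Otherwise a vertex would be adjacent to its own copy in [c ++ c], against irreflexivity. *)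
have kN : (k < size c)%N.
  rewrite ltnNge; apply/negP => Nk; move: pc; rewrite take_oversize // => /(kpathP _ _ x0).
  move/(_ 0%N (size c)); rewrite size_cat nth_cat N0 nth_cat ltnn subnn ei.
  by move=> H; have : false by apply: H; lia.
have adj i j : (i < size c)%N -> (0 < j <= k)%N ->
    e (nth x0 c i) (nth x0 c ((i + j) %% size c)).
  move=> iN jk; have /(kpathP _ _ x0)/(_ i (i + j)%N) := pc.
  rewrite size_cat size_takel ?(ltnW kN) // nth_cat iN nth_cat.
  have /andP[j0 jk'] := jk.
  rewrite -[X in (X < _)%N]addn0 ltn_add2l j0 -addSn leq_add // leq_add2l jk' => /(_ isT isT).
  case: (ltnP (i + j) (size c)) => ij; first by rewrite modn_small.
  have ijk : (i + j - size c < j)%N by rewrite ltn_subLR // ltn_add2r.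
  rewrite nth_take; last exact: leq_trans ijk jk'.
  by rewrite -{2}(subnK ij) modnDr modn_small // (ltn_trans ijk) // (leq_ltn_trans jk').
move=> x y /and3P[xy cxy dk].
have [/existsP[s /andP[ps /eqP ls]] _] := gdistP cxy.
have [a [b [ab E]]] := cycle_graph_path uc (vc x) ps; rewrite ls in E.
rewrite size_tuple in ab.
have ak : (a + b <= k)%N by lia.
have ix : (index x c < size c)%N by rewrite index_mem.
have iy : (index y c < size c)%N by rewrite index_mem.
have nxy : index x c != index y c.
  by apply: contraNneq xy => h; rewrite -(nth_index x0 (vc x)) h nth_index.
rewrite -[x](nth_index x0 (vc x)) -[y](nth_index x0 (vc y)).
(* The smaller number of steps cancels; the remaining [d - f] forward steps are not zero since [i]
   and [j] differ. *)
have main i j d f : (i < size c)%N -> (j < size c)%N -> i != j -> (f <= d)%N -> (d <= k)%N ->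
    (i + d = j + f %[mod size c])%N -> e (nth x0 c i) (nth x0 c j).
  move=> iN jN ij fd dk'; rewrite -{1}(subnK fd) addnA => /eqP; rewrite eqn_modDr => /eqP h.
  have := adj i (d - f)%N iN; rewrite h (modn_small jN); apply.
  rewrite (leq_trans (leq_subr _ _) dk') andbT lt0n; apply: contraNneq ij => d0.
  by move: h; rewrite d0 addn0 !modn_small // => ->.
case: (leqP b a) => ba; first by apply: (main _ _ a b) => //; lia.
by rewrite es; apply: (main _ _ b a) => //; [rewrite eq_sym|exact: ltnW|lia].
Qed.

Lemma power_cycle_of_good (R : realType) k (rg : rel nat) C : (0 < k)%N -> (forall a, (a < k)%N -> rg a k) ->
  connect_spec R k rg -> absorb_spec R k rg C ->
  forall beta : R, 0 < beta -> exists2 eta : R, 0 < eta &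
  forall (T : finType) (e : rel T) (p : R), good_graph e p rg eta -> (3 <= #|T|)%N ->
  (forall v, beta * p * #|T|%:R <= #|nb e v|%:R) -> has_power_Hamilton_cycle k e.
Proof.
move=> k0 rgk conn absorb beta b0.
(* The reservoirs have size [|T| / m0] rounded down: the first term leaves room for the absorbers of
   all their vertices, the second keeps them below [beta |T|]. *)
pose m0 := (20 * C.+1 + (Num.truncn beta^-1).+1)%N.
have m0b : beta^-1 <= m0%:R.
  have ib0 : 0 < beta^-1 by rewrite invr_gt0.
  have /andP[_ h] := truncn_itv (ltW ib0).
  by apply/ltW/(lt_le_trans h); rewrite ler_nat leq_addl.
have m0C : 20%:R + 20%:R * C%:R <= m0%:R :> R.
  by rewrite -natrM -natrD ler_nat /m0; lia.
have m00 : 0 < m0%:R :> R by rewrite ltr0n.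
have c0 : 0 <= C%:R :> R by []. have k0R : 0 <= k%:R :> R by [].
pose rho : R := (40%:R * C.+1%:R * m0%:R)^-1.
have C1 : 1 <= C.+1%:R :> R by rewrite ler1n.
have rho0 : 0 < rho by rewrite invr_gt0 !mulr_gt0.
have rho20 : 0 < 2%:R * rho by rewrite mulr_gt0.
have rhoE : rho * (40%:R * C.+1%:R * m0%:R) = 1.
  by rewrite mulVf // gt_eqF // !mulr_gt0.
have [eta1 e10 H1] := conn rho rho0.
have [eta2 e20 H2] := absorb rho rho0.
have [eta3 e30 H3] := absorb _ rho20.
pose K : R := 100%:R + 100%:R * C%:R + 100%:R * k%:R.
have K0 : 0 < K by rewrite /K; lra.
pose eta := Num.min (Num.min eta1 eta2) (Num.min eta3 (rho / K)).
have eta_gt0 : 0 < eta by rewrite !lt_min e10 e20 e30 divr_gt0.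
exists eta => // T e p gg T3 deg.
have le1 : eta <= eta1 by rewrite !ge_min lexx.
have le2 : eta <= eta2 by rewrite !ge_min lexx orbT.
have le3 : eta <= eta3 by rewrite !ge_min lexx !orbT.
have le4 : K * eta <= rho.
  by rewrite mulrC -ler_pdivlMr // !ge_min lexx !orbT.
have big : 1 <= eta * lev T p 0.
  have r := rgk 0%N k0; exact: (gg_big gg r).
have n0 : 0 < lev T p 0 by exact: lev_gt0 gg.
have r1 : rho <= m0%:R^-1.
  rewrite lef_pV2 ?posrE ?mulr_gt0 // ler_peMl ?(ltW m00) //; lra.
have n2 : 2%:R * m0%:R <= lev T p 0.
  have h : 100%:R * eta <= m0%:R^-1.
    apply: le_trans r1; apply: le_trans le4; rewrite ler_pM2r // /K; lra.
  have h2 : 100%:R * (eta * m0%:R) <= 1.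
    by rewrite mulrA -ler_pdivlMr // mul1r.
  have h3 : 100%:R * m0%:R * 1 <= 100%:R * m0%:R * (eta * lev T p 0).
    by rewrite ler_pM2l // mulr_gt0.
  have h4 : 100%:R * (eta * m0%:R) * lev T p 0 <= 1 * lev T p 0 by rewrite ler_pM2r.
  by rlra.
pose M := (#|T| %/ m0)%N.
have Mu : M%:R * m0%:R <= lev T p 0 by rewrite levn0 -natrM ler_nat leq_divM.
have Ml : lev T p 0 <= 2%:R * (M%:R * m0%:R).
  have h : lev T p 0 <= (M%:R + 1) * m0%:R.
    by rewrite levn0 natr1 -natrM ler_nat ltnW // ltn_ceil.
  by move: h n2; clear; move=> h n2; lra.
have [c [uc vc pc]] : exists c, [/\ uniq c, forall v, v \in c & kpath e k (c ++ take k c)].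
  apply: (@power_cycle_exists R k rg T e p eta C M rho beta); split=> //.
  - exact: H2 (good_graph_le le2 gg).
  - exact: H3 (good_graph_le le3 gg).
  - exact: H1 (good_graph_le le1 gg).
  - have h : (rho * (40%:R * C.+1%:R * m0%:R)) * lev T p 0 <= 2%:R * (M%:R * m0%:R).
      by rewrite rhoE mul1r.
    rewrite -(ler_pM2r m00); move: h; rewrite -natr1; clear; move=> h; lra.
  - have h : M%:R * (20%:R + 20%:R * C%:R) <= M%:R * m0%:R :> R by rewrite ler_wpM2l.
    by rlra.
  - have h : M%:R * beta^-1 <= lev T p 0 by apply: le_trans Mu; rewrite ler_wpM2l.
    by move: h; rewrite ler_pdivrMr // mulrC.
  - by apply: (le_trans r1); rewrite -[beta]invrK lef_pV2 ?posrE ?invr_gt0.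
  - by move: le4; rewrite /K; rlra.
exact: (Hamilton_of_kpath (gg_sym gg) (gg_irr gg) T3 uc vc pc).
Qed.

(** * From pseudorandomness to good graphs *)

(** Disjointness tells the two ends of an edge apart, so an unordered edge determines its ordered
    pair. *)
Lemma card_edges_between (T : finType) (e : rel T) (X Y : {set T}) : [disjoint X & Y] ->
  #|edges_between e X Y| = ecount e X Y.
Proof.
move=> dXY.
pose P := [set u : T * T | [&& u.1 \in X, u.2 \in Y & e u.1 u.2]].
have -> : edges_between e X Y = [set [set u.1; u.2] | u in P].
  apply/setP => E; apply/imset2P/imsetP => [[x y xX]|[[x y]]].
    by rewrite inE => /andP[yY exy] ->; exists (x, y); rewrite // inE /= xX yY.
  rewrite inE /= => /and3P[xX yY exy] ->; exists x y => //; by rewrite inE yY.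
rewrite card_in_imset; last first.
  move=> [x y] [x' y']; rewrite !inE /= => /and3P[xX yY _] /and3P[x'X y'Y _] E.
  have dis v : v \in X -> v \in Y -> False by move=> vX vY; move/pred0P/(_ v): dXY; rewrite /= vX vY.
  have : x \in [set x'; y'] by rewrite -E !inE eqxx.
  have : y \in [set x'; y'] by rewrite -E !inE eqxx orbT.
  rewrite !inE => /orP[/eqP y1|/eqP->]; first by case: (dis y) => //; rewrite y1.
  by case/orP => /eqP x1; [rewrite x1|case: (dis x) => //; rewrite x1].
rewrite /ecount -sum1_card (eq_bigl (fun u : T * T => (u.1 \in X) && (u.2 \in Y :&: nb e u.1))); last first.
  by move=> u; rewrite !inE.
rewrite -(pair_big_dep (mem X) (fun x y => y \in Y :&: nb e x) (fun _ _ => 1%N)) /=.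
by apply: eq_bigr => x _; rewrite sum1_card.
Qed.

Lemma pseudorandom_le (R : realType) (eps eps' p : R) a b (T : finType) (e : rel T) :
  0 < p -> eps <= eps' -> pseudorandom eps p a b e -> pseudorandom eps' p a b e.
Proof.
move=> p0 le H X Y dXY hX hY.
have le' c : eps * p ^+ c * #|T|%:R <= eps' * p ^+ c * #|T|%:R.
  by rewrite !ler_wpM2r // exprn_ge0 // ltW.
apply: lt_le_trans (H X Y dXY (le_trans (le' a) hX) (le_trans (le' b) hY)) _.
by rewrite !ler_wpM2r // ltW.
Qed.

Lemma complete_power_Hamilton (T : finType) k (e : rel T) : (3 <= #|T|)%N ->
  (forall x y, x != y -> e x y) -> has_power_Hamilton_cycle k e.
Proof.
move=> T3 H; exists (enum T); split; rewrite -?cardE ?enum_uniq //.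
  by move=> x; rewrite mem_enum inE.
by move=> x y /and3P[xy _ _]; exact: H.
Qed.

Lemma min_deg_le (T : finType) (e : rel T) v : (min_deg e <= #|nb e v|)%N.
Proof. by rewrite /min_deg (bigminD1 v) //=; exact: geq_minl. Qed.

Lemma power_Hamilton_of_pseudorandom (R : realType) k (rg : rel nat) C (L : seq (nat * nat)) :
  (0 < k)%N -> symmetric rg -> (forall a, (a < k)%N -> rg a k) ->
  connect_spec R k rg -> absorb_spec R k rg C ->
  (forall a b, rg a b -> exists2 ab, ab \in L & (a <= ab.1) && (b <= ab.2) || (b <= ab.1) && (a <= ab.2))%N ->
  (forall ab, ab \in L -> (ab.1 <= ab.2)%N) ->
  forall beta : R, 0 < beta -> exists2 eps : R, 0 < eps &
  forall p : R, 0 < p -> p < 1 ->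
  forall (T : finType) (e : rel T), symmetric e -> irreflexive e -> (3 <= #|T|)%N ->
  beta * p * #|T|%:R <= (min_deg e)%:R ->
  (forall ab, ab \in L -> pseudorandom eps p ab.1 ab.2 e) -> has_power_Hamilton_cycle k e.
Proof.
move=> k0 rgs rgk conn absorb HL Lle beta b0.
have [eta1 e10 H1] := power_cycle_of_good k0 rgk conn absorb b0.
have h0 : 0 < 2%:R^-1 :> R by rewrite invr_gt0.
have [eta2 e20 H2] := power_cycle_of_good k0 rgk conn absorb h0.
have [K LK] : exists K, forall ab, ab \in L -> (ab.2 <= K)%N.
  by exists (\max_(ab <- L) ab.2)%N => ab abL; exact: leq_bigmax_seq.
(* [lev] uses powers of [p / 16], the hypothesis powers of [p]; for exponents up to [K] the factor
   [s] covers the difference. *)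
have [s sE] : exists s : R, s = 16%:R ^- K by exists (16%:R ^- K).
have s0 : 0 < s by rewrite sE invr_gt0 exprn_gt0.
pose eps : R := Num.min (10%:R^-1) (Num.min (eta1 * s) (eta2 * s / 2%:R)).
have es1 : 0 < eta1 * s by rewrite mulr_gt0.
have es2 : 0 < eta2 * s / 2%:R by rewrite !mulr_gt0 // invr_gt0.
have eps0 : 0 < eps by rewrite /eps !lt_min es1 es2 !andbT; lra.
exists eps => // p p0 p1 T e es ei T3 deg PR.
have le1 : eps <= 10%:R^-1 by rewrite ge_min lexx.
have le2 : eps <= eta1 * s by rewrite !ge_min lexx orbT.
have le3 : eps <= eta2 * s / 2%:R by rewrite !ge_min lexx !orbT.
clearbody eps.
have n0 : 0 < #|T|%:R :> R by rewrite ltr0n; apply: leq_trans T3.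
have n3 : 3%:R <= #|T|%:R :> R by rewrite ler_nat.
have degv v : beta * p * #|T|%:R <= #|nb e v|%:R.
  by apply: le_trans deg _; rewrite ler_nat min_deg_le.
have PRe ab (X Y : {set T}) : ab \in L -> [disjoint X & Y] -> eps * p ^+ ab.1 * #|T|%:R <= #|X|%:R ->
    eps * p ^+ ab.2 * #|T|%:R <= #|Y|%:R ->
    `|(ecount e X Y)%:R - p * #|X|%:R * #|Y|%:R| < eps * p * #|X|%:R * #|Y|%:R.
  by move=> abL dXY hX hY; rewrite -card_edges_between //; exact: (PR ab abL X Y dXY hX hY).
have q16 (q : R) a b : 0 < q -> q <= 1 -> (a <= b)%N -> (a <= K)%N -> s * q ^+ b <= (q / 16%:R) ^+ a.
  move=> q0 q1 ab aK; rewrite expr_div_n mulrC; apply: ler_pM.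
  - by rewrite exprn_ge0 // ltW.
  - exact: ltW.
  - by apply: ler_wiXn2l => //; rewrite ltW.
  - by rewrite sE lef_pV2 ?posrE ?exprn_gt0 // ler_eXn2l // ltr1n.
have [/allP big|] := boolP (all (fun ab => 1 <= eps * p ^+ ab.2 * #|T|%:R) L).
  apply: (H1 T e p) => //.
  have cmp a c : (a <= c)%N -> (a <= K)%N -> eps * p ^+ c * #|T|%:R <= eta1 * lev T p a.
    move=> ac aK; rewrite levE mulrA ler_wpM2r //.
    apply: le_trans (_ : eta1 * s * p ^+ c <= _); first by rewrite ler_wpM2r // exprn_ge0 // ltW.
    by rewrite -mulrA ler_pM2l //; apply: q16 => //; exact: ltW.
  have half_reg a b : (exists2 ab, ab \in L & (a <= ab.1) && (b <= ab.2))%N -> reg e p eta1 a b.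
    case=> ab abL /andP[a1 b2] X Y dXY hX hY.
    have h2 := LK _ abL; have h1 := Lle _ abL.
    have := PRe ab X Y abL dXY _ _; rewrite ltr_norml.
    have hX' : eps * p ^+ ab.1 * #|T|%:R <= #|X|%:R by apply: le_trans hX; apply: cmp => //; nlia.
    have hY' : eps * p ^+ ab.2 * #|T|%:R <= #|Y|%:R by apply: le_trans hY; apply: cmp => //; nlia.
    move=> /(_ hX' hY') /andP[lo hi].
    have pos : 0 <= p * #|X|%:R * #|Y|%:R by rewrite !mulr_ge0 // ltW.
    have h3 : eps * (p * #|X|%:R * #|Y|%:R) <= 10%:R^-1 * (p * #|X|%:R * #|Y|%:R).
      by apply: ler_wpM2r.
    have E1 : eps * p * #|X|%:R * #|Y|%:R = eps * (p * #|X|%:R * #|Y|%:R) by rewrite !mulrA.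
    have E2 : p / 2%:R * #|X|%:R * #|Y|%:R = (p * #|X|%:R * #|Y|%:R) / 2%:R by ring.
    have E3 : 2%:R * p * #|X|%:R * #|Y|%:R = 2%:R * (p * #|X|%:R * #|Y|%:R) by rewrite !mulrA.
    rewrite E1 in lo hi; rewrite E2 E3; move: lo hi h3 pos; clear => lo hi h3 pos.
    by apply/andP; split; lra.
  split=> //; first exact: ltW.
  - by rewrite -(ltr0n R).
  - move=> a b /HL[ab abL /orP[h|h]]; first by apply: half_reg; exists ab.
    by apply: (reg_sym es); apply: half_reg; exists ab.
  - move=> a b /HL[ab abL h]; apply: le_trans (big ab abL) _; apply: cmp.
      by move: (Lle _ abL) h; case: (ab) => u v /=; clear; lia.
    by move: (Lle _ abL) (LK _ abL) h; case: (ab) => u v /=; clear; lia.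
case/allPn => ab abL; rewrite -ltNge => small.
(* By [small], the set [[set v]] is large enough for the condition, which forbids a large [X]
   without any edge to [v]. *)
have nonnb v : #|[set u | (u != v) && ~~ e v u]|%:R < eps * #|T|%:R.
  set X := [set u | _].
  apply: lt_le_trans (_ : eps * p ^+ ab.1 * #|T|%:R <= _); last first.
    rewrite ler_wpM2r // ler_piMr ?(ltW eps0) // exprn_ile1 // ltW //.
  rewrite ltNge; apply/negP => hX.
  have dX : [disjoint X & [set v]] by rewrite disjoint_sym disjoints1 !inE eqxx.
  have := PRe ab X [set v] abL dX hX _; rewrite cards1 => /(_ (ltW small)).
  have -> : ecount e X [set v] = 0%N.
    rewrite /ecount big1 // => u; rewrite inE => /andP[_ nvu]; apply/eqP; rewrite cards_eq0.
    by apply/eqP/setP => w; rewrite !inE; case: eqP => //= ->; rewrite es (negbTE nvu).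
  have X0 : 0 < #|X|%:R :> R by apply: lt_le_trans hX; rewrite !mulr_gt0 // exprn_gt0.
  rewrite !mulr1 sub0r normrN gtr0_norm ?mulr_gt0 // ltNge => /negP; apply.
  by rewrite -mulrA; apply: ler_piMl; [rewrite ltW // mulr_gt0|apply: le_trans le1 _; lra].
have [tiny|big] := ltP (eps * #|T|%:R) 1.
  apply: complete_power_Hamilton => // x y xy; apply: contraT => nxy.
  have := lt_trans (nonnb x) tiny; rewrite ltrn1 ltnS leqn0 cards_eq0 => /eqP E.
  by have := in_set0 y; rewrite -E inE eq_sym xy nxy.
(* Now all degrees are at least [n / 2], and every vertex of [X] sees more than half of any large
   [Y]: regularity with [p = 1], for all exponents up to [K]. *)
apply: (H2 T e 1) => //; last first.
  move=> v; rewrite mulr1; have h := nonnb v.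
  have : #|T|%:R <= #|nb e v|%:R + #|[set u | (u != v) && ~~ e v u]|%:R + 1 :> R.
    rewrite -natrD natr1 ler_nat -cardsT -addn1 -(cards1 v).
    apply: leq_trans (subset_leq_card (_ : _ \subset (nb e v :|: [set u | (u != v) && ~~ e v u]) :|: [set v])) _.
      by apply/subsetP => u _; rewrite !inE; case: (e v u) => //; case: (u == v).
    apply: leq_trans (leq_card_setU _ _) _; by rewrite leq_add2r leq_card_setU.
  have : eps * #|T|%:R <= 10%:R^-1 * #|T|%:R by rewrite ler_wpM2r.
  by rlra.
have cmp a : (a <= K)%N -> 2%:R * (eps * #|T|%:R) <= eta2 * lev T 1 a.
  move=> aK; rewrite levE mulrA mulrA ler_wpM2r //.
  have h := q16 1 a a ltr01 (lexx _) (leqnn _) aK; rewrite expr1n mulr1 in h.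
  have : eta2 * s <= eta2 * (1 / 16%:R) ^+ a by rewrite ler_pM2l.
  by rlra.
have rgK a b : rg a b -> (a <= K)%N && (b <= K)%N.
  by case/HL => ab' abL'; move: (Lle _ abL') (LK _ abL'); case: (ab') => u v /=; clear; lia.
split=> //.
- by rewrite -(ltr0n R).
- move=> a b /rgK/andP[aK bK] X Y dXY hX hY.
  have hY' : 2%:R * (eps * #|T|%:R) <= #|Y|%:R by apply: le_trans hY; exact: cmp.
  have lo x : x \in X -> 2%:R^-1 * #|Y|%:R <= #|Y :&: nb e x|%:R :> R.
    move=> xX; have : #|Y|%:R <= #|Y :&: nb e x|%:R + #|[set u | (u != x) && ~~ e x u]|%:R :> R.
      rewrite -natrD ler_nat; apply: leq_trans (leq_card_setU _ _).
      apply/subset_leq_card/subsetP => u uY; rewrite !inE uY; case: (e x u); rewrite //= andbT.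
      by apply: contraTneq uY => ->; apply/negP => xY; move/pred0P/(_ x): dXY; rewrite /= xX xY.
    by move=> h1; have h2 := nonnb x; rlra.
  rewrite mulr1 mul1r /ecount natr_sum; apply/andP; split.
    have -> : 2%:R^-1 * #|X|%:R * #|Y|%:R = \sum_(x in X) (2%:R^-1 * #|Y|%:R) :> R.
      by rewrite sumr_const -[RHS]mulr_natl; ring.
    exact: ler_sum.
  have -> : 2%:R * #|X|%:R * #|Y|%:R = \sum_(x in X) (2%:R * #|Y|%:R) :> R.
    by rewrite sumr_const -[RHS]mulr_natl; ring.
  apply: ler_sum => x _; apply: le_trans (_ : #|Y|%:R <= _); last by rewrite ler_peMl // ler1n.
  by rewrite ler_nat subset_leq_card // subsetIl.
- by move=> a b /rgK/andP[aK bK]; apply: le_trans (cmp a aK); lra.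
Qed.


Theorem theorem2 (R : realType) (k : nat) (beta : R) (hk : (2 <= k)%N)
    (hbeta : 0 < beta) :
  exists2 eps : R, 0 < eps &
    forall p : R, 0 < p -> p < 1 ->
    forall (T : finType) (e : rel T), symmetric e -> irreflexive e ->
      (3 <= #|T|)%N ->
      beta * p * #|T|%:R <= (min_deg e)%:R ->
      (pseudorandom eps p 1 2 e -> has_power_Hamilton_cycle 2 e) /\
      (pseudorandom eps p (k - 1) (2 * k - 1) e ->
       pseudorandom eps p k (k + 1) e -> has_power_Hamilton_cycle k e).
Proof.
have conn2 : connect_spec R 2 rg2.
  apply: connect_of_left => //; last exact: left_two.
  by move=> a b; rewrite /rg2; lia.
have rg2k a : (a < 2)%N -> rg2 a 2 by rewrite /rg2; lia.
have absorb2 := absorb_of_core (isT : (0 < 2)%N) rg2k (core_two conn2).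
have [||eps2 e20 H2] := power_Hamilton_of_pseudorandom (L := [:: (1, 2)%N]) (isT : (0 < 2)%N) rg2_sym rg2k
  conn2 absorb2 _ _ hbeta.
- by move=> a b; rewrite /rg2 => h; exists (1, 2)%N; rewrite ?inE //=; lia.
- by move=> ab; rewrite inE => /eqP->.
pose L := [:: (k - 1, 2 * k - 1); (k, k + 1)]%N.
(* The pairs of exponents covered by one of the two hypotheses, in either order. *)
pose rg : rel nat := fun a b =>
  [|| (a <= k - 1) && (b <= 2 * k - 1), (a <= k) && (b <= k + 1),
      (b <= k - 1) && (a <= 2 * k - 1) | (b <= k) && (a <= k + 1)]%N.
have rgs : symmetric rg by move=> a b; rewrite /rg; lia.
have k0 : (0 < k)%N by lia.
have rgk a : (a < k)%N -> rg a k by rewrite /rg; lia.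
have conn : connect_spec R k rg.
  apply: connect_of_left => //; first by move=> a b; rewrite /rg; lia.
    by rewrite /rg; lia.
  by apply: left_general => // a b; rewrite /rg; lia.
have core : core_spec R k rg (7 * k).
  by apply: core_general => // a b; rewrite /rg; lia.
have [||eps1 e10 H1] := power_Hamilton_of_pseudorandom (L := L) k0 rgs rgk
  conn (absorb_of_core k0 rgk core) _ _ hbeta.
- move=> a b; rewrite /rg => /or4P[] h; [exists (k - 1, 2 * k - 1)%N|exists (k, k + 1)%N|
    exists (k - 1, 2 * k - 1)%N|exists (k, k + 1)%N];
    by rewrite ?h ?orbT ?inE ?eqxx ?orbT.
- by move=> ab; rewrite !inE => /orP[] /eqP-> /=; lia.
exists (Num.min eps1 eps2) => [|p p0 p1 T e es ei T3 deg]; first by rewrite lt_min e10.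
split=> [P|P Q].
  apply: (H2 p) => // ab; rewrite inE => /eqP->.
  by apply: pseudorandom_le P; rewrite ?ge_min ?lexx ?orbT.
apply: (H1 p) => // ab; rewrite !inE => /orP[] /eqP->.
  by apply: pseudorandom_le P; rewrite ?ge_min ?lexx ?orbT.
by apply: pseudorandom_le Q; rewrite ?ge_min ?lexx ?orbT.
Qed.
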